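(* Let Assumption 1 (for the problem OGR) hold. Consider the closed-loop delayed system consisting of the power system (P), the generation dynamics (GD), the generation input (U), the controller (C), and the scattering communication protocol (S1)--(S2), all written out in the context, and consider an equilibrium point of this system in which Assumption 2 holds, i.e. $|\eta_{ij}^*|<\pi/2$ for all $(i,j)\in E$. The communication delays ($T_{ij}\ge 0$ for all $(i,j)\in\tilde E$, in both channel directions) are assumed to be constant, and are allowed to take arbitrary bounded values and be heterogeneous. Then there exists an open neighborhood $\Omega$ about this equilibrium point such that the solutions of the closed-loop system with initial conditions in $\Omega$ converge to an equilibrium point that solves the problem OGR (i.e. whose component $p^{M,*}$ is an optimal solution of OGR) with $\omega^*=\mathbf 0_{|N|}$.
   Context: **Network.** $\mathcal G(N,E)$ is a connected graph of buses $N=G\cup L$ (disjoint union of generation buses $G$ and load buses $L$) and transmission lines $E$, each line given an arbitrary orientation $(i,j)$, also written $i\to j$. $\mathcal G(N,\tilde E)$ is a connected undirected communication graph; $\tilde N_j$ is the set of communication neighbours of bus $j$. Communication weights satisfy $\alpha_{ij}=\alpha_{ji}>0$. **(P) Power system**, with constants $M_j>0$ ($j\in G$), $\Lambda_j>0$ ($j\in N$), $Y_{ij}=Y_{ji}>0$, and constant demands $p_j^L\in\mathbb R$ ($j\in N$): $\dot\eta_{ij}=\omega_i-\omega_j$, $(i,j)\in E$; $M_j\dot\omega_j=-p_j^L+p_j^M-\Lambda_j\omega_j-\sum_{k:j\to k}p_{jk}+\sum_{i:i\to j}p_{ij}$, $j\in G$; $0=-p_j^L-\Lambda_j\omega_j-\sum_{k:j\to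 k}p_{jk}+\sum_{i:i\to j}p_{ij}$, $j\in L$; $p_{ij}=Y_{ij}\sin\eta_{ij}$, $(i,j)\in E$. **(GD) Generation dynamics**, with $\tau_j,k_{g,j}>0$: $\tau_j\dot p_j^M=-p_j^M+k_{g,j}u_j$, $j\in G$. Set $p_j^M:=0$ for $j\notin G$. **(U) Generation input**, with $k_{c,j}>0$: $u_j=k_{c,j}(p_j^c-\omega_j)+\frac{p_j^M}{k_{g,j}}-k_{c,j}Q_j'(p_j^M)$, $j\in G$. **Problem OGR:** $\min_{p^M}\sum_{j\in G}Q_j(p_j^M)$ subject to $\sum_{j\in G}p_j^M=\sum_{j\in N}p_j^L$. **Assumption 1.** The functions $Q_j$, $j\in G$, are continuously differentiable and strictly convex, and the considered optimization problem is feasible, i.e. there exists an equilibrium point of (P),(GD) with $\omega=0$ such that the corresponding $p^M$ is a solution to the considered optimization problem. **(C) Controller**, for all $j\in N$: $\dot\rho_j^{\zeta}=-\rho_j^{\zeta}+\sum_{i\in\tilde N_j}\alpha_{ij}(r_{ij}^p-p_j^c)$, $\dot\zeta_j=-\rho_j^{\zeta}+2\sum_{i\in\tilde N_j}\alpha_{ij}(r_{ij}^p-p_j^c)$, $\dot\rho_j^{p}=-\rho_j^{p}-(p_j^M-p_j^L)-\sum_{i\in\tilde N_j}\alpha_{ij}(r_{ij}^\zeta-\zeta_j)$, $\dot p_j^c=-\rho_j^{p}-2(p_j^M-p_j^L)-2\sum_{i\in\tilde N_j}\alpha_{ij}(r_{ij}^\zeta-\zeta_j)$. Here $r_{ij}^p,r_{ij}^\zeta$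 are signals formed at bus $j$ from what it receives from bus $i$. **(S1) Scattering transformation**, for each $(i,j)\in\tilde E$ (variables in $\mathbb R^2$), with $r_{ij}=(r_{ij}^p,r_{ij}^\zeta)^T$, $r_{ji}=(r_{ji}^p,r_{ji}^\zeta)^T$, $y_i=(\zeta_i,-p_i^c)^T$, $y_j=(\zeta_j,-p_j^c)^T$: $s_{\overrightarrow{ij}}=-\frac1{\sqrt2}(r_{ji}-y_i)$, $s_{\overleftarrow{ij}}=-\frac1{\sqrt2}(r_{ji}+y_i)$, $s_{\overleftarrow{ji}}=\frac1{\sqrt2}(r_{ij}+y_j)$, $s_{\overrightarrow{ji}}=\frac1{\sqrt2}(r_{ij}-y_j)$. **(S2) Delayed transmission**, with $E_s=\begin{bmatrix}0&-1\\1&0\end{bmatrix}$: $s_{\overleftarrow{ij}}(t)=E_s s_{\overrightarrow{ji}}(t-T_{ji})$, $s_{\overleftarrow{ji}}(t)=E_s s_{\overrightarrow{ij}}(t-T_{ij})$, where $T_{ij}$ is the delay of channel $i\to j$ and $T_{ji}$ that of channel $j\to i$, and where $s_{\overrightarrow{ji}}(t)=\mathbf 0$ and $s_{\overrightarrow{ij}}(t)=\mathbf 0$ for all $t<0$. Variables without subscripts denote stacked vectors; the superscript $*$ denotes the value at an equilibrium point.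
   Formalization: Zero prehistory s(t)=0, t<0, contradicts an equilibrium with s*≠0, so the initial waves in the channels are part of the initial condition and Ω asks them to be near s*; convergence is of η, ω, p^M, ρ, ζ, p^c, not of the signals r, s, whose jumps persist forever. *)

(* Defs.v *)
From HB Require Import structures.
From mathcomp Require Import all_boot all_order all_algebra.
From mathcomp Require Import all_classical all_reals all_analysis.

Set Implicit Arguments.
Unset Strict Implicit.
Unset Printing Implicit Defensive.

Import Order.TTheory GRing.Theory Num.Theory.
Import numFieldNormedType.Exports.

Local Open Scope classical_set_scope.
Local Open Scope ring_scope.

(* Each undirected edge of [line] and of [comm] is represented by exactly one
   ordered pair, its (arbitrary) orientation.  The two channels of a
   communication edge (i, j) are (i, j) and (j, i); [delay i j] is the delay of
   the channel from i to j.  Load buses are the complement of [gen]. *)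
Record network (R : realType) (N : finType) := Network {
  gen : {set N};
  line : {set N * N};
  comm : {set N * N};
  inertia : N -> R;              (* M_j *)
  damping : N -> R;              (* Lambda_j *)
  demand : N -> R;               (* p^L_j *)
  suscept : N -> N -> R;         (* Y_ij *)
  turbine : N -> R;              (* tau_j *)
  kg : N -> R;
  kc : N -> R;
  cost : N -> R -> R;            (* Q_j *)
  alpha : N -> N -> R;
  delay : N -> N -> R            (* T_ij *)
}.

Section Network.
Context {R : realType} {N : finType}.
Implicit Types (S : network R N).

Definition adjacent (E : {set N * N}) : rel N :=
  fun i j => ((i, j) \in E) || ((j, i) \in E).

Record well_formed S : Prop := WellFormed {
  line_oriented : forall i j, (i, j) \in line S -> (j, i) \notin line S;
  line_connected : forall i j, connect (adjacent (line S)) i j;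
  comm_oriented : forall i j, (i, j) \in comm S -> (j, i) \notin comm S;
  comm_connected : forall i j, connect (adjacent (comm S)) i j;
  inertia_gt0 : forall j, j \in gen S -> 0 < inertia S j;
  damping_gt0 : forall j, 0 < damping S j;
  suscept_gt0 : forall i j, adjacent (line S) i j -> 0 < suscept S i j;
  susceptC : forall i j, adjacent (line S) i j -> suscept S i j = suscept S j i;
  turbine_gt0 : forall j, j \in gen S -> 0 < turbine S j;
  kg_gt0 : forall j, j \in gen S -> 0 < kg S j;
  kc_gt0 : forall j, j \in gen S -> 0 < kc S j;
  alpha_gt0 : forall i j, adjacent (comm S) i j -> 0 < alpha S i j;
  alphaC : forall i j, adjacent (comm S) i j -> alpha S i j = alpha S j i;
  delay_ge0 : forall i j, adjacent (comm S) i j -> 0 <= delay S i j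
}.

(* Values of all signals at one instant.  [eta] is meaningful on [line]; [r],
   [sout], [sinc] on pairs adjacent in [comm]: [r x i j] is r_ij (formed at j
   from what comes from i), [sout x i j] is the wave s_{ij} with right arrow
   (leaving i towards j), [sinc x i j] the one with left arrow (reaching i
   from j). *)
Record signals := Signals {
  eta : N * N -> R;
  omega : N -> R;
  pM : N -> R;
  rhozeta : N -> R;
  zeta : N -> R;
  rhop : N -> R;
  pc : N -> R;
  r : N -> N -> 'cV[R]_2;
  sout : N -> N -> 'cV[R]_2;
  sinc : N -> N -> 'cV[R]_2
}.
Implicit Types (x : signals) (X : R -> signals).

Definition vec2 (a b : R) : 'cV[R]_2 := \col_k (if k == 0 then a else b).

Definition Es : 'M[R]_2 :=
  \matrix_(k, l) (if k == l then 0 else if k == 0 then -1 else 1).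

Definition rp x i j : R := r x i j 0 0.
Definition rzeta x i j : R := r x i j 1 0.
Definition y x i : 'cV[R]_2 := vec2 (zeta x i) (- pc x i).

Definition flow S x i j : R := suscept S i j * sin (eta x (i, j)).

Definition imbalance S x j : R :=
  - demand S j - damping S j * omega x j
  - \sum_(k | (j, k) \in line S) flow S x j k
  + \sum_(i | (i, j) \in line S) flow S x i j.

Definition gen_input S x j : R :=
  kc S j * (pc x j - omega x j) + pM x j / kg S j
  - kc S j * derive1 (cost S j) (pM x j).

Definition comm_p S x j : R :=
  \sum_(i | adjacent (comm S) i j) alpha S i j * (rp x i j - pc x j).
Definition comm_zeta S x j : R :=
  \sum_(i | adjacent (comm S) i j) alpha S i j * (rzeta x i j - zeta x j).

(* [evolves f g] is to be read "d/dt f = g"; it is instantiated below both by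
   trajectories and by stationary points. *)
Section Dynamics.
Variable evolves : (signals -> R) -> (signals -> R) -> Prop.

Definition power_dynamics S : Prop :=
  (forall i j, (i, j) \in line S ->
     evolves (fun x => eta x (i, j)) (fun x => omega x i - omega x j)) /\
  (forall j, j \in gen S ->
     evolves (fun x => inertia S j * omega x j)
             (fun x => pM x j + imbalance S x j)).

Definition gen_dynamics S (u : signals -> N -> R) : Prop :=
  forall j, j \in gen S ->
    evolves (fun x => turbine S j * pM x j)
            (fun x => - pM x j + kg S j * u x j).

Definition controller_dynamics S : Prop :=
  forall j,
  [/\ evolves (fun x => rhozeta x j) (fun x => - rhozeta x j + comm_p S x j),
      evolves (fun x => zeta x j) (fun x => - rhozeta x j + 2 * comm_p S x j),
      evolves (fun x => rhop x j)
        (fun x => - rhop x j - (pM x j - demand S j) - comm_zeta S x j)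
    & evolves (fun x => pc x j)
        (fun x => - rhop x j - 2 * (pM x j - demand S j)
                  - 2 * comm_zeta S x j)].

Definition closed_loop_dynamics S : Prop :=
  [/\ power_dynamics S, gen_dynamics S (gen_input S) & controller_dynamics S].
End Dynamics.

Definition load_balance S x : Prop :=
  (forall j, j \notin gen S -> 0 = imbalance S x j) /\
  (forall j, j \notin gen S -> pM x j = 0).

Definition scattering S x : Prop :=
  forall i j, (i, j) \in comm S ->
  [/\ sout x i j = - (Num.sqrt 2)^-1 *: (r x j i - y x i),
      sinc x i j = - (Num.sqrt 2)^-1 *: (r x j i + y x i),
      sinc x j i = (Num.sqrt 2)^-1 *: (r x i j + y x j)
    & sout x j i = (Num.sqrt 2)^-1 *: (r x i j - y x j)].

Definition transmission S X : Prop :=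
  forall t, 0 <= t -> forall i j, (i, j) \in comm S ->
    sinc (X t) i j = Es *m sout (X (t - delay S j i)) j i /\
    sinc (X t) j i = Es *m sout (X (t - delay S i j)) i j.

(* Caratheodory sense: the waves, hence the derivatives of the controller
   states, jump at the times at which wave fronts arrive. *)
Definition integrates X (f g : signals -> R) : Prop :=
  forall t, 0 <= t ->
    lebesgue_measure.-integrable `[0, t] (fun s => (g (X s))%:E) /\
    f (X t) = f (X 0) + \int[lebesgue_measure]_(s in `[0, t]) g (X s).

(* Only [sout (X t)] matters for t < 0: it is the initial content of the
   channels. *)
Definition solution S X : Prop :=
  [/\ closed_loop_dynamics (integrates X) S,
      forall t, 0 <= t -> load_balance S (X t) /\ scattering S (X t),
      transmission S X
    & forall i j, adjacent (comm S) i j -> forall k,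
        measurable_fun [set: R] (fun t : R => sout (X t) i j k 0)].

Definition vanishes x (_ g : signals -> R) : Prop := g x = 0.

Definition equilibrium S x : Prop :=
  [/\ closed_loop_dynamics (vanishes x) S, load_balance S x, scattering S x
    & transmission S (fun=> x)].

Definition OGR_feasible S (p : N -> R) : Prop :=
  \sum_(j in gen S) p j = \sum_j demand S j.

Definition solves_OGR S (p : N -> R) : Prop :=
  OGR_feasible S p /\
  forall q, OGR_feasible S q ->
    \sum_(j in gen S) cost S j (p j) <= \sum_(j in gen S) cost S j (q j).

Definition strictly_convex (f : R -> R) : Prop :=
  forall a b t, a != b -> 0 < t < 1 ->
    f (t * a + (1 - t) * b) < t * f a + (1 - t) * f b.

Definition continuously_differentiable (f : R -> R) : Prop :=
  (forall a, derivable f a 1) /\ continuous (derive1 f).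

(* In the second clause the generation input is a free constant:
   it is an equilibrium of the power system and generation dynamics alone. *)
Definition assumption1 S : Prop :=
  (forall j, j \in gen S ->
     continuously_differentiable (cost S j) /\ strictly_convex (cost S j)) /\
  (exists x (u : N -> R),
     [/\ power_dynamics (vanishes x) S, gen_dynamics (vanishes x) S (fun=> u),
         load_balance S x, forall j, omega x j = 0 & solves_OGR S (pM x)]).

Definition assumption2 S x : Prop :=
  forall i j, (i, j) \in line S -> `|eta x (i, j)| < pi / 2.

(* Space of initial conditions of the delay system: the values at time 0 of
   (eta, (omega, p^M), (rho^zeta, zeta), (rho^p, p^c)) and the waves still in
   transit in the channels.  All components carry the topology of uniform
   convergence, on the lines for eta and, for the waves, on the channels (i, j)
   and the times in [- T_ij, 0[ (values elsewhere are not seen by the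
   topology). *)
Definition channel_window S : set (N * N * R) :=
  [set q | adjacent (comm S) q.1.1 q.1.2 /\ - delay S q.1.1 q.1.2 <= q.2 < 0].

Definition phase S : topologicalType :=
  ({uniform` [set e | e \in line S] -> R^o} *
   ({uniform N -> R^o} * {uniform N -> R^o}) *
   ({uniform N -> R^o} * {uniform N -> R^o}) *
   ({uniform N -> R^o} * {uniform N -> R^o}) *
   {uniform` channel_window S -> 'cV[R]_2})%type.

Definition initial_condition S X : phase S :=
  (eta (X 0), (omega (X 0), pM (X 0)), (rhozeta (X 0), zeta (X 0)),
   (rhop (X 0), pc (X 0)),
   fun q : N * N * R => sout (X q.2) q.1.1 q.1.2).

(* Convergence is that of the states of the differential equations and of the
   frequencies of load buses.  It leaves out the waves: their jumps are
   reflected at the buses with unit gain and never decay. *)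
Definition converges_to S X x : Prop :=
  (forall i j, (i, j) \in line S ->
     eta (X t) (i, j) @[t --> +oo] --> eta x (i, j)) /\
  (forall j,
    omega (X t) j @[t --> +oo] --> omega x j /\
    pM (X t) j @[t --> +oo] --> pM x j /\
    rhozeta (X t) j @[t --> +oo] --> rhozeta x j /\
    zeta (X t) j @[t --> +oo] --> zeta x j /\
    rhop (X t) j @[t --> +oo] --> rhop x j /\
    pc (X t) j @[t --> +oo] --> pc x j).

End Network.
Arguments signals : clear implicits.

(* Main.v *)
Require Import Defs.
From HB Require Import structures.
From mathcomp Require Import all_boot all_order all_algebra.
From mathcomp Require Import all_classical all_reals all_analysis.
From mathcomp Require Import measurable_realfun.
From mathcomp Require Import lra ring.

Set Implicit Arguments.
Unset Strict Implicit.
Unset Printing Implicit Defensive.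

Import Order.TTheory GRing.Theory Num.Theory.
Import numFieldNormedType.Exports.

Local Open Scope classical_set_scope.
Local Open Scope ring_scope.

(* Scaling the wave that leaves i towards j by +-sqrt 2 (the sign depends on the
   orientation of the edge) turns the scattering protocol into the symmetric
   relations U_ij(t) = V_ji(t - T_ji) + 2 zeta_i(t) and
   V_ij(t) = - U_ji(t - T_ji) - 2 p^c_i(t), in which the channels are lossless:
   the energy of the waves in transit absorbs the power exchanged with the
   controllers.  Added to quadratic storages for the controllers, the rotors and
   the turbines and to the potential energy of the lines, it gives a functional
   whose derivative is minus a sum of Lambda omega^2, (rho^zeta)^2, (rho^p)^2 and
   (p^M - p)(Q'(p^M) - Q'(p)), p being the equilibrium value of p^M; these
   quantities tend to 0 by Barbalat's lemma, and near the equilibrium the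
   functional keeps the angles away from pi/2.

   The waves themselves need not converge, so there is no compactness to invoke.
   However zeta and p^c vary slowly, since zeta - 2 rho^zeta and p^c - 2 rho^p
   have the vanishing derivatives rho^zeta and rho^p.  Integrals of the waves
   over an interval of length h agree up to O(1) with those of the waves at rest,
   hence so do the inflows, whose integrals are bounded: averaging over long
   intervals shows that the Laplacians of p^c and zeta vanish asymptotically.
   Averaging the conservation law of the controllers and the channels in the same
   way gives the convergence of the common values. *)

(** * Calculus of integrals of locally bounded functions *)

Section LocallyBounded.
Context {R : realType}.
Notation mu := (@lebesgue_measure R).
Implicit Types (f g F : R -> R) (a b c k : R).

(** The waves jump, so the derivatives of the controller states are only measurable; and some delays
    may vanish while others do not. Hence F' = f is used in integrated form, within a class of
    functions stable under products and time shifts, and the chain rule is proved in that form. On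
    an instantaneous channel the energy in transit is zero and bounds nothing: there the waves are
    controlled through the return channel or, if it is instantaneous too, algebraically. In all
    cases only integrals of their squares are bounded, so the uniform continuity of [rhozeta] and
    [rhop] is drawn from integrals over short intervals rather than from a bounded derivative. The
    limit need not be the given equilibrium: other angles with the same net flows, a common shift of
    [zeta] and, without generators, a common shift of [p^c] are also at rest. Convergence to some
    limit is therefore proved for each state, for the angles by strong monotonicity of sine along
    increments that are differences of node potentials. *)

Definition loc_bounded f :=
  measurable_fun [set: R] f /\
  forall b, exists K, forall t, `|t| <= b -> `|f t| <= K.

Lemma loc_bounded_ge0 f b : loc_bounded f ->
  exists2 K, 0 <= K & forall t, `|t| <= b -> `|f t| <= K.
Proof.
move=> [_ /(_ b)[K fK]]; exists `|K| => // t tb.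
exact: le_trans (fK _ tb) (ler_norm _).
Qed.

Lemma loc_bounded_cst k : loc_bounded (fun=> k).
Proof. by split=> [|b]; [exact: measurable_cst | exists `|k|]. Qed.

Lemma loc_boundedD f g : loc_bounded f -> loc_bounded g ->
  loc_bounded (fun t => f t + g t).
Proof.
move=> lf lg; split=> [|b]; first exact: measurable_funD lf.1 lg.1.
have [K _ fK] := loc_bounded_ge0 b lf; have [L _ gL] := loc_bounded_ge0 b lg.
exists (K + L) => t tb.
by rewrite (le_trans (ler_normD _ _))// lerD ?fK ?gL.
Qed.

Lemma loc_boundedM f g : loc_bounded f -> loc_bounded g ->
  loc_bounded (fun t => f t * g t).
Proof.
move=> lf lg; split=> [|b]; first exact: measurable_funM lf.1 lg.1.
have [K _ fK] := loc_bounded_ge0 b lf; have [L _ gL] := loc_bounded_ge0 b lg.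
by exists (K * L) => t tb; rewrite normrM ler_pM ?fK ?gL.
Qed.

Lemma loc_boundedZ k f : loc_bounded f -> loc_bounded (fun t => k * f t).
Proof. exact/loc_boundedM/loc_bounded_cst. Qed.

Lemma eq_loc_bounded f g : f =1 g -> loc_bounded f -> loc_bounded g.
Proof. by move=> /funext ->. Qed.

Lemma loc_boundedN f : loc_bounded f -> loc_bounded (fun t => - f t).
Proof.
move=> /(loc_boundedZ (-1)); apply: eq_loc_bounded => t.
by rewrite mulN1r.
Qed.

Lemma loc_boundedB f g : loc_bounded f -> loc_bounded g ->
  loc_bounded (fun t => f t - g t).
Proof. by move=> lf /loc_boundedN; exact: loc_boundedD. Qed.

Lemma loc_boundedX f n : loc_bounded f -> loc_bounded (fun t => f t ^+ n).
Proof.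
move=> lf; elim: n => [|n IH].
  by apply: (eq_loc_bounded _ (loc_bounded_cst 1)) => t; rewrite expr0.
by apply: (eq_loc_bounded _ (loc_boundedM lf IH)) => t; rewrite exprS.
Qed.

Lemma loc_bounded_sum (I : Type) (r : seq I) (P : pred I) (h : I -> R -> R) :
  (forall i, P i -> loc_bounded (h i)) ->
  loc_bounded (fun t => \sum_(i <- r | P i) h i t).
Proof.
move=> lh; elim: r => [|i r IH].
  by apply: (eq_loc_bounded _ (loc_bounded_cst 0)) => t; rewrite big_nil.
have [Pi|nPi] := boolP (P i).
  apply: (eq_loc_bounded _ (loc_boundedD (lh i Pi) IH)) => t.
  by rewrite big_cons Pi.
by apply: (eq_loc_bounded _ IH) => t; rewrite big_cons (negbTE nPi).
Qed.

Lemma loc_bounded_norm f : loc_bounded f -> loc_bounded (fun t => `|f t|).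
Proof.
move=> [mf bf]; split; first exact: measurableT_comp.
by move=> b; have [K fK] := bf b; exists K => t tb; rewrite normr_id fK.
Qed.

Lemma loc_bounded_shift f c : loc_bounded f -> loc_bounded (fun t => f (t - c)).
Proof.
move=> [mf bf]; split.
  by apply: (measurableT_comp mf); exact: measurable_funB.
move=> b; have [K fK] := bf (b + `|c|); exists K => t tb; apply: fK.
by rewrite (le_trans (ler_normB _ _))// lerD2r.
Qed.

Lemma loc_bounded_continuous f : continuous f -> loc_bounded f.
Proof.
move=> cf; split; first exact: continuous_measurable_fun.
move=> b; have [b0|b0] := ltP b 0.
  by exists 0 => t tb; have := le_lt_trans tb b0; rewrite normr_lt0.
have bb : - b <= b by lra.
have cN : {within `[- b, b], continuous (fun t => `|f t|)}.
  apply: continuous_subspaceT => t.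
  by apply: continuous_comp; [exact: cf | exact: norm_continuous].
have [c _ fc] := EVT_max bb cN.
by exists `|f c| => t tb; apply: fc; rewrite in_itv /= -ler_norml.
Qed.

Lemma loc_bounded_integrable f a b : loc_bounded f ->
  mu.-integrable `[a, b[ (EFin \o f).
Proof.
move=> lf; apply: measurable_bounded_integrable => //.
- rewrite /= lebesgue_measure_itv /=; case: ifP => // _.
  by rewrite -EFinD ltry.
- exact: measurable_funTS lf.1.
- have [K _ fK] := loc_bounded_ge0 (Num.max `|a| `|b|) lf.
  exists K; split; first exact: num_real.
  move=> M KM t /=; rewrite in_itv /= => /andP[ta tb].
  rewrite (le_trans _ (ltW KM))// fK// le_max.
  have [t0|t0] := leP 0 t.
    by rewrite (ger0_norm t0) (le_trans (ltW tb) (ler_norm _)) orbT.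
  by rewrite (ltr0_norm t0) (@le_trans _ _ (- a)) ?lerN2// -normrN ler_norm.
Qed.

(** Half-open, so that adjacent intervals are disjoint and a channel content, made of the waves sent
    during [[t - T, t[], leaves out the wave being emitted; at time 0 this is exactly the window
    that [initial_condition] sees. *)
Definition intco f a b := \int[mu]_(t in `[a, b[) f t.

Section Integral.
Variables (f g : R -> R).
Hypotheses (lf : loc_bounded f) (lg : loc_bounded g).

Lemma intco_eq h a b : (forall t, a <= t < b -> f t = h t) ->
  intco f a b = intco h a b.
Proof. by move=> fh; apply: eq_Rintegral => t; rewrite inE /= in_itv; exact: fh. Qed.

Lemma intco_empty a : intco f a a = 0.
Proof. by rewrite /intco set_itv_ge ?Rintegral_set0// bnd_simp ltxx. Qed.

Lemma intco_split b a c : a <= b -> b <= c ->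
  intco f a c = intco f a b + intco f b c.
Proof.
move=> ab bc; rewrite /intco (@itv_bndbnd_setU _ _ _ (BLeft b))//.
rewrite Rintegral_setU//.
- by rewrite -itv_bndbnd_setU//; exact: loc_bounded_integrable.
- apply/disj_setPS => t [/=]; rewrite !in_itv/= => /andP[_ tb] /andP[].
  by rewrite leNgt tb.
Qed.

Lemma intcoD a b :
  intco (fun t => f t + g t) a b = intco f a b + intco g a b.
Proof. by rewrite /intco RintegralD//; exact: loc_bounded_integrable. Qed.

Lemma intcoB a b :
  intco (fun t => f t - g t) a b = intco f a b - intco g a b.
Proof. by rewrite /intco RintegralB//; exact: loc_bounded_integrable. Qed.

Lemma intcoZ k a b : intco (fun t => k * f t) a b = k * intco f a b.
Proof. by rewrite /intco RintegralZl//; exact: loc_bounded_integrable. Qed.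

Lemma intco_cst k a b : a <= b -> intco (fun=> k) a b = k * (b - a).
Proof.
move=> ab; rewrite /intco Rintegral_cst//= lebesgue_measure_itv /= lte_fin.
case: ltP => // ba; have -> : a = b by lra.
by rewrite subrr.
Qed.

Lemma intco_le a b : (forall t, a <= t < b -> f t <= g t) ->
  intco f a b <= intco g a b.
Proof.
move=> fg; apply: le_Rintegral => //.
- exact: loc_bounded_integrable.
- exact: loc_bounded_integrable.
Qed.

Lemma intco_ge0 a b : (forall t, a <= t < b -> 0 <= f t) ->
  0 <= intco f a b.
Proof. by move=> f0; apply: Rintegral_ge0 => t /=; rewrite in_itv; exact: f0. Qed.

Lemma intco_norm a b :
  `|intco f a b| <= intco (fun t => `|f t|) a b.
Proof. by apply: le_normr_Rintegral => //; exact: loc_bounded_integrable. Qed.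

Lemma intco_shift c a b :
  intco (fun t => f (t - c)) a b = intco f (a - c) (b - c).
Proof.
pose phi (t : measurableTypeR R) : measurableTypeR R := t - c.
have mphi : measurable_fun [set: _] phi by exact: measurable_funB.
(* Translation invariance: a measure that gives each interval []x, y]] its length is the Lebesgue
   measure. *)
have eqmu (A : set R) : measurable A -> pushforward mu phi A = mu A.
  move=> mA; apply/esym/lebesgue_measure_unique => //= _ [[x y]] _ <-.
  rewrite /pushforward.
  have -> : phi @^-1` `]x, y] = `]x + c, y + c]%classic.
    by apply/seteqP; split=> t /=; rewrite !in_itv /= ltrBrDr lerBlDr.
  rewrite !lebesgue_measure_itv /= !lte_fin ltrD2r.
  by case: ifP => // _; rewrite -!EFinD; congr _%:E; lra.
have pre : phi @^-1` `[a - c, b - c[ = `[a, b[%classic.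
  by apply/seteqP; split=> t /=; rewrite !in_itv /= lerD2r ltrD2r.
rewrite /intco /Rintegral; congr fine.
transitivity (\int[pushforward mu phi]_(t in `[(a - c)%R, (b - c)%R[) (f t)%:E)%E;
  last by apply: eq_measure_integral => A mA _; exact: eqmu.
rewrite integral_pushforward ?pre//.
- by apply/measurable_EFinP; exact: lf.1.
- exact: (loc_bounded_integrable a b (loc_bounded_shift c lf)).
Qed.
End Integral.

End LocallyBounded.

(** * Integrated derivatives, chain rule and sliding windows *)

Section Primitive.
Context {R : realType}.
Implicit Types (f g F G D h : R -> R) (a b c k : R).

Lemma intco_bound f k a b : loc_bounded f -> a <= b ->
  (forall t, a <= t < b -> `|f t| <= k) -> `|intco f a b| <= k * (b - a).
Proof.
move=> lf ab fk; rewrite (le_trans (intco_norm lf _ _))//.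
rewrite -(intco_cst k ab); apply: intco_le => //.
- exact: loc_bounded_norm.
- exact: loc_bounded_cst.
Qed.

Lemma intco_mono f a b a' b' : loc_bounded f ->
  (forall t, a <= t < b -> 0 <= f t) -> a <= a' -> a' <= b' -> b' <= b ->
  intco f a' b' <= intco f a b.
Proof.
move=> lf f0 aa ab bb.
rewrite (@intco_split _ f lf a' a b)//; last exact: le_trans bb.
rewrite (@intco_split _ f lf b' a' b)//.
have h1 : 0 <= intco f a a'.
  by apply: intco_ge0 => t /andP[t1 t2]; apply: f0; rewrite t1/=; lra.
have h2 : 0 <= intco f b' b.
  by apply: intco_ge0 => t /andP[t1 t2]; apply: f0; rewrite t2 andbT; lra.
by lra.
Qed.

Lemma intco_sum (I : Type) (r : seq I) (P : pred I) (h : I -> R -> R) a b :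
  (forall i, P i -> loc_bounded (h i)) ->
  intco (fun t => \sum_(i <- r | P i) h i t) a b =
  \sum_(i <- r | P i) intco (h i) a b.
Proof.
move=> lh; elim: r => [|i r IH].
  rewrite big_nil (@intco_eq _ _ (fun t => 0 * 0)); last first.
    by move=> t _; rewrite big_nil mulr0.
  by rewrite (intcoZ (loc_bounded_cst 0)) mul0r.
rewrite big_cons; case: ifPn => Pi; last first.
  by rewrite -IH; apply: intco_eq => t _; rewrite big_cons (negbTE Pi).
rewrite -IH -intcoD//; last exact: loc_bounded_sum.
  by apply: intco_eq => t _; rewrite big_cons Pi.
exact: lh.
Qed.

(** Cutting [[0, t]] into n + 1 equal steps leaves a variation of at most C t^2 / (n + 1). This
    stands in for a vanishing derivative where no pointwise derivative need exist. *)
Lemma eq0_of_quadratic_increments F b C :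
  (forall s t : R, 0 <= s -> s <= t -> t <= b ->
     `|F t - F s| <= C * (t - s) ^+ 2) ->
  forall t : R, 0 <= t <= b -> F t = F 0.
Proof.
move=> FC t /andP[t0 tb].
have step n : `|F t - F 0| <= C * t ^+ 2 / n.+1%:R.
  set d := t / n.+1%:R.
  have n0 : 0 < n.+1%:R :> R by rewrite ltr0n.
  have d0 : 0 <= d by rewrite divr_ge0// ltW.
  have dn : d * n.+1%:R = t by rewrite /d mulfVK// lt0r_neq0.
  have kd (k : nat) : (k <= n.+1)%N -> `|F (k%:R * d) - F 0| <= k%:R * (C * d ^+ 2).
    elim: k => [_|k IH kn]; first by rewrite !mul0r subrr normr0.
    have h1 := IH (ltnW kn).
    have h2 : `|F (k.+1%:R * d) - F (k%:R * d)| <= C * d ^+ 2.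
      rewrite (_ : d ^+ 2 = (k.+1%:R * d - k%:R * d) ^+ 2); last first.
        by rewrite -natr1; ring.
      apply: FC; first by rewrite mulr_ge0.
      - by rewrite ler_wpM2r// ler_nat.
      - by rewrite (le_trans _ tb)// -dn mulrC ler_wpM2l// ler_nat.
    have -> : F (k.+1%:R * d) - F 0 =
      (F (k.+1%:R * d) - F (k%:R * d)) + (F (k%:R * d) - F 0) by ring.
    have -> : k.+1%:R * (C * d ^+ 2) = k%:R * (C * d ^+ 2) + C * d ^+ 2.
      by rewrite -natr1; ring.
    by rewrite (le_trans (ler_normD _ _))//; lra.
  have := kd _ (leqnn _); rewrite mulrC dn => /le_trans; apply.
  by rewrite le_eqVlt; apply/orP; left; apply/eqP; rewrite /d; field;
    rewrite lt0r_neq0.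
apply/eqP; rewrite -subr_eq0 -normr_eq0 eq_le normr_ge0 andbT.
rewrite leNgt; apply/negP => e0; set e := `|_| in e0 step.
have C0 : 0 < C * t ^+ 2 by have := step 0%N; rewrite divr1; lra.
have := step (Num.truncn (C * t ^+ 2 / e)); rewrite leNgt => /negP; apply.
by rewrite ltr_pdivrMr// [e * _]mulrC -ltr_pdivrMr// truncnS_gt.
Qed.

(** Integrated form of F' = f, meaningful when [f] jumps; restricted to [0 <= s] because the
    equations hold from time 0 on. *)
Definition primitive F f :=
  forall s t : R, 0 <= s -> s <= t -> F t - F s = intco f s t.

Lemma primitiveD F G f g : loc_bounded f -> loc_bounded g ->
  primitive F f -> primitive G g ->
  primitive (fun t => F t + G t) (fun t => f t + g t).
Proof.
by move=> lf lg Ff Gg s t s0 st; rewrite intcoD// -Ff// -Gg//; ring.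
Qed.

Lemma primitiveZ k F f : loc_bounded f -> primitive F f ->
  primitive (fun t => k * F t) (fun t => k * f t).
Proof. by move=> lf Ff s t s0 st; rewrite intcoZ// -Ff//; ring. Qed.

Lemma primitive_sum (I : Type) (r : seq I) (P : pred I) (H h : I -> R -> R) :
  (forall i, P i -> loc_bounded (h i)) ->
  (forall i, P i -> primitive (H i) (h i)) ->
  primitive (fun t => \sum_(i <- r | P i) H i t)
            (fun t => \sum_(i <- r | P i) h i t).
Proof.
move=> lh Hh s t s0 st; rewrite intco_sum// -sumrB.
by apply: eq_bigr => i Pi; rewrite Hh.
Qed.

Lemma eq_primitive F G f g : (forall t : R, 0 <= t -> F t = G t) ->
  (forall t : R, 0 <= t -> f t = g t) -> primitive F f -> primitive G g.
Proof.
move=> FG fg Ff s t s0 st; rewrite -FG ?(le_trans s0 st)// -FG// Ff//.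
by apply: intco_eq => u /andP[su _]; rewrite fg// (le_trans s0 su).
Qed.

Lemma primitive_lipschitz F f b : loc_bounded f -> primitive F f ->
  exists2 K, 0 <= K &
    (forall t : R, 0 <= t <= b -> `|f t| <= K) /\
    (forall s t : R, 0 <= s -> s <= t -> t <= b -> `|F t - F s| <= K * (t - s)).
Proof.
move=> lf Ff; have [K K0 fK] := loc_bounded_ge0 b lf.
have fK' t : 0 <= t <= b -> `|f t| <= K.
  by move=> /andP[t0 tb]; apply: fK; rewrite ger0_norm.
exists K => //; split=> // s t s0 st tb; rewrite Ff//.
apply: intco_bound => // u /andP[su ut].
by apply: fK'; rewrite (le_trans s0 su)/= (le_trans (ltW ut) tb).
Qed.

(** Chain rule. Over a step from [u] to [v] the Taylor remainder of [phi] and the variation of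
    [dphi] along [F] each contribute at most L K^2 (v - u)^2, where [K] bounds [f]. The composition
    minus the claimed integral thus has quadratic increments, hence is constant. *)
Lemma primitive_comp (phi dphi : R -> R) L F f :
  (forall x y, `|phi y - phi x - dphi x * (y - x)| <= L * (y - x) ^+ 2) ->
  (forall x y, `|dphi x - dphi y| <= L * `|x - y|) ->
  loc_bounded f -> loc_bounded (fun t => dphi (F t)) -> primitive F f ->
  primitive (fun t => phi (F t)) (fun t => dphi (F t) * f t).
Proof.
move=> phiP dphiP lf ldF Ff.
have lg := loc_boundedM ldF lf.
have L0 : 0 <= L.
  have := phiP 0 1; rewrite subr0 expr1n !mulr1 => h; exact: le_trans (normr_ge0 _) h.
pose Phi t := phi (F t) - intco (fun t => dphi (F t) * f t) 0 t.
suff PhiE t : 0 <= t -> Phi t = phi (F 0).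
  move=> s t s0 st; have t0 := le_trans s0 st.
  have := PhiE _ s0; have := PhiE _ t0; rewrite /Phi.
  by rewrite (intco_split lg s0 st); lra.
move=> t0; have [K K0 [fK FK]] := primitive_lipschitz t lf Ff.
have -> : phi (F 0) = Phi 0 by rewrite /Phi intco_empty subr0.
apply: (@eq0_of_quadratic_increments Phi t (2 * L * K ^+ 2)); last first.
  by rewrite t0 lexx.
move=> u v u0 uv vt; have v0 := le_trans u0 uv.
have -> : Phi v - Phi u = (phi (F v) - phi (F u) - dphi (F u) * (F v - F u)) +
    intco (fun w => (dphi (F u) - dphi (F w)) * f w) u v.
  have -> : intco (fun w => (dphi (F u) - dphi (F w)) * f w) u v =
      dphi (F u) * intco f u v - intco (fun w => dphi (F w) * f w) u v.
    rewrite -(intcoZ lf) -intcoB//; last exact: loc_boundedZ.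
    by apply: intco_eq => w _; ring.
  by rewrite /Phi (intco_split lg u0 uv) (Ff u v)//; ring.
rewrite (le_trans (ler_normD _ _))//.
have h1 : `|phi (F v) - phi (F u) - dphi (F u) * (F v - F u)| <=
    L * K ^+ 2 * (v - u) ^+ 2.
  rewrite (le_trans (phiP _ _))// -mulrA ler_wpM2l// -exprMn.
  rewrite -real_normK ?num_real// ler_sqr ?nnegrE//; first exact: FK.
  by rewrite mulr_ge0// subr_ge0.
have h2 : `|intco (fun w => (dphi (F u) - dphi (F w)) * f w) u v| <=
    (L * (K * (v - u)) * K) * (v - u).
  apply: intco_bound => //.
    apply: loc_boundedM => //; apply: loc_boundedB => //.
    exact: loc_bounded_cst.
  move=> w /andP[uw wv]; rewrite normrM ler_pM//; last first.
    by apply: fK; rewrite (le_trans u0 uw) (le_trans (ltW wv) vt).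
  rewrite (le_trans (dphiP _ _))// ler_wpM2l// distrC.
  rewrite (le_trans (FK _ _ u0 uw _))//; first exact: le_trans (ltW wv) vt.
  by rewrite ler_wpM2l// lerD2r ltW.
by lra.
Qed.

Lemma primitive_half_sqr F f : loc_bounded f -> loc_bounded F -> primitive F f ->
  primitive (fun t => F t ^+ 2 / 2) (fun t => F t * f t).
Proof.
move=> lf lF Ff.
apply: (@primitive_comp (fun x => x ^+ 2 / 2) id 1) => // x y.
  rewrite (_ : _ - _ = (y - x) ^+ 2 / 2); last by field.
  by rewrite ger0_norm ?divr_ge0 ?sqr_ge0//; have := sqr_ge0 (y - x); lra.
by rewrite mul1r.
Qed.

(** Polarization of [primitive_half_sqr]: F G = (F + G)^2 / 2 - F^2 / 2 - G^2 / 2. *)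
Lemma primitiveM F G f g : loc_bounded f -> loc_bounded F ->
  loc_bounded g -> loc_bounded G -> primitive F f -> primitive G g ->
  primitive (fun t => F t * G t) (fun t => F t * g t + G t * f t).
Proof.
move=> lf lF lg lG Ff Gg s t s0 st.
have := primitive_half_sqr (loc_boundedD lf lg) (loc_boundedD lF lG)
  (primitiveD lf lg Ff Gg) s0 st.
have -> : intco (fun t => (F t + G t) * (f t + g t)) s t =
    intco (fun t => F t * g t + G t * f t) s t +
    (intco (fun t => F t * f t) s t + intco (fun t => G t * g t) s t).
  rewrite -!intcoD//; try by repeat (apply: loc_boundedM || apply: loc_boundedD).
  by apply: intco_eq => u _; ring.
rewrite -(primitive_half_sqr lf lF Ff s0 st) -(primitive_half_sqr lg lG Gg s0 st).
lra.
Qed.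

Lemma window_increment g c s t : 0 <= c -> loc_bounded g -> s <= t ->
  intco g (t - c) t - intco g (s - c) s = intco (fun t => g t - g (t - c)) s t.
Proof.
move=> c0 lg st; have sc : s - c <= s by lra.
rewrite intcoB ?intco_shift//; last exact: loc_bounded_shift.
have := intco_split lg sc st.
rewrite (@intco_split _ g lg (t - c)); [lra | by rewrite lerD2r | lra].
Qed.

Lemma primitive_window g c : 0 <= c -> loc_bounded g ->
  primitive (fun t => intco g (t - c) t) (fun t => g t - g (t - c)).
Proof. by move=> c0 lg s t _ st; exact: window_increment. Qed.

(** [loc_bounded] also looks at negative times, on which [primitive_window] is silent; hence the
    local Lipschitz estimate on the whole line. *)
Lemma loc_bounded_window g c : 0 <= c -> loc_bounded g ->
  loc_bounded (fun t => intco g (t - c) t).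
Proof.
move=> c0 lg; apply: loc_bounded_continuous => x.
have lW := loc_boundedB lg (loc_bounded_shift c lg).
have [K K0 WK] := loc_bounded_ge0 (`|x| + 1) lW.
have incr s t : `|s| <= `|x| + 1 -> `|t| <= `|x| + 1 -> s <= t ->
    `|intco g (t - c) t - intco g (s - c) s| <= K * (t - s).
  move=> sx tx st; rewrite window_increment//; apply: intco_bound => // u.
  by move=> /andP[su ut]; apply: WK; move: sx tx; rewrite !ler_norml; lra.
apply/cvgrPdist_le => e e0.
have K1 : 0 < K + 1 by lra.
near=> t.
have tx1 : `|x - t| <= 1 by near: t; exact: cvgr_dist_le.
have txe : `|x - t| <= e / (K + 1).
  by near: t; apply: cvgr_dist_le => //; exact: divr_gt0.
have tx : `|t| <= `|x| + 1.
  have -> : t = x - (x - t) by ring.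
  by rewrite (le_trans (ler_normB _ _))// lerD2l.
have xx : `|x| <= `|x| + 1 by lra.
have Ke : (K + 1) * `|x - t| <= e by rewrite mulrC -ler_pdivlMr.
apply: le_trans Ke.
have [xt|/ltW xt] := leP x t.
  rewrite distrC (le_trans (incr _ _ xx tx xt))// distrC ger0_norm; nra.
rewrite (le_trans (incr _ _ tx xx xt))// ger0_norm; nra.
Unshelve. all: by end_near. Qed.

End Primitive.

(** * Asymptotics of primitives *)

Section Asymptotics.
Context {R : realType}.
Implicit Types (f g F D : R -> R) (k e l : R).

Lemma cvg_at_pinftyP f l : f t @[t --> +oo] --> l <->
  forall e, 0 < e -> exists2 t0 : R, 0 <= t0 &
    forall t, t0 <= t -> `|f t - l| <= e.
Proof.
split=> [/cvgrPdist_le fl e e0 | fl].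
  have [t0 [_ t0P]] := fl _ e0.
  exists (Num.max t0 0 + 1); first by rewrite addr_ge0// le_max lexx orbT.
  move=> t t0t; rewrite distrC; apply: t0P; apply: lt_le_trans t0t.
  by rewrite (@le_lt_trans _ _ (Num.max t0 0)) ?le_max ?lexx// ltrDl.
apply/cvgrPdist_le => e e0; have [t0 _ t0P] := fl _ e0.
exists t0; split; first exact: num_real.
by move=> t /ltW t0t; rewrite distrC t0P.
Qed.

Lemma cvg_sum0 (I : Type) (r : seq I) (P : pred I) (h : I -> R -> R) :
  (forall i, P i -> h i t @[t --> +oo] --> 0) ->
  \sum_(i <- r | P i) h i t @[t --> +oo] --> 0.
Proof.
move=> h0; rewrite [X in _ --> X](_ : 0 = \sum_(i <- r | P i) 0); last first.
  by rewrite big1.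
by apply: cvg_big => //; exact: add_continuous.
Qed.

Lemma cvg0D f g : f t @[t --> +oo] --> 0 -> g t @[t --> +oo] --> 0 ->
  f t + g t @[t --> +oo] --> 0.
Proof. by move=> f0 g0; rewrite -[X in _ --> X]addr0; exact: cvgD. Qed.

Lemma cvg0Z k f : f t @[t --> +oo] --> 0 -> k * f t @[t --> +oo] --> 0.
Proof. by move=> f0; rewrite -[X in _ --> X](mulr0 k); apply: cvgM f0; exact: cvg_cst. Qed.

Lemma cvg0M_bounded f g K : (forall t, 0 <= t -> `|g t| <= K) ->
  f t @[t --> +oo] --> 0 -> g t * f t @[t --> +oo] --> 0.
Proof.
move=> gK /cvg_at_pinftyP f0; apply/cvg_at_pinftyP => e e0.
have K0 : 0 <= K := le_trans (normr_ge0 _) (gK 0 (lexx 0)).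
have K1 : 0 < K + 1 by lra.
have [t0 t00 ft] := f0 _ (divr_gt0 e0 K1); exists t0 => // t t0t.
have := ft t t0t; rewrite !subr0 normrM ler_pdivlMr// mulrC; apply: le_trans.
by apply: ler_wpM2r => //; rewrite (le_trans (gK _ (le_trans t00 t0t)))//; lra.
Qed.

Lemma eq_cvg_ge0 f g l : (forall t, 0 <= t -> f t = g t) ->
  f t @[t --> +oo] --> l -> g t @[t --> +oo] --> l.
Proof.
move=> fg /cvg_at_pinftyP fl; apply/cvg_at_pinftyP => e e0.
have [t0 t00 ft] := fl _ e0; exists t0 => // t t0t.
by rewrite -fg ?ft// (le_trans t00).
Qed.

Lemma cauchy_cvg_pinfty f :
  (forall e, 0 < e -> exists2 t0 : R, 0 <= t0 &
    forall s t, t0 <= s -> t0 <= t -> `|f s - f t| <= e) ->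
  exists l, f t @[t --> +oo] --> l.
Proof.
move=> fC; exists (lim (f t @[t --> +oo])).
apply: cauchy_cvg; apply: cauchy_exP => e e0.
have [t0 t00 ft] := fC (e / 2) (divr_gt0 e0 (ltr0n _ 2)).
exists (f t0), t0; split; first exact: num_real.
move=> t /ltW t0t; rewrite /ball /= (@le_lt_trans _ _ (e / 2)) ?ft//; lra.
Qed.

(** Weaker than convergence, as sin (log (1 + t)) shows; it is what a derivative tending to 0
    provides. *)
Definition slowly_varying f := forall h e : R, 0 <= h -> 0 < e ->
  exists2 t0 : R, 0 <= t0 &
    forall s t, t0 <= t -> t <= s -> s <= t + h -> `|f s - f t| <= e.

Lemma slowD f g : slowly_varying f -> slowly_varying g ->
  slowly_varying (fun t => f t + g t).
Proof.
move=> sf sg h e h0 e0; have e2 : 0 < e / 2 by lra.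
have [t1 t10 f1] := sf h _ h0 e2; have [t2 t20 g2] := sg h _ h0 e2.
exists (Num.max t1 t2) => [|s t]; first by rewrite le_max t10.
rewrite ge_max => /andP[t1t t2t] ts st.
have -> : f s + g s - (f t + g t) = (f s - f t) + (g s - g t) by ring.
rewrite (le_trans (ler_normD _ _))// (splitr e) lerD//; [exact: f1|exact: g2].
Qed.

Lemma slow_cst k : slowly_varying (fun=> k).
Proof. by move=> h e h0 e0; exists 0 => // s t _ _ _; rewrite subrr normr0 ltW. Qed.

Lemma slowZ k f : slowly_varying f -> slowly_varying (fun t => k * f t).
Proof.
move=> sf h e h0 e0; have k0 : 0 < `|k| + 1 by rewrite ltr_wpDl.
have [t0 t00 ft] := sf h _ h0 (divr_gt0 e0 k0).
exists t0 => // s t tt ts st; rewrite -mulrBr normrM.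
have := ft _ _ tt ts st; rewrite ler_pdivlMr// => /(le_trans _); apply.
by rewrite mulrC ler_wpM2l// lerDl.
Qed.

Lemma slow_sum (I : Type) (r : seq I) (P : pred I) (h : I -> R -> R) :
  (forall i, P i -> slowly_varying (h i)) ->
  slowly_varying (fun t => \sum_(i <- r | P i) h i t).
Proof.
move=> sh; elim: r => [|i r IH].
  by under eq_fun do rewrite big_nil; exact: slow_cst.
have [Pi|nPi] := boolP (P i).
  by under eq_fun do rewrite big_cons Pi; apply: slowD => //; exact: sh.
by under eq_fun do rewrite big_cons (negbTE nPi).
Qed.

Lemma slow_cvg f l : f t @[t --> +oo] --> l -> slowly_varying f.
Proof.
move=> /cvg_at_pinftyP fl h e h0 e0; have e2 : 0 < e / 2 by lra.
have [t0 t00 ft] := fl _ e2; exists t0 => // s t tt ts st.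
have -> : f s - f t = (f s - l) - (f t - l) by ring.
rewrite (le_trans (ler_normB _ _))// (splitr e) lerD// ft//.
exact: le_trans ts.
Qed.

Lemma eq_slow f g : (forall t, 0 <= t -> f t = g t) ->
  slowly_varying f -> slowly_varying g.
Proof.
move=> fg sf h e h0 e0; have [t0 t00 ft] := sf h _ h0 e0.
exists t0 => // s t tt ts st; rewrite -!fg ?ft//.
  exact: le_trans tt.
exact: le_trans (le_trans t00 tt) ts.
Qed.

Lemma slow_primitive F f : loc_bounded f -> primitive F f ->
  f t @[t --> +oo] --> 0 -> slowly_varying F.
Proof.
move=> lf Ff /cvg_at_pinftyP f0 h e h0 e0; have h1 : 0 < h + 1 by lra.
have [t0 t00 ft] := f0 _ (divr_gt0 e0 h1); exists t0 => // s t tt ts st.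
rewrite (Ff _ _ (le_trans t00 tt) ts).
apply: (@le_trans _ _ (e / (h + 1) * (s - t))).
  apply: intco_bound => // u /andP[tu us].
  by have := ft u (le_trans tt tu); rewrite subr0.
rewrite mulrAC ler_pdivrMr// ler_wpM2l ?(ltW e0)//; lra.
Qed.

(* A slowly varying function is close to its averages over long intervals, and
   these are O(1/h) for intervals of length h. *)
Lemma slow_cvg0 f K : loc_bounded f -> slowly_varying f ->
  (forall t h : R, 0 <= t -> 0 <= h -> `|intco f t (t + h)| <= K) ->
  f t @[t --> +oo] --> 0.
Proof.
move=> lf sf fK; apply/cvg_at_pinftyP => e e0; have e2 : 0 < e / 2 by lra.
have K0 : 0 <= K := le_trans (normr_ge0 _) (fK 0 0 (lexx 0) (lexx 0)).
pose h := 2 * K / e + 1.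
have h0 : 0 < h by rewrite ltr_wpDl// !mulr_ge0// invr_ge0 ltW.
have [t0 t00 ft] := sf h _ (ltW h0) e2; exists t0 => // t tt; rewrite subr0.
have t0' := le_trans t00 tt.
have th : t <= t + h by lra.
have h1 : `|intco (fun u => f u - f t) t (t + h)| <= e / 2 * (t + h - t).
  apply: intco_bound => //; first by apply: loc_boundedB => //; exact: loc_bounded_cst.
  by move=> u /andP[tu uh]; rewrite ft// ltW.
have h2 := fK t h t0' (ltW h0).
have E : h * f t = intco f t (t + h) - intco (fun u => f u - f t) t (t + h).
  rewrite intcoB//; last exact: loc_bounded_cst.
  by rewrite intco_cst//; ring.
have h3 : h * `|f t| <= K + e / 2 * h.
  rewrite -[X in X * `|_|](ger0_norm (ltW h0)) -normrM E.
  rewrite (le_trans (ler_normB _ _))//; lra.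
have Ke : K <= h * (e / 2).
  have -> : h * (e / 2) = K + e / 2 by rewrite /h; field; lra.
  lra.
by rewrite -(ler_pM2l h0); lra.
Qed.

Definition ge0_unif_continuous f := forall e, 0 < e ->
  exists2 d : R, 0 < d &
    forall s t, 0 <= s -> s <= t -> t <= s + d -> `|f t - f s| <= e.

(* A form of Barbalat's lemma. *)
Lemma cvg0_dissipation (h : R -> R) D K : ge0_unif_continuous h -> loc_bounded D ->
  (forall t, 0 <= t -> 0 <= D t) ->
  (forall t, 0 <= t -> intco D 0 t <= K) ->
  (forall e, 0 < e -> exists2 c, 0 < c &
     forall t, 0 <= t -> e <= `|h t| -> c <= D t) ->
  h t @[t --> +oo] --> 0.
Proof.
move=> uh lD D0 DK hD; apply/cvg_at_pinftyP => e e0; have e2 : 0 < e / 2 by lra.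
have [d d0 hd] := uh _ e2; have [c c0 hc] := hD _ e2.
pose E := [set intco D 0 t | t in [set t : R | 0 <= t]].
have supE : has_sup E.
  split; first by exists (intco D 0 0); exists 0 => /=.
  by exists K => _ [t /= t0 <-]; exact: DK.
have cd0 : 0 < c * d by exact: mulr_gt0.
(* After [t0] less than [c * d] of the integral of [D] remains, whereas a value of [h] above [e]
   would keep [D] above [c] for a time [d]. *)
have [_ [t0 /= t00 <-] t0E] := sup_adherent cd0 supE.
exists t0 => // t t0t; rewrite subr0 leNgt; apply/negP => eh.
have t0' := le_trans t00 t0t.
have td : t <= t + d by lra.
have : intco D 0 (t + d) <= sup E.
  by apply: ub_le_sup; [exact: supE.2 | exists (t + d) => //=; lra].
rewrite (intco_split lD t00 (le_trans t0t td)) (intco_split lD t0t td).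
have : 0 <= intco D t0 t.
  by apply: intco_ge0 => u /andP[t0u _]; rewrite D0// (le_trans t00).
suff : c * (t + d - t) <= intco D t (t + d) by lra.
rewrite -intco_cst//; apply: intco_le => //; first exact: loc_bounded_cst.
move=> u /andP[tu ud]; apply: hc; first exact: le_trans tu.
have := hd _ _ t0' tu (ltW ud).
have := ler_normD (h u) (h t - h u).
have -> : h u + (h t - h u) = h t by ring.
by rewrite -[`|h t - h u|]distrC; lra.
Qed.

End Asymptotics.

(** * Uniformly small integrals over short intervals *)

Section SmallIntegrals.
Context {R : realType}.
Implicit Types (f g F : R -> R).

(** What makes a primitive of [f] uniformly continuous. It replaces boundedness for the inflows,
    whose waves are controlled in mean square only. *)
Definition small_integrals f := forall e : R, 0 < e ->
  exists2 d : R, 0 < d &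
    forall s t, 0 <= s -> s <= t -> t <= s + d -> `|intco f s t| <= e.

Lemma small_integralsD f g : loc_bounded f -> loc_bounded g ->
  small_integrals f -> small_integrals g ->
  small_integrals (fun t => f t + g t).
Proof.
move=> lf lg sf sg e e0; have e2 : 0 < e / 2 by lra.
have [d1 d10 f1] := sf _ e2; have [d2 d20 g2] := sg _ e2.
exists (Num.min d1 d2) => [|s t s0 st]; first by rewrite lt_min d10.
rewrite -lerBlDl le_min => /andP[t1 t2]; rewrite intcoD//.
rewrite (le_trans (ler_normD _ _))// (splitr e).
by rewrite lerD// ?f1 ?g2// -lerBlDl.
Qed.

Lemma small_integralsZ (k : R) f : loc_bounded f -> small_integrals f ->
  small_integrals (fun t => k * f t).
Proof.
move=> lf sf e e0; have k0 : 0 < `|k| + 1 by rewrite ltr_wpDl.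
have [d d0 fd] := sf _ (divr_gt0 e0 k0); exists d => // s t s0 st td.
rewrite intcoZ// normrM; have := fd _ _ s0 st td.
rewrite ler_pdivlMr// => /(le_trans _); apply.
by rewrite mulrC ler_wpM2l// lerDl.
Qed.

Lemma small_integrals_sum (I : Type) (r : seq I) (P : pred I) (h : I -> R -> R) :
  (forall i, P i -> loc_bounded (h i)) ->
  (forall i, P i -> small_integrals (h i)) ->
  small_integrals (fun t => \sum_(i <- r | P i) h i t).
Proof.
move=> lh sh; elim: r => [|i r IH].
  move=> e e0; exists 1 => // s t _ st _; rewrite intco_sum// big_nil.
  by rewrite normr0 ltW.
have [Pi|nPi] := boolP (P i).
  under eq_fun do rewrite big_cons Pi.
  by apply: small_integralsD; [exact: lh|exact: loc_bounded_sum|exact: sh|].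
by under eq_fun do rewrite big_cons (negbTE nPi).
Qed.

Lemma small_integrals_bounded f K : loc_bounded f ->
  (forall t, 0 <= t -> `|f t| <= K) -> small_integrals f.
Proof.
move=> lf fK e e0.
have K0 : 0 <= K := le_trans (normr_ge0 _) (fK 0 (lexx 0)).
have K1 : 0 < K + 1 by lra.
exists (e / (K + 1)) => [|s t s0 st td]; first exact: divr_gt0.
have h1 : (K + 1) * (t - s) <= e.
  by rewrite mulrC -ler_pdivlMr//; lra.
apply: le_trans h1.
apply: (@le_trans _ _ (K * (t - s))); last by apply: ler_wpM2r; lra.
by apply: intco_bound => // u /andP[su _]; apply: fK; lra.
Qed.

(** Integrated form of |x| <= (l x^2 + 1 / l) / 2; the free parameter [l] does the work of the
    Cauchy-Schwarz inequality. *)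
Lemma intco_le_sqr f (a b l : R) : loc_bounded f -> a <= b -> 0 < l ->
  `|intco f a b| <= (l * intco (fun t => f t ^+ 2) a b + (b - a) / l) / 2.
Proof.
move=> lf ab l0; rewrite (le_trans (intco_norm lf _ _))//.
have -> : (l * intco (fun t => f t ^+ 2) a b + (b - a) / l) / 2 =
    intco (fun t => l / 2 * f t ^+ 2 + (2 * l)^-1) a b.
  rewrite intcoD ?intcoZ ?intco_cst//; first by field; lra.
  - exact: loc_boundedX.
  - by apply: loc_boundedZ; exact: loc_boundedX.
  - exact: loc_bounded_cst.
apply: intco_le => [||t _]; first exact: loc_bounded_norm.
  apply: loc_boundedD; last exact: loc_bounded_cst.
  by apply: loc_boundedZ; exact: loc_boundedX.
have -> : l / 2 * f t ^+ 2 + (2 * l)^-1 =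
    (2 * l)^-1 * (l * `|f t| - 1) ^+ 2 + `|f t|.
  by rewrite -(real_normK (num_real (f t))); field; lra.
by rewrite lerDr mulr_ge0 ?sqr_ge0// invr_ge0; lra.
Qed.

Lemma small_integrals_sqr f (h K : R) : loc_bounded f -> 0 < h ->
  (forall s t, 0 <= s -> s <= t -> t <= s + h ->
     intco (fun u => f u ^+ 2) s t <= K) -> small_integrals f.
Proof.
move=> lf h0 fK e e0.
have K0 : 0 <= K.
  by apply: le_trans (fK 0 0 _ _ _) => //; rewrite ?intco_empty//; lra.
(* With this [l] the quadratic term is at most [e], and intervals no longer than [e * l] keep the
   other term below [e] as well. *)
pose l := e / (K + 1).
have l0 : 0 < l by rewrite divr_gt0//; lra.
have lK : l * K <= e.
  have -> : e = l * (K + 1) by rewrite /l; field; lra.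
  by rewrite ler_pM2l//; lra.
exists (Num.min h (e * l)) => [|s t s0 st]; first by rewrite lt_min h0 mulr_gt0.
rewrite -lerBlDl le_min => /andP[t1 t2].
rewrite (le_trans (intco_le_sqr lf st l0))//.
have h1 : l * intco (fun u => f u ^+ 2) s t <= e.
  by apply: le_trans lK; rewrite ler_pM2l// fK// -lerBlDl.
have h2 : (t - s) / l <= e by rewrite ler_pdivrMr.
lra.
Qed.

Lemma primitive_unif_continuous F f : primitive F f -> small_integrals f ->
  ge0_unif_continuous F.
Proof.
move=> Ff sf e e0; have [d d0 fd] := sf _ e0; exists d => // s t s0 st td.
by rewrite Ff// fd.
Qed.

End SmallIntegrals.

(** * Graph Laplacians on connected graphs *)

Section ConnectedSums.
Context {R : realType} {N : finType}.
Variable adj : rel N.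
Hypothesis adjC : symmetric adj.
Hypothesis adj_connected : forall i j, connect adj i j.

Lemma exchange_adj (F : N -> N -> R) :
  \sum_j \sum_(i | adj i j) F i j = \sum_j \sum_(i | adj i j) F j i.
Proof.
rewrite (exchange_big_dep predT)//=; apply: eq_bigr => j _.
by apply: eq_bigl => i; rewrite adjC.
Qed.

(** [K] is the length of a path from [i] to [j]. It is chosen before [x], so that one constant
    serves at all times. *)
Lemma connect_diff_bound i j : exists2 K : R, 0 <= K &
  forall (x : N -> R) d, (forall a b, adj a b -> `|x a - x b| <= d) ->
    `|x i - x j| <= K * d.
Proof.
have /connectP[p] := adj_connected i j.
elim: p i => [i _ ->|k p IH i /= /andP[ik kp] jp].
  by exists 0 => // x d _; rewrite subrr normr0 mul0r.
have [K K0 xK] := IH _ kp jp; exists (K + 1) => [|x d xd]; first lra.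
have -> : x i - x j = (x i - x k) + (x k - x j) by ring.
by rewrite (le_trans (ler_normD _ _))// mulrDl mul1r addrC lerD ?xK ?xd.
Qed.

Lemma connect_eq (T : Type) (x : N -> T) : (forall a b, adj a b -> x a = x b) ->
  forall i j, x i = x j.
Proof.
move=> xE i j; have /connectP[p] := adj_connected i j.
by elim: p i => [i _ ->//|k p IH i /= /andP[/xE-> kp] /IH]; exact.
Qed.

Variable w : N -> N -> R.
Hypothesis w_gt0 : forall i j, adj i j -> 0 < w i j.
Hypothesis wC : forall i j, adj i j -> w i j = w j i.

(** Discrete Green identity: since [w] is symmetric, exchanging the ends of the edges shows that
    both ends contribute equally, hence the factor 2. *)
Lemma dirichlet_form (x : N -> R) :
  \sum_j \sum_(i | adj i j) w i j * (x i - x j) ^+ 2 =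
  - 2 * \sum_j x j * \sum_(i | adj i j) w i j * (x i - x j).
Proof.
have E : \sum_j \sum_(i | adj i j) w i j * (x i - x j) * x i =
    - \sum_j \sum_(i | adj i j) w i j * (x i - x j) * x j.
  rewrite (exchange_adj (fun i j => w i j * (x i - x j) * x i)) -sumrN.
  apply: eq_bigr => j _; rewrite -sumrN; apply: eq_bigr => i ij.
  by rewrite -(wC ij); ring.
transitivity (\sum_j \sum_(i | adj i j) w i j * (x i - x j) * x i -
              \sum_j \sum_(i | adj i j) w i j * (x i - x j) * x j).
  rewrite -sumrB; apply: eq_bigr => j _; rewrite -sumrB.
  by apply: eq_bigr => i _; ring.
have -> : \sum_j x j * \sum_(i | adj i j) w i j * (x i - x j) =
    \sum_j \sum_(i | adj i j) w i j * (x i - x j) * x j.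
  by apply: eq_bigr => j _; rewrite mulr_sumr; apply: eq_bigr => i _; ring.
by rewrite E; ring.
Qed.

Lemma laplacian_eq0 (x : N -> R) :
  (forall j, \sum_(i | adj i j) w i j * (x i - x j) = 0) ->
  forall i j, x i = x j.
Proof.
move=> x0; apply: connect_eq => a b ab.
have := dirichlet_form x.
rewrite [X in _ = _ * X]big1 ?mulr0; last by move=> j _; rewrite x0 mulr0.
have F0 j i : adj i j -> 0 <= w i j * (x i - x j) ^+ 2.
  by move=> ij; rewrite mulr_ge0 ?sqr_ge0// ltW// w_gt0.
move=> /psumr_eq0P H; have {H}H := H _ b isT.
have /psumr_eq0P H0 : \sum_(i | adj i b) w i b * (x i - x b) ^+ 2 = 0.
  by apply: H => j _; apply: sumr_ge0 => i; exact: F0.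
have /eqP := H0 (F0 b) a ab.
by rewrite mulf_eq0 (gt_eqF (w_gt0 ab)) sqrf_eq0 subr_eq0 => /eqP.
Qed.

(** Pairing the vanishing Laplacian with the bounded [x] makes the Dirichlet form vanish, hence the
    differences along edges, and then along paths. *)
Lemma laplacian_cvg0 (x : N -> R -> R) (K : R) :
  (forall j t, 0 <= t -> `|x j t| <= K) ->
  (forall j, \sum_(i | adj i j) w i j * (x i t - x j t) @[t --> +oo] --> 0) ->
  forall i j, x i t - x j t @[t --> +oo] --> 0.
Proof.
move=> xK x0.
have D0 : \sum_j \sum_(i | adj i j) w i j * (x i t - x j t) ^+ 2
    @[t --> +oo] --> 0.
  under eq_cvg do rewrite (dirichlet_form (x ^~ _)).
  by apply/cvg0Z/cvg_sum0 => j _; apply: cvg0M_bounded (x0 j); exact: xK.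
have F0 t j i : adj i j -> 0 <= w i j * (x i t - x j t) ^+ 2.
  by move=> ij; rewrite mulr_ge0 ?sqr_ge0// ltW// w_gt0.
have edge a b : adj a b -> forall e : R, 0 < e -> exists2 t0 : R, 0 <= t0 &
    forall t, t0 <= t -> `|x a t - x b t| <= e.
  move=> ab e e0; have wab := w_gt0 ab.
  have [t0 t00 Dt] := (cvg_at_pinftyP _ _).1 D0 _ (mulr_gt0 wab (exprn_gt0 2 e0)).
  exists t0 => // t tt.
  have := Dt t tt; rewrite subr0 => /(le_trans (ler_norm _)).
  rewrite (bigD1 b)//= (bigD1 a)//= -addrA => H.
  have : w a b * (x a t - x b t) ^+ 2 <= w a b * e ^+ 2.
    apply: le_trans H; rewrite lerDl addr_ge0 ?sumr_ge0// => [i /andP[ia _]|j _].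
      exact: F0.
    by apply: sumr_ge0 => i; exact: F0.
  rewrite ler_pM2l// -(real_normK (num_real (x a t - x b t))).
  by rewrite ler_sqr// nnegrE ltW.
move=> i j; have [C C0 xC] := connect_diff_bound i j.
apply/cvg_at_pinftyP => e e0; have C1 : 0 < C + 1 by lra.
have e1 := divr_gt0 e0 C1.
suff [t0 t00 H] : exists2 t0 : R, 0 <= t0 & forall t, t0 <= t ->
    forall a b, adj a b -> `|x a t - x b t| <= e / (C + 1).
  exists t0 => // t tt; rewrite subr0 (le_trans (xC (x ^~ t) _ (H t tt)))//.
  by rewrite mulrA ler_pdivrMr// mulrC ler_pM2l//; lra.
have /choice[f fP] : forall ab : N * N, exists t0 : R, 0 <= t0 /\
    (adj ab.1 ab.2 -> forall t, t0 <= t -> `|x ab.1 t - x ab.2 t| <= e / (C + 1)).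
  move=> [a b] /=; have [ab|nab] := boolP (adj a b); last by exists 0.
  by have [t0 t00 H] := edge _ _ ab _ e1; exists t0.
(* The thresholds are nonnegative, so their sum lies beyond each of them. *)
exists (\sum_ab f ab) => [|t ft a b ab]; first by apply: sumr_ge0 => p _; exact: (fP p).1.
apply: ((fP (a, b)).2 ab); apply: le_trans ft.
by rewrite (bigD1 (a, b))//= lerDl; apply: sumr_ge0 => p _; exact: (fP p).1.
Qed.

End ConnectedSums.

(** * Scattering with delays *)

Section Scattering.
Context {R : realType} {N : finType}.
Variables (adj : rel N) (w T : N -> N -> R).
Hypothesis adjC : symmetric adj.
Hypothesis adj_connected : forall i j, connect adj i j.
Hypothesis w_gt0 : forall i j, adj i j -> 0 < w i j.
Hypothesis wC : forall i j, adj i j -> w i j = w j i.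
Hypothesis T_ge0 : forall i j, adj i j -> 0 <= T i j.

(* [U i j] and [V i j] are, up to the factor [sqrt 2] (negated at one end of
   each edge), the two components of the wave leaving i towards j. *)
Definition scatters (zt pt : N -> R -> R) (U V : N -> N -> R -> R) :=
  forall i j, adj i j -> forall t : R, 0 <= t ->
    U i j t = V j i (t - T j i) + 2 * zt i t /\
    V i j t = - U j i (t - T j i) - 2 * pt i t.

(** [zt j t - U j i t] is the deviation of the received signal r_ij^p, recovered from the wave
    leaving [j]; this is therefore the coupling sum of the controller at [j]. *)
Definition inflow (zt pt : N -> R -> R) (U : N -> N -> R -> R) j t :=
  \sum_(i | adj i j) w i j * (zt j t - U j i t - pt j t).

(** The waves emitted during the last [T i j] units of time are those still in transit. On an
    instantaneous channel the window is empty and the value is 0. *)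
Definition energy (U V : N -> N -> R -> R) i j t :=
  intco (fun s => U i j s ^+ 2 + V i j s ^+ 2) (t - T i j) t.

(* The quarter turn (zeta, p^c) -> (p^c, - zeta) is a symmetry of the
   scattering relations; it exchanges the two halves of the controller. *)
Lemma scatters_turn zt pt U V : scatters zt pt U V ->
  scatters pt (fun j t => - zt j t) (fun i j t => - V i j t) U.
Proof.
move=> sc i j ij t t0; have [h1 h2] := sc i j ij t t0.
by split; [rewrite h2|rewrite h1]; ring.
Qed.

Lemma energy_turn U V : energy (fun i j t => - V i j t) U = energy U V.
Proof.
apply/funext => i; apply/funext => j; apply/funext => t; rewrite /energy.
by apply: intco_eq => s _; ring.
Qed.

Section OneState.
Variables (zt pt : N -> R -> R) (U V : N -> N -> R -> R) (K : R).
Hypothesis sc : scatters zt pt U V.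
Hypothesis lz : forall j, loc_bounded (zt j).
Hypothesis lp : forall j, loc_bounded (pt j).
Hypothesis lU : forall i j, loc_bounded (U i j).
Hypothesis lV : forall i j, loc_bounded (V i j).
Hypothesis zK : forall j t, 0 <= t -> `|zt j t| <= K.
Hypothesis pK : forall j t, 0 <= t -> `|pt j t| <= K.
Hypothesis EK : forall i j, adj i j -> forall t, 0 <= t -> energy U V i j t <= K.

Let g i j t := U i j t ^+ 2 + V i j t ^+ 2.

Let lg i j : loc_bounded (g i j).
Proof. by apply: loc_boundedD; exact: loc_boundedX. Qed.

Let K0 i j : adj i j -> 0 <= K.
Proof. by move=> _; exact: le_trans (normr_ge0 _) (zK i (lexx 0)). Qed.

Lemma intco_wave_le i j a b : a <= b ->
  intco (fun t => `|U i j t|) a b <= (b - a + intco (g i j) a b) / 2 /\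
  intco (fun t => `|V i j t|) a b <= (b - a + intco (g i j) a b) / 2.
Proof.
move=> ab; have lc := @loc_bounded_cst R 1.
have l0 := loc_boundedD lc (lg i j).
have l1 := loc_boundedZ 2^-1 l0.
have -> : (b - a + intco (g i j) a b) / 2 =
    intco (fun t => 2^-1 * (1 + g i j t)) a b.
  by rewrite (intcoZ l0) (intcoD lc (lg i j)) intco_cst//; ring.
split; (apply: intco_le => // [|t _]; first exact: loc_bounded_norm); rewrite /g.
  have := sqr_ge0 (`|U i j t| - 1); have := sqr_ge0 (V i j t).
  by rewrite sqrrB1 real_normK ?num_real//; lra.
have := sqr_ge0 (`|V i j t| - 1); have := sqr_ge0 (U i j t).
by rewrite sqrrB1 real_normK ?num_real//; lra.
Qed.

Lemma window_wave_le i j t : adj i j -> 0 <= t ->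
  intco (fun t => `|U i j t|) (t - T i j) t <= (T i j + K) / 2 /\
  intco (fun t => `|V i j t|) (t - T i j) t <= (T i j + K) / 2.
Proof.
move=> ij t0; have tT : t - T i j <= t by rewrite gerBl T_ge0.
have [h1 h2] := intco_wave_le i j tT.
have := EK ij t0; rewrite /energy -/(g i j) => h3.
by split; [move: h1|move: h2]; rewrite (_ : t - (t - T i j) = T i j); lra.
Qed.

(** The two integrals differ only by the windows of length [c] at the two ends, whatever the length
    [h]. *)
Lemma shifted_intco_le (f : R -> R) c C t h : 0 <= c -> loc_bounded f ->
  (forall t, 0 <= t -> intco (fun s => `|f s|) (t - c) t <= C) ->
  0 <= t -> 0 <= h ->
  `|intco (fun s => f (s - c)) t (t + h) - intco f t (t + h)| <= 2 * C.
Proof.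
move=> c0 lf fC t0 h0; have th : t <= t + h by rewrite lerDl.
rewrite distrC -intcoB//; last exact: loc_bounded_shift.
rewrite -(primitive_window c0 lf t0 th).
rewrite (le_trans (ler_normB _ _))// mulr2n mulrDl !mul1r lerD//.
  by rewrite (le_trans (intco_norm lf _ _))// fC// addr_ge0.
by rewrite (le_trans (intco_norm lf _ _))// fC.
Qed.

(** Integration removes the delays up to O(1). The relations for [U i j] and [V j i] then form a
    linear system in their integrals, whose solution for [U i j] is the integral of zt_i - pt_j. *)
Lemma wave_mean i j : adj i j -> exists C : R, forall t h, 0 <= t -> 0 <= h ->
  `|intco (U i j) t (t + h) - intco (fun s => zt i s - pt j s) t (t + h)| <= C.
Proof.
move=> ij; have ji : adj j i by rewrite adjC.
exists ((T j i + K) / 2 + (T i j + K) / 2) => t h t0 h0.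
have th : t <= t + h by rewrite lerDl.
have h1 := shifted_intco_le (T_ge0 ji) (lV j i)
  (fun t t0 => (window_wave_le ji t0).2) t0 h0.
have h2 := shifted_intco_le (T_ge0 ij) (lU i j)
  (fun t t0 => (window_wave_le ij t0).1) t0 h0.
have E1 : intco (U i j) t (t + h) =
    intco (fun s => V j i (s - T j i)) t (t + h) + 2 * intco (zt i) t (t + h).
  rewrite -intcoZ// -intcoD//; [|exact: loc_bounded_shift|exact: loc_boundedZ].
  by apply: intco_eq => s /andP[ts _]; rewrite (sc ij (le_trans t0 ts)).1.
have E2 : intco (V j i) t (t + h) =
    - (intco (fun s => U i j (s - T i j)) t (t + h)) - 2 * intco (pt j) t (t + h).
  have lUs := loc_bounded_shift (T i j) (lU i j).
  have -> : - intco (fun s => U i j (s - T i j)) t (t + h)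
      - 2 * intco (pt j) t (t + h) =
      (-1) * intco (fun s => U i j (s - T i j)) t (t + h)
      + (-2) * intco (pt j) t (t + h) by ring.
  rewrite -!intcoZ// -intcoD; try exact: loc_boundedZ.
  by apply: intco_eq => s /andP[ts _]; rewrite (sc ji (le_trans t0 ts)).2; ring.
rewrite intcoB//.
move: h1 h2; rewrite !ler_norml => /andP[? ?] /andP[? ?]; apply/andP; split; lra.
Qed.

(** [V i j] is minus the delayed [U j i] minus 2 pt_i, and [wave_mean] gives [U j i] the mean zt_j -
    pt_i. *)
Lemma conj_wave_mean i j : adj i j -> exists C : R, forall t h, 0 <= t -> 0 <= h ->
  `|intco (V i j) t (t + h) + intco (fun s => zt j s + pt i s) t (t + h)| <= C.
Proof.
move=> ij; have ji : adj j i by rewrite adjC.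
have [C CP] := wave_mean ji.
exists (C + 2 * ((T j i + K) / 2)) => t h t0 h0.
have th : t <= t + h by rewrite lerDl.
have h1 := shifted_intco_le (T_ge0 ji) (lU j i)
  (fun t t0 => (window_wave_le ji t0).1) t0 h0.
have E1 : intco (V i j) t (t + h) =
    - intco (fun s => U j i (s - T j i)) t (t + h) - 2 * intco (pt i) t (t + h).
  have lUs := loc_bounded_shift (T j i) (lU j i).
  have -> : - intco (fun s => U j i (s - T j i)) t (t + h)
      - 2 * intco (pt i) t (t + h) =
      (-1) * intco (fun s => U j i (s - T j i)) t (t + h)
      + (-2) * intco (pt i) t (t + h) by ring.
  rewrite -!intcoZ// -intcoD; try exact: loc_boundedZ.
  by apply: intco_eq => s /andP[ts _]; rewrite (sc ij (le_trans t0 ts)).2; ring.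
have := CP t h t0 h0; rewrite intcoB// intcoD//.
move: h1; rewrite !ler_norml => /andP[? ?] /andP[? ?]; apply/andP; split; lra.
Qed.

(** In the mean [U j i] is zt_j - pt_i, so zt_j cancels from the inflow and only differences of [pt]
    remain. *)
Lemma inflow_mean j : exists C : R, forall t h, 0 <= t -> 0 <= h ->
  `|intco (inflow zt pt U j) t (t + h) -
    intco (fun s => \sum_(i | adj i j) w i j * (pt i s - pt j s)) t (t + h)| <= C.
Proof.
have /choice[C CP] : forall i, exists C : R, adj i j ->
    forall t h, 0 <= t -> 0 <= h -> `|intco (U j i) t (t + h) -
      intco (fun s => zt j s - pt i s) t (t + h)| <= C.
  move=> i; have [ij|_] := boolP (adj i j); last by exists 0.
  by rewrite adjC in ij; have [C CP] := wave_mean ij; exists C.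
exists (\sum_(i | adj i j) w i j * C i) => t h t0 h0.
have l1 i : loc_bounded (fun s => zt j s - U j i s - pt j s).
  by do 2 apply: loc_boundedB => //.
have l2 i : loc_bounded (fun s => pt i s - pt j s) by exact: loc_boundedB.
rewrite /inflow !intco_sum; try by move=> i _; exact: loc_boundedZ.
rewrite -sumrB (le_trans (ler_norm_sum _ _ _))//; apply: ler_sum => i ij.
rewrite !intcoZ// -mulrBr normrM gtr0_norm ?w_gt0// ler_pM2l ?w_gt0//.
have := CP i ij t h t0 h0; rewrite !intcoB//; last exact: loc_boundedB.
rewrite -normrN; apply: le_trans; rewrite le_eqVlt; apply/orP; left.
by apply/eqP; congr `|_|; ring.
Qed.

(* The mean inflow is a graph Laplacian up to O(1) and has bounded integrals. *)
Lemma consensus (z m : N -> R -> R) (Z : R) :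
  (forall j, loc_bounded (m j)) ->
  (forall j, primitive (z j) (fun t => m j t + inflow zt pt U j t)) ->
  (forall j t, 0 <= t -> `|z j t| <= Z) ->
  (forall j, m j t @[t --> +oo] --> 0) ->
  (forall j, slowly_varying (pt j)) ->
  forall i j, pt i t - pt j t @[t --> +oo] --> 0.
Proof.
move=> lm zA zZ m0 sp; apply: (laplacian_cvg0 adjC adj_connected w_gt0 wC pK).
move=> j; pose L t := \sum_(i | adj i j) w i j * (pt i t - pt j t).
have lL : loc_bounded L.
  by apply: loc_bounded_sum => i _; apply/loc_boundedZ/loc_boundedB.
have lA : loc_bounded (inflow zt pt U j).
  apply: loc_bounded_sum => i _; apply: loc_boundedZ.
  by do 2 apply: loc_boundedB => //.
have [C CP] := inflow_mean j.
(* The sum is treated as a whole: the increments of [z j] bound the integrals of [m j] plus the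
   inflow, whereas [m j], although it tends to 0, may have unbounded integrals. *)
have mL0 : m j t + L t @[t --> +oo] --> 0.
  apply: (@slow_cvg0 _ _ (2 * Z + C)); first exact: loc_boundedD.
    apply: slowD; first exact: slow_cvg (m0 j).
    apply: slow_sum => i _; apply: slowZ; apply: slowD => //.
    under eq_fun do rewrite -mulN1r; exact: slowZ.
  move=> t h t0 h0; have th : t <= t + h by rewrite lerDl.
  have t0' := le_trans t0 th.
  have := zA j _ _ t0 th; rewrite !intcoD// => h1.
  have h2 := CP t h t0 h0; have h3 := zZ j _ t0; have h4 := zZ j _ t0'.
  move: h2 h3 h4; rewrite /L !ler_norml => /andP[? ?] /andP[? ?] /andP[? ?].
  by apply/andP; split; lra.
have : -1 * m j t + (m j t + L t) @[t --> +oo] --> 0.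
  by apply: cvg0D => //; exact: cvg0Z.
by apply: eq_cvg_ge0 => t _; rewrite /L; ring.
Qed.

Let d i j t := U i j t - V i j t.

Let ld i j : loc_bounded (d i j).
Proof. exact: loc_boundedB. Qed.

(** At [j], the scattering relations make the inflow from [i] equal to half of what arrives,
    [d i j (t - T i j)], minus half of what leaves, [d j i t]. The channels thus preserve U - V as
    well as the energy. *)
Lemma sum_inflow t : 0 <= t -> \sum_j inflow zt pt U j t =
  - (2^-1 * \sum_j \sum_(i | adj i j) w i j * (d i j t - d i j (t - T i j))).
Proof.
move=> t0; have -> :
    \sum_j \sum_(i | adj i j) w i j * (d i j t - d i j (t - T i j)) =
    \sum_j \sum_(i | adj i j) w i j * d i j t -
    \sum_j \sum_(i | adj i j) w i j * d i j (t - T i j).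
  rewrite -sumrB; apply: eq_bigr => j _; rewrite -sumrB.
  by apply: eq_bigr => i _; ring.
rewrite (exchange_adj adjC (fun i j => w i j * d i j t)) -sumrB mulr_sumr -sumrN.
apply: eq_bigr => j _; rewrite /inflow -sumrB mulr_sumr -sumrN.
apply: eq_bigr => i ij; have ji : adj j i by rewrite adjC.
have [h1 h2] := sc ji t0; by rewrite -(wC ij) /d h1 h2; field.
Qed.

Lemma inflow_conserved (z : N -> R -> R) :
  (forall j, primitive (z j) (inflow zt pt U j)) ->
  exists c : R, forall t, 0 <= t -> \sum_j z j t +
    2^-1 * \sum_j \sum_(i | adj i j) w i j * intco (d i j) (t - T i j) t = c.
Proof.
move=> zA; pose W t := \sum_j z j t + 2^-1 * \sum_j \sum_(i | adj i j)
  w i j * intco (d i j) (t - T i j) t.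
exists (W 0) => t t0; apply/eqP; rewrite -subr_eq0 -/(W t).
have lA j : loc_bounded (inflow zt pt U j).
  apply: loc_bounded_sum => i _; apply: loc_boundedZ.
  by do 2 apply: loc_boundedB => //.
have lw i j : loc_bounded (fun t => d i j t - d i j (t - T i j)).
  by apply: loc_boundedB => //; exact: loc_bounded_shift.
have lww j : loc_bounded (fun t => \sum_(i | adj i j)
    w i j * (d i j t - d i j (t - T i j))).
  by apply: loc_bounded_sum => i _; exact: loc_boundedZ.
have WP : primitive W (fun t => \sum_j inflow zt pt U j t + 2^-1 * \sum_j
    \sum_(i | adj i j) w i j * (d i j t - d i j (t - T i j))).
  apply: primitiveD; first exact: loc_bounded_sum.
  - by apply/loc_boundedZ/loc_bounded_sum.
  - by apply: primitive_sum.
  - apply: primitiveZ; first exact: loc_bounded_sum.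
    apply: primitive_sum => // j _; apply: primitive_sum => [i _|i ij].
      exact: loc_boundedZ.
    apply: primitiveZ => //; apply: primitive_window => //; exact: T_ge0.
rewrite (WP _ _ (lexx 0) t0) (@intco_eq _ _ (fun=> 0)).
  by rewrite intco_cst// mul0r.
by move=> s /andP[s0 _]; rewrite sum_inflow//; ring.
Qed.

(** Exchanging the two integrations would give this up to boundary terms; an explicit bounded
    primitive of the difference yields it directly. *)
Lemma integrated_window (f : R -> R) c C : 0 <= c -> loc_bounded f ->
  (forall t, 0 <= t -> intco (fun s => `|f s|) (t - c) t <= C) ->
  forall t h, 0 <= t -> 0 <= h ->
  `|intco (fun s => intco f (s - c) s) t (t + h) - c * intco f t (t + h)| <=
    2 * (c * C).
Proof.
move=> c0 lf fC t h t0 h0; have th : t <= t + h by rewrite lerDl.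
have lid : loc_bounded (fun s : R => s) by apply: loc_bounded_continuous => s; exact: cvg_id.
have luf : loc_bounded (fun s => s * f s) by exact: loc_boundedM.
(* the primitive of [c f(t) - int_(t-c)^t f] is [int_(t-c)^t (c - (t-s)) f(s) ds] *)
pose E s := (c - s) * intco f (s - c) s + intco (fun s => s * f s) (s - c) s.
have EP : primitive E (fun s => c * f s - intco f (s - c) s).
  have lW := loc_bounded_window c0 lf.
  have ldW := loc_boundedB lf (loc_bounded_shift c lf).
  have lcs : loc_bounded (fun s : R => c - s).
    by apply: loc_boundedB => //; exact: loc_bounded_cst.
  have P1 : primitive (fun s : R => c - s) (fun=> -1).
    by move=> u v _ uv; rewrite intco_cst//; ring.
  have P2 := primitiveM (loc_bounded_cst (-1)) lcs ldW lW P1 (primitive_window c0 lf).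
  have := primitiveD _ _ P2 (primitive_window c0 luf).
  move=> H; apply: eq_primitive (H _ _) => //.
  - by move=> s _; ring.
  - apply: loc_boundedD; first exact: loc_boundedM.
    by apply: loc_boundedM => //; exact: loc_bounded_cst.
  - by apply: loc_boundedB => //; exact: loc_bounded_shift luf.
have EC s : 0 <= s -> `|E s| <= c * C.
  move=> s0; have sc' : s - c <= s by lra.
  have -> : E s = intco (fun u => (c - s) * f u + u * f u) (s - c) s.
    by rewrite intcoD ?intcoZ//; exact: loc_boundedZ.
  have l1 : loc_bounded (fun u => (c - s) * f u + u * f u).
    by apply: loc_boundedD => //; exact: loc_boundedZ.
  rewrite (le_trans (intco_norm l1 _ _))//.
  apply: (@le_trans _ _ (c * intco (fun u => `|f u|) (s - c) s)); last first.
    by rewrite ler_wpM2l// fC.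
  have l2 := loc_bounded_norm lf.
  rewrite -intcoZ//; apply: intco_le; [exact: loc_bounded_norm|exact: loc_boundedZ|].
  move=> u /andP[u1 u2]; rewrite -mulrDl normrM ler_wpM2r//.
  by rewrite ger0_norm; lra.
have := EP _ _ t0 th; rewrite intcoB//; last exact: loc_bounded_window.
  2: exact: loc_boundedZ.
rewrite intcoZ// => h1.
have := EC _ t0; have := EC _ (le_trans t0 th); rewrite !ler_norml.
by move=> /andP[? ?] /andP[? ?]; apply/andP; split; lra.
Qed.

(* Averaging the conservation law over long intervals removes the part of the
   channel contents that keeps oscillating. *)
Lemma potentials_cvg (z : N -> R -> R) :
  (forall j, loc_bounded (z j)) ->
  (forall j, primitive (z j) (inflow zt pt U j)) ->
  (forall j, zt j t - z j t @[t --> +oo] --> 0) ->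
  (forall j, slowly_varying (zt j)) ->
  (forall i j, zt i t - zt j t @[t --> +oo] --> 0) ->
  (forall i j, pt i t - pt j t @[t --> +oo] --> 0) ->
  exists l : R, forall j, zt j t @[t --> +oo] --> l.
Proof.
move=> lzz zA zz sz zc pc.
have [j0 _|noN] := pickP (fun _ : N => true); last first.
  by exists 0 => j; have := noN j.
have [c cP] := inflow_conserved zA.
(* [Q i j] is the mean of [d i j] found by [wave_mean] and [conj_wave_mean]. In [f] each channel
   content is replaced by [T i j * Q i j], which makes [f] slowly varying, while the conservation
   law bounds its integrals. *)
pose Q i j t := (zt i t + zt j t) + (pt i t - pt j t).
have lQ i j : loc_bounded (Q i j).
  by apply: loc_boundedD; [exact: loc_boundedD|exact: loc_boundedB].
pose f t := \sum_j z j t - c +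
  2^-1 * \sum_j \sum_(i | adj i j) w i j * (T i j * Q i j t).
have lW i j : adj i j -> loc_bounded (fun s => intco (d i j) (s - T i j) s).
  by move=> ij; apply: loc_bounded_window => //; exact: T_ge0.
have dQ i j : adj i j -> exists C : R, forall t h, 0 <= t -> 0 <= h ->
    `|T i j * intco (Q i j) t (t + h) -
      intco (fun s => intco (d i j) (s - T i j) s) t (t + h)| <= C.
  move=> ij; have [C1 C1P] := wave_mean ij; have [C2 C2P] := conj_wave_mean ij.
  exists (T i j * (C1 + C2) + 2 * (T i j * (T i j + K))) => t h t0 h0.
  have Tij := T_ge0 ij.
  have h1 := C1P t h t0 h0; have h2 := C2P t h t0 h0.
  have h3 : `|intco (fun s => intco (d i j) (s - T i j) s) t (t + h) -
      T i j * intco (d i j) t (t + h)| <= 2 * (T i j * (T i j + K)).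
    apply: integrated_window => // s s0.
    have [h4 h5] := window_wave_le ij s0.
    apply: (@le_trans _ _ (intco (fun u => `|U i j u| + `|V i j u|) (s - T i j) s)).
      apply: intco_le => [||u _]; first exact: loc_bounded_norm.
        by apply: loc_boundedD; exact: loc_bounded_norm.
      exact: ler_normB.
    by rewrite intcoD; [lra|exact: loc_bounded_norm|exact: loc_bounded_norm].
  have h4 : `|T i j * intco (Q i j) t (t + h) - T i j * intco (d i j) t (t + h)|
      <= T i j * (C1 + C2).
    rewrite -mulrBr normrM (ger0_norm Tij) ler_wpM2l//.
    have lzz' : loc_bounded (fun s => zt i s + zt j s) by exact: loc_boundedD.
    have lpp' : loc_bounded (fun s => pt i s - pt j s) by exact: loc_boundedB.
    move: h1 h2; rewrite /Q /d (intcoD lzz' lpp') !intcoB// !intcoD// !ler_norml.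
    by move=> /andP[? ?] /andP[? ?]; apply/andP; split; lra.
  move: h3 h4; rewrite !ler_norml.
  by move=> /andP[? ?] /andP[? ?]; apply/andP; split; lra.
have /choice[C CP] : forall ij : N * N, exists C : R, adj ij.1 ij.2 ->
    forall t h, 0 <= t -> 0 <= h -> `|T ij.1 ij.2 * intco (Q ij.1 ij.2) t (t + h) -
      intco (fun s => intco (d ij.1 ij.2) (s - T ij.1 ij.2) s) t (t + h)| <= C.
  move=> [i j] /=; have [ij|_] := boolP (adj i j); last by exists 0.
  by have [C CP] := dQ i j ij; exists C.
have lTQ i j : loc_bounded (fun s => w i j * (T i j * Q i j s)).
  by do 2 apply: loc_boundedZ.
have lsz : loc_bounded (fun t => \sum_j z j t) by exact: loc_bounded_sum.
have lf : loc_bounded f.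
  apply: loc_boundedD; first by apply: loc_boundedB => //; exact: loc_bounded_cst.
  by apply: loc_boundedZ; do 2 apply: loc_bounded_sum => ? _.
have sQ i j : slowly_varying (Q i j).
  by apply: slowD; [exact: slowD|exact: slow_cvg (pc i j)].
have ssz : slowly_varying (fun t => \sum_j z j t).
  apply: slow_sum => j _.
  apply: (@eq_slow _ (fun t => zt j t + (-1) * (zt j t - z j t))) => [t _|].
    by ring.
  by apply: slowD => //; apply: slow_cvg (cvg0Z (-1) (zz j)).
have f0 : f t @[t --> +oo] --> 0.
  apply: (@slow_cvg0 _ _ (2^-1 * \sum_j \sum_(i | adj i j) w i j * C (i, j))) => //.
    apply: slowD; first by apply: slowD => //; exact: slow_cst.
    by apply: slowZ; do 2 apply: slow_sum => ? _; do 2 apply: slowZ.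
  move=> t h t0 h0.
  have lG i j : adj i j -> loc_bounded (fun s =>
      w i j * (T i j * Q i j s - intco (d i j) (s - T i j) s)).
    by move=> ij; apply/loc_boundedZ/loc_boundedB; [exact: loc_boundedZ|exact: lW].
  have -> : intco f t (t + h) = intco (fun s => 2^-1 * \sum_j \sum_(i | adj i j)
      w i j * (T i j * Q i j s - intco (d i j) (s - T i j) s)) t (t + h).
    apply: intco_eq => s /andP[ts _]; rewrite /f -(cP s (le_trans t0 ts)).
    have -> : \sum_j \sum_(i | adj i j)
        w i j * (T i j * Q i j s - intco (d i j) (s - T i j) s) =
      \sum_j \sum_(i | adj i j) w i j * (T i j * Q i j s) -
      \sum_j \sum_(i | adj i j) w i j * intco (d i j) (s - T i j) s.
      rewrite -sumrB; apply: eq_bigr => j _; rewrite -sumrB.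
      by apply: eq_bigr => i _; ring.
    by ring.
  rewrite intcoZ; last by do 2 apply: loc_bounded_sum => ? ?; exact: lG.
  rewrite normrM ger0_norm ?invr_ge0// ler_wpM2l ?invr_ge0//.
  rewrite intco_sum; last by move=> j _; apply: loc_bounded_sum => i; exact: lG.
  rewrite (le_trans (ler_norm_sum _ _ _))//; apply: ler_sum => j _.
  rewrite intco_sum; last by move=> i; exact: lG.
  rewrite (le_trans (ler_norm_sum _ _ _))//; apply: ler_sum => i ij.
  have lTQ' : loc_bounded (fun s => T i j * Q i j s) by exact: loc_boundedZ.
  rewrite intcoZ; last by apply: loc_boundedB => //; exact: lW.
  rewrite intcoB//; last exact: lW.
  rewrite intcoZ// normrM gtr0_norm ?w_gt0// ler_pM2l ?w_gt0//.
  exact: (CP (i, j)).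
(* If all [z] and [zt] equal l and all [pt] agree, then [f] is [k * l - c]; hence the limit
   [c / k]. *)
pose k := #|N|%:R + \sum_j \sum_(i | adj i j) w i j * T i j.
have k0 : 0 < k.
  apply: ltr_pwDl; first by rewrite ltr0n; apply/card_gt0P; exists j0.
  apply: sumr_ge0 => j _; apply: sumr_ge0 => i ij.
  by rewrite mulr_ge0 ?T_ge0// ltW// w_gt0.
have zj0 : k^-1 * (f t + (\sum_j (zt j t - z j t) + -1 * \sum_j (zt j t - zt j0 t)
    + (- 2^-1) * \sum_j \sum_(i | adj i j) w i j * (T i j * ((zt i t - zt j0 t) +
    ((zt j t - zt j0 t) + (pt i t - pt j t)))))) @[t --> +oo] --> 0.
  apply: cvg0Z; apply: cvg0D => //; apply: cvg0D; first apply: cvg0D.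
  - exact: cvg_sum0.
  - by apply: cvg0Z; exact: cvg_sum0.
  - apply: cvg0Z; do 2 apply: cvg_sum0 => ? _; do 2 apply: cvg0Z.
    by apply: cvg0D => //; exact: cvg0D.
exists (c / k) => j.
have : zt j0 t - c / k @[t --> +oo] --> 0.
  apply: eq_cvg_ge0 zj0 => t _; rewrite /f.
  have -> : \sum_j (zt j t - z j t) = \sum_j zt j t - \sum_j z j t by rewrite sumrB.
  have -> : \sum_j (zt j t - zt j0 t) = \sum_j zt j t - #|N|%:R * zt j0 t.
    by rewrite sumrB sumr_const mulr_natl.
  have -> : \sum_j \sum_(i | adj i j) w i j * (T i j * ((zt i t - zt j0 t) +
    ((zt j t - zt j0 t) + (pt i t - pt j t)))) =
    \sum_j \sum_(i | adj i j) w i j * (T i j * Q i j t) -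
    2 * zt j0 t * \sum_j \sum_(i | adj i j) w i j * T i j.
    rewrite mulr_sumr -sumrB; apply: eq_bigr => a _.
    rewrite mulr_sumr -sumrB; apply: eq_bigr => b _; rewrite /Q; ring.
  by rewrite /k; field; apply: lt0r_neq0; exact: k0.
move=> /(cvg0D (zc j j0)) H.
have {}H : zt j t - zt j0 t + (zt j0 t - c / k) + c / k @[t --> +oo] --> 0 + c / k.
  by apply: cvgD H _; exact: cvg_cst.
by rewrite add0r in H; apply: eq_cvg_ge0 H => t _; ring.
Qed.

(** For each channel, of unit weight, the power given to the controller at the receiving end is a
    quarter of the squared wave that arrives minus that of the wave sent back. This is the origin of
    the factor [4^-1] in the energy functional. *)
Lemma energy_balance t : 0 <= t ->
  \sum_j (zt j t * inflow zt pt U j t +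
    pt j t * inflow pt (fun j t => - zt j t) (fun i j t => - V i j t) j t) =
  4^-1 * \sum_j \sum_(i | adj i j) w i j * (g i j (t - T i j) - g i j t).
Proof.
move=> t0; have -> :
    \sum_j \sum_(i | adj i j) w i j * (g i j (t - T i j) - g i j t) =
    \sum_j \sum_(i | adj i j) w i j * g i j (t - T i j) -
    \sum_j \sum_(i | adj i j) w i j * g i j t.
  rewrite -sumrB; apply: eq_bigr => j _; rewrite -sumrB.
  by apply: eq_bigr => i _; ring.
rewrite (exchange_adj adjC (fun i j => w i j * g i j t)) -sumrB mulr_sumr.
apply: eq_bigr => j _; rewrite /inflow !mulr_sumr -big_split -sumrB mulr_sumr /=.
apply: eq_bigr => i ij; have ji : adj j i by rewrite adjC.
by have [h1 h2] := sc ji t0; rewrite -(wC ij) /g h1 h2; field.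
Qed.

(** A positive delay [T i j] makes [energy] itself the bound. If it is 0 and [T j i] is positive,
    the waves leaving [i] are reflections of those stored in the channel from [j]; if both are 0,
    the four relations determine the waves from the states. *)
Lemma local_energy i j : adj i j -> exists2 h : R, 0 < h & exists C : R,
  forall s t, 0 <= s -> s <= t -> t <= s + h -> intco (g i j) s t <= C.
Proof.
move=> ij; have ji : adj j i by rewrite adjC.
have g0 a b t : 0 <= g a b t by rewrite addr_ge0 ?sqr_ge0.
have := T_ge0 ij; rewrite le_eqVlt => /predU1P[Tij|Tij]; last first.
  exists (T i j) => //; exists K => s t s0 st tT.
  apply: le_trans (EK ij (le_trans s0 st)).
  by apply: intco_mono => //; lra.
have sqK x : `|x| <= K -> x ^+ 2 <= K ^+ 2.
  by move=> xK; rewrite -(real_normK (num_real x)) ler_sqr// nnegrE (K0 ij).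
have := T_ge0 ji; rewrite le_eqVlt => /predU1P[Tji|Tji].
  exists 1 => //; exists (8 * K ^+ 2) => s t s0 st t1.
  apply: (@le_trans _ _ (intco (fun=> 8 * K ^+ 2) s t)).
    apply: intco_le => // [|u /andP[su _]]; first exact: loc_bounded_cst.
    have u0 := le_trans s0 su.
    have [h1 h2] := sc ij u0; have [h3 h4] := sc ji u0.
    rewrite -Tij subr0 in h3 h4; rewrite -Tji subr0 in h1 h2.
    have -> : g i j u = (zt i u - pt j u) ^+ 2 + (zt j u + pt i u) ^+ 2.
      have -> : zt i u - pt j u = U i j u by lra.
      have -> : zt j u + pt i u = - V i j u by lra.
      by rewrite sqrrN.
    have := sqK _ (zK i u0); have := sqK _ (zK j u0).
    have := sqK _ (pK i u0); have := sqK _ (pK j u0).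
    have := sqr_ge0 (zt i u + pt j u); have := sqr_ge0 (zt j u - pt i u).
    rewrite !sqrrD !sqrrN; lra.
  rewrite intco_cst// ler_piMr//; last lra.
  by rewrite mulr_ge0// sqr_ge0.
(* Each component is a delayed one plus a term of size at most [2 * K], and (a + b)^2 <= 2 a^2 + 2
   b^2; on an interval of length at most [T j i] the delayed squares lie in one window of the return
   channel. *)
exists (T j i) => //; exists (2 * K + 16 * K ^+ 2 * T j i) => s t s0 st tT.
have lgs := loc_bounded_shift (T j i) (lg j i).
apply: (@le_trans _ _
    (intco (fun u => 2 * g j i (u - T j i) + 16 * K ^+ 2) s t)).
  apply: intco_le => // [|u /andP[su _]].
    by apply: loc_boundedD; [exact: loc_boundedZ|exact: loc_bounded_cst].
  have u0 := le_trans s0 su; have [h1 h2] := sc ij u0.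
  rewrite /g h1 h2; have := sqK _ (zK i u0); have := sqK _ (pK i u0).
  have := sqr_ge0 (V j i (u - T j i) - 2 * zt i u).
  have := sqr_ge0 (U j i (u - T j i) - 2 * pt i u).
  rewrite !sqrrD !sqrrN !exprMn; lra.
rewrite intcoD; [|exact: loc_boundedZ|exact: loc_bounded_cst].
rewrite intcoZ// intco_shift// intco_cst// lerD//.
  rewrite ler_pM2l//; apply: le_trans (EK ji s0).
  by apply: intco_mono => //; lra.
apply: ler_wpM2l; last lra.
by apply: mulr_ge0 => //; exact: sqr_ge0.
Qed.

Lemma small_integrals_inflow j : small_integrals (inflow zt pt U j).
Proof.
have l1 i : loc_bounded (fun s => zt j s - U j i s - pt j s).
  by do 2 apply: loc_boundedB => //.
apply: small_integrals_sum => i ij; first exact: loc_boundedZ.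
have ji : adj j i by rewrite adjC.
apply: small_integralsZ => //.
have sU : small_integrals (U j i).
  have [h h0 [C CP]] := local_energy ji.
  apply: (small_integrals_sqr (lU j i) h0) => s t s0 st th.
  apply: le_trans (CP s t s0 st th); apply: intco_le => //.
    exact: loc_boundedX.
  by move=> u _; rewrite /g lerDl sqr_ge0.
have -> : (fun s => zt j s - U j i s - pt j s) =
    (fun s => (zt j s + -1 * U j i s) + -1 * pt j s).
  by apply/funext => s; ring.
have lmU : loc_bounded (fun s => -1 * U j i s) by exact: loc_boundedZ.
apply: small_integralsD; [exact: loc_boundedD|exact: loc_boundedZ| |].
  apply: small_integralsD => //; last exact: small_integralsZ.
  exact: small_integrals_bounded (zK j).
by apply: small_integralsZ => //; exact: small_integrals_bounded (pK j).
Qed.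

End OneState.
End Scattering.

(** * Energy of the lines *)

Section Sine.
Context {R : realType}.
Implicit Types (x y a b : R).

Lemma MVT_unordered (f df : R -> R) x y :
  (forall z : R, is_derive z 1 f (df z)) ->
  exists2 z, (x <= z <= y) || (y <= z <= x) & f y - f x = df z * (y - x).
Proof.
move=> fdf.
have cf : continuous f.
  by move=> z; apply/differentiable_continuous/derivable1_diffP/(@ex_derive _ _ _ _ _ _ _ (fdf z)).
have [xy|/ltW yx] := leP x y.
  have [z + E] := MVT_segment xy (fun z _ => fdf z) (continuous_subspaceT cf).
  by rewrite in_itv /= => zxy; exists z => //; rewrite zxy.
have [z + E] := MVT_segment yx (fun z _ => fdf z) (continuous_subspaceT cf).
rewrite in_itv /= => zxy; exists z; first by rewrite zxy orbT.
by rewrite -opprB E; ring.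
Qed.

Lemma between_dist x y z : (x <= z <= y) || (y <= z <= x) ->
  `|z - x| <= `|y - x|.
Proof.
case/orP=> /andP[h1 h2].
  by rewrite !ger0_norm; lra.
by rewrite !ler0_norm; lra.
Qed.

Lemma sin_lipschitz x y : `|sin x - sin y| <= `|x - y|.
Proof.
have [z _ ->] := MVT_unordered y x (fun z => is_derive_sin z).
by rewrite normrM ler_piMl// cos_max.
Qed.

Lemma cos_mvt x y : exists2 z, (x <= z <= y) || (y <= z <= x) &
  cos x - cos y = sin z * (y - x).
Proof.
have [z zxy E] := MVT_unordered x y (fun z => is_derive_cos z).
by exists z => //; rewrite -opprB E; ring.
Qed.

(** The Bregman divergence of [- cos] at [a]: the first-order part is removed, and the derivative in
    [x] is the flow deviation [sin (a + x) - sin a]. *)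
Definition line_energy a x := cos a - cos (a + x) - sin a * x.

Lemma line_energy_quadratic a x y :
  `|line_energy a y - line_energy a x - (sin (a + x) - sin a) * (y - x)| <=
  1 * (y - x) ^+ 2.
Proof.
have [z zxy E] := cos_mvt (a + x) (a + y).
have -> : line_energy a y - line_energy a x - (sin (a + x) - sin a) * (y - x)
    = (sin z - sin (a + x)) * (y - x).
  have D : a + y - (a + x) = y - x by ring.
  by rewrite D in E; rewrite [RHS]mulrBl -E /line_energy; ring.
rewrite mul1r normrM -real_normK ?num_real// expr2 ler_wpM2r//.
rewrite (le_trans (sin_lipschitz _ _))// (le_trans (between_dist zxy))//.
by rewrite (_ : a + y - (a + x) = y - x)//; ring.
Qed.

Lemma line_energy_le a x : line_energy a x <= x ^+ 2.
Proof.
have E0 : line_energy a 0 = 0 by rewrite /line_energy addr0; ring.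
have := line_energy_quadratic a 0 x.
rewrite E0 addr0 subrr mul0r !subr0 mul1r => h; exact: le_trans (ler_norm _) h.
Qed.

Lemma line_energy_ge0 a x : `|a| + `|x| < pi / 2 -> 0 <= line_energy a x.
Proof.
move=> ax; have [z zx E] := cos_mvt a (a + x).
have -> : line_energy a x = (sin z - sin a) * x.
  by rewrite /line_energy E; ring.
have ha := ler_norm a; have ha' := lerNnormlW (lexx `|a|).
have hx := ler_norm x; have hx' := lerNnormlW (lexx `|x|).
have ain : a \in `[- (pi / 2), pi / 2] by rewrite in_itv /=; lra.
have zin : z \in `[- (pi / 2), pi / 2].
  by rewrite in_itv /=; move: zx => /orP[] /andP[? ?]; lra.
have [x0|x0] := leP 0 x.
  rewrite mulr_ge0// subr_ge0 leNgt (ltr_sin zin ain) -leNgt.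
  by move: zx => /orP[] /andP[? ?]; lra.
rewrite -mulrNN mulr_ge0 ?oppr_ge0 ?(ltW x0)// subr_le0 leNgt (ltr_sin ain zin).
by rewrite -leNgt; move: zx => /orP[] /andP[? ?]; lra.
Qed.

Lemma line_energy_gt0 a x : x != 0 -> `|a| + `|x| < pi / 2 ->
  0 < line_energy a x.
Proof.
move=> x0 ax; have ha := ler_norm a; have ha' := lerNnormlW (lexx `|a|).
have hx := ler_norm x; have hx' := lerNnormlW (lexx `|x|).
have ain : a \in `[- (pi / 2), pi / 2] by rewrite in_itv /=; lra.
have hin : a + x / 2 \in `[- (pi / 2), pi / 2] by rewrite in_itv /=; lra.
(* the second half of the way to [a + x] already gains a positive amount *)
have half : 0 <= line_energy a (x / 2).
  apply: line_energy_ge0; rewrite normrM (ger0_norm (x := 2^-1)) ?invr_ge0//.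
  by have := normr_ge0 x; lra.
have [z zx E] := cos_mvt (a + x / 2) (a + x).
have zin : z \in `[- (pi / 2), pi / 2].
  by rewrite in_itv /=; move: zx => /orP[] /andP[? ?]; lra.
suff : 0 < (sin z - sin a) * (a + x - (a + x / 2)).
  by move: half; rewrite mulrBl -E /line_energy; lra.
have -> : a + x - (a + x / 2) = x / 2 by field.
have [x1|x1] := ltP 0 x.
  rewrite mulr_gt0 ?divr_gt0// subr_gt0 (ltr_sin ain zin).
  by move: zx => /orP[] /andP[? ?]; lra.
have x2 : x < 0 by rewrite lt_neqAle x0.
rewrite -mulrNN mulr_gt0 ?oppr_gt0//; last by lra.
rewrite subr_lt0 (ltr_sin zin ain).
by move: zx => /orP[] /andP[? ?]; lra.
Qed.

(** The constant is [cos (|a| + d)], the least value of the derivative of sine between the points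
    concerned. *)
Lemma sin_strongly_monotone a d : 0 <= d -> `|a| + d < pi / 2 ->
  exists2 c, 0 < c & forall x y, `|x| <= d -> `|y| <= d ->
    c * (x - y) ^+ 2 <= (sin (a + x) - sin (a + y)) * (x - y).
Proof.
move=> d0 ad; have a0 := normr_ge0 a; exists (cos (`|a| + d)).
  by apply: cos_gt0_pihalf; lra.
move=> x y xd yd; have [z zxy E] := MVT_unordered (a + y) (a + x) (fun z => is_derive_sin z).
rewrite E (_ : a + x - (a + y) = x - y); last by ring.
rewrite -mulrA -expr2 ler_wpM2r ?sqr_ge0//.
have ha := ler_norm a; have ha' := lerNnormlW (lexx `|a|).
move: xd yd; rewrite !ler_norml => /andP[? ?] /andP[? ?].
have pih := @pihalf_lt2 R; have zd : `|z| <= `|a| + d.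
  by rewrite ler_norml; move: zxy => /orP[] /andP[? ?]; lra.
rewrite -[cos z]cos_norm leNgt; apply/negP; rewrite ltr_cos ?in_itv/=; [|lra|].
  by move=> H; lra.
by have := normr_ge0 z; lra.
Qed.

End Sine.

(** * Bounded and uniformly continuous functions, and a barrier argument *)

Section Bounded.
Context {R : realType}.
Implicit Types (f g : R -> R).

Lemma slow_le f g (C : R) : (forall s t, `|f s - f t| <= C * `|g s - g t|) ->
  slowly_varying g -> slowly_varying f.
Proof.
move=> fg sg h e h0 e0; have C0 : 0 < `|C| + 1 by rewrite ltr_wpDl.
have [t0 t00 gt] := sg h _ h0 (divr_gt0 e0 C0).
exists t0 => // s t tt ts st; rewrite (le_trans (fg _ _))//.
have := gt s t tt ts st; rewrite ler_pdivlMr// mulrC; apply: le_trans.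
by apply: ler_wpM2r => //; have := ler_norm C; lra.
Qed.

Lemma unif_continuous_le f g (C : R) :
  (forall s t, `|f s - f t| <= C * `|g s - g t|) ->
  ge0_unif_continuous g -> ge0_unif_continuous f.
Proof.
move=> fg ug e e0; have C0 : 0 < `|C| + 1 by rewrite ltr_wpDl.
have [d d0 gd] := ug _ (divr_gt0 e0 C0).
exists d => // s t s0 st td; rewrite (le_trans (fg _ _))//.
have := gd s t s0 st td; rewrite ler_pdivlMr// mulrC; apply: le_trans.
by apply: ler_wpM2r => //; have := ler_norm C; lra.
Qed.

Lemma unif_continuousD f g : ge0_unif_continuous f -> ge0_unif_continuous g ->
  ge0_unif_continuous (fun t => f t + g t).
Proof.
move=> uf ug e e0; have e2 : 0 < e / 2 by lra.
have [d1 d10 f1] := uf _ e2; have [d2 d20 g2] := ug _ e2.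
exists (Num.min d1 d2) => [|s t s0 st]; first by rewrite lt_min d10.
rewrite -lerBlDl le_min => /andP[t1 t2].
have -> : f t + g t - (f s + g s) = (f t - f s) + (g t - g s) by ring.
rewrite (le_trans (ler_normD _ _))// (splitr e).
by rewrite lerD// ?f1 ?g2// -lerBlDl.
Qed.

Lemma unif_continuousZ (k : R) f : ge0_unif_continuous f ->
  ge0_unif_continuous (fun t => k * f t).
Proof.
by apply: (@unif_continuous_le _ _ `|k|) => s t; rewrite -mulrBr normrM.
Qed.

Lemma unif_continuous_sum (I : Type) (r : seq I) (P : pred I) (h : I -> R -> R) :
  (forall i, P i -> ge0_unif_continuous (h i)) ->
  ge0_unif_continuous (fun t => \sum_(i <- r | P i) h i t).
Proof.
move=> uh; elim: r => [|i r IH].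
  by move=> e e0; exists 1 => // s t _ _ _; rewrite !big_nil subrr normr0 ltW.
have [Pi|nPi] := boolP (P i).
  by under eq_fun do rewrite big_cons Pi; apply: unif_continuousD => //; exact: uh.
by under eq_fun do rewrite big_cons (negbTE nPi).
Qed.

Definition ge0_bounded f := exists K : R, forall t, 0 <= t -> `|f t| <= K.

Lemma ge0_boundedD f g : ge0_bounded f -> ge0_bounded g ->
  ge0_bounded (fun t => f t + g t).
Proof.
move=> [K fK] [L gL]; exists (K + L) => t t0.
by rewrite (le_trans (ler_normD _ _))// lerD ?fK ?gL.
Qed.

Lemma ge0_boundedZ (k : R) f : ge0_bounded f -> ge0_bounded (fun t => k * f t).
Proof.
by move=> [K fK]; exists (`|k| * K) => t t0; rewrite normrM ler_wpM2l// fK.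
Qed.

Lemma ge0_bounded_sum (I : Type) (r : seq I) (P : pred I) (h : I -> R -> R) :
  (forall i, P i -> ge0_bounded (h i)) ->
  ge0_bounded (fun t => \sum_(i <- r | P i) h i t).
Proof.
move=> bh; elim: r => [|i r IH].
  by exists 0 => t _; rewrite big_nil normr0.
have [Pi|nPi] := boolP (P i).
  by under eq_fun do rewrite big_cons Pi; apply: ge0_boundedD => //; exact: bh.
by under eq_fun do rewrite big_cons (negbTE nPi).
Qed.

Lemma ge0_bounded_sqr f (c K : R) : 0 < c ->
  (forall t, 0 <= t -> c * f t ^+ 2 <= K) -> ge0_bounded f.
Proof.
move=> c0 fK; exists ((K / c + 1) / 2) => t t0.
have h : f t ^+ 2 <= K / c by rewrite ler_pdivlMr// mulrC fK.
have := sqr_ge0 (`|f t| - 1).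
by rewrite sqrrB1 real_normK ?num_real//; lra.
Qed.

Lemma ge0_bounded_unif (I : finType) (h : I -> R -> R) :
  (forall i, ge0_bounded (h i)) ->
  exists2 K : R, 0 <= K & forall i t, 0 <= t -> `|h i t| <= K.
Proof.
move=> /choice[K hK]; exists (\sum_i `|K i|) => [|i t t0]; first exact: sumr_ge0.
rewrite (le_trans (hK i t t0))// (le_trans (ler_norm _))//.
by rewrite (bigD1 i)//= lerDl sumr_ge0.
Qed.

(** To leave, the maximum of the [|h i|] would take the value [d] at some instant, by the
    intermediate value theorem. The barrier hypothesis is applied at that instant, when all
    coordinates are within [d] and one of them attains it. *)
Lemma trapped (I : finType) (P : pred I) (h : I -> R -> R) (d : R) :
  0 < d -> (forall i, P i -> continuous (h i)) ->
  (forall i, P i -> `|h i 0| < d) ->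
  (forall t, 0 <= t -> (forall i, P i -> `|h i t| <= d) ->
     forall i, P i -> `|h i t| != d) ->
  forall t, 0 <= t -> forall i, P i -> `|h i t| < d.
Proof.
move=> d0 ch h0 hd t t0 i Pi; rewrite ltNge; apply/negP => dht.
pose m (s : R) := \big[Num.max/0]_(i | P i) `|h i s|.
have cm : continuous m.
  rewrite /m; elim: (index_enum I) => [|a r IH].
    by under eq_fun do rewrite big_nil; move=> s; exact: cvg_cst.
  have [Pa|nPa] := boolP (P a).
    under eq_fun do rewrite big_cons Pa.
    move=> s; apply: (@continuous_max _ _ (fun s => `|h a s|)); last exact: IH.
    by apply: continuous_comp; [exact: ch|exact: norm_continuous].
  by under eq_fun do rewrite big_cons (negbTE nPa).
have m_ge s j : P j -> `|h j s| <= m s by move=> Pj; exact: le_bigmax_cond.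
have m_lt s : (forall j, P j -> `|h j s| < d) -> m s < d.
  by move=> hs; apply: bigmax_lt.
have [] := IVT (v := d) t0 (continuous_subspaceT cm).
  by rewrite ge_min le_max (ltW (m_lt 0 h0)) (le_trans dht (m_ge t i Pi)) orbT.
move=> s; rewrite in_itv /= => /andP[s0 st] msd.
have hs j : P j -> `|h j s| <= d by move=> Pj; rewrite -msd m_ge.
suff : m s < d by rewrite msd ltxx.
by apply: m_lt => j Pj; rewrite lt_neqAle hd// hs.
Qed.

End Bounded.

(** * Lyapunov analysis of the closed loop *)

Section LineSums.
Context {R : realType} {N : finType}.
Variable line : {set N * N}.

(** The divergence of a flow on the oriented graph, adjoint to the difference operator of
    potentials. *)
Definition netflow (fl : N * N -> R) j :=
  \sum_(k | (j, k) \in line) fl (j, k) - \sum_(i | (i, j) \in line) fl (i, j).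

Lemma sum_line (F : N * N -> R) :
  \sum_(e in line) F e = \sum_j \sum_(k | (j, k) \in line) F (j, k).
Proof.
rewrite pair_big_dep /=; apply: eq_big => [[j k]|[j k] _] //=.
Qed.

Lemma summation_by_parts (fl : N * N -> R) (x : N -> R) :
  \sum_(e in line) fl e * (x e.1 - x e.2) = \sum_j x j * netflow fl j.
Proof.
transitivity (\sum_j \sum_(k | (j, k) \in line) fl (j, k) * x j -
  \sum_j \sum_(k | (j, k) \in line) fl (j, k) * x k).
  rewrite -(sum_line (fun e => fl e * x e.1)) -(sum_line (fun e => fl e * x e.2)).
  by rewrite -sumrB; apply: eq_bigr => e _; ring.
rewrite [X in _ - X](exchange_big_dep predT)//= -sumrB.
apply: eq_bigr => j _; rewrite /netflow mulrBr !mulr_sumr.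
by congr (_ - _); apply: eq_bigr => i _; ring.
Qed.

Lemma sum_netflow fl : \sum_j netflow fl j = 0.
Proof.
have := summation_by_parts fl (fun=> 1).
rewrite big1 => [E|e _]; last by rewrite subrr mulr0.
by rewrite [RHS]E; apply: eq_bigr => j _; rewrite mul1r.
Qed.

End LineSums.

(** * Energy functional and convergence of the deviations *)

Section ClosedLoop.
Context {R : realType} {N : finType}.
Variables (adj : rel N) (w T : N -> N -> R).
Hypothesis adjC : symmetric adj.
Hypothesis adj_connected : forall i j, connect adj i j.
Hypothesis w_gt0 : forall i j, adj i j -> 0 < w i j.
Hypothesis wC : forall i j, adj i j -> w i j = w j i.
Hypothesis T_ge0 : forall i j, adj i j -> 0 <= T i j.

Variables (gen : {set N}) (line : {set N * N}).
Variables (Mi La tau kk : N -> R) (Y : N * N -> R).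
Hypothesis line_connected : forall i j, connect (Defs.adjacent line) i j.
Hypothesis Mi_gt0 : forall j, j \in gen -> 0 < Mi j.
Hypothesis La_gt0 : forall j, 0 < La j.
Hypothesis tau_gt0 : forall j, j \in gen -> 0 < tau j.
Hypothesis kk_gt0 : forall j, j \in gen -> 0 < kk j.
Hypothesis Y_gt0 : forall e, e \in line -> 0 < Y e.

Variables (es : N * N -> R) (dl : R) (dQ : N -> R -> R).
Hypothesis dl_gt0 : 0 < dl.
Hypothesis es_dl : forall e, e \in line -> `|es e| + dl < pi / 2.
Hypothesis dQ_continuous : forall j, j \in gen -> continuous (dQ j).
Hypothesis dQ_incr : forall j, j \in gen -> {homo dQ j : x y / x < y}.
Hypothesis dQ0 : forall j, j \in gen -> dQ j 0 = 0.

(* All states are deviations from an equilibrium. *)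
Variables (et : N * N -> R -> R) (om mm rz zt rp pt : N -> R -> R).
Variables (U V : N -> N -> R -> R).
Hypothesis et_continuous : forall e, e \in line -> continuous (et e).
Hypothesis om_continuous : forall j, continuous (om j).
Hypothesis mm_continuous : forall j, continuous (mm j).
Hypothesis rz_continuous : forall j, continuous (rz j).
Hypothesis zt_continuous : forall j, continuous (zt j).
Hypothesis rp_continuous : forall j, continuous (rp j).
Hypothesis pt_continuous : forall j, continuous (pt j).
Hypothesis lU : forall i j, loc_bounded (U i j).
Hypothesis lV : forall i j, loc_bounded (V i j).

Definition flow_dev (x : N * N -> R) e := Y e * (sin (es e + x e) - sin (es e)).
Let F j t := netflow line (flow_dev (et ^~ t)) j.
Let A := inflow adj w zt pt U.
Let B := inflow adj w pt (fun j t => - zt j t) (fun i j t => - V i j t).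

Hypothesis et_primitive : forall e, e \in line ->
  primitive (et e) (fun t => om e.1 t - om e.2 t).
Hypothesis om_primitive : forall j, j \in gen ->
  primitive (fun t => Mi j * om j t) (fun t => mm j t - La j * om j t - F j t).
Hypothesis load_om : forall j, j \notin gen -> forall t, 0 <= t ->
  La j * om j t = - F j t.
Hypothesis load_mm : forall j, j \notin gen -> forall t, 0 <= t -> mm j t = 0.
Hypothesis mm_primitive : forall j, j \in gen -> primitive
  (fun t => tau j * mm j t) (fun t => kk j * (pt j t - om j t - dQ j (mm j t))).
Hypothesis rz_primitive : forall j,
  primitive (rz j) (fun t => - rz j t + A j t).
Hypothesis zt_primitive : forall j,
  primitive (zt j) (fun t => - rz j t + 2 * A j t).
Hypothesis rp_primitive : forall j,
  primitive (rp j) (fun t => - rp j t - mm j t + B j t).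
Hypothesis pt_primitive : forall j,
  primitive (pt j) (fun t => - rp j t - 2 * mm j t + 2 * B j t).
Hypothesis UV_scatters : scatters adj T zt pt U V.

Let g i j t := U i j t ^+ 2 + V i j t ^+ 2.

(** The variables [zt - rz] and [pt - rp] are used because their derivatives are free of the [rho]
    terms; this makes each half of the controller passive, with output [zt] or [pt]. The weight
    [tau j / kk j] gives the turbine unit gain from the price and frequency deviations. *)
Definition storage t :=
  \sum_j (((zt j t - rz j t) ^+ 2 / 2 + rz j t ^+ 2 / 2) +
          ((pt j t - rp j t) ^+ 2 / 2 + rp j t ^+ 2 / 2)) +
  4^-1 * \sum_j \sum_(i | adj i j) w i j * energy T U V i j t +
  \sum_(j in gen) (Mi j * (om j t ^+ 2 / 2) + tau j / kk j * (mm j t ^+ 2 / 2)) +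
  \sum_(e in line) Y e * line_energy (es e) (et e t).

Hypothesis barrier : forall e x, e \in line -> `|x| = dl ->
  storage 0 < Y e * line_energy (es e) x.
Hypothesis et_init : forall e, e \in line -> `|et e 0| < dl.

Definition dissipation t :=
  \sum_j (La j * om j t ^+ 2 + (rz j t ^+ 2 + rp j t ^+ 2)) +
  \sum_(j in gen) mm j t * dQ j (mm j t).

Let let_ e : e \in line -> loc_bounded (et e).
Proof. by move=> /et_continuous/loc_bounded_continuous. Qed.
Let lom j : loc_bounded (om j). Proof. exact/loc_bounded_continuous. Qed.
Let lmm j : loc_bounded (mm j). Proof. exact/loc_bounded_continuous. Qed.
Let lrz j : loc_bounded (rz j). Proof. exact/loc_bounded_continuous. Qed.
Let lzt j : loc_bounded (zt j). Proof. exact/loc_bounded_continuous. Qed.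
Let lrp j : loc_bounded (rp j). Proof. exact/loc_bounded_continuous. Qed.
Let lpt j : loc_bounded (pt j). Proof. exact/loc_bounded_continuous. Qed.

Let lg i j : loc_bounded (g i j).
Proof. by apply: loc_boundedD; exact: loc_boundedX. Qed.

Let lA j : loc_bounded (A j).
Proof.
by apply: loc_bounded_sum => i _; apply: loc_boundedZ; do 2 apply: loc_boundedB => //.
Qed.

Let lB j : loc_bounded (B j).
Proof.
apply: loc_bounded_sum => i _; apply: loc_boundedZ.
by do 2 (apply: loc_boundedB; last exact: loc_boundedN) => //.
Qed.

Let lsin e : e \in line ->
  loc_bounded (fun t => sin (es e + et e t) - sin (es e)).
Proof.
move=> el; apply: loc_boundedB; last exact: loc_bounded_cst.
split; last by exists 1 => t _; exact: sin_max.
apply: measurableT_comp; first by apply: continuous_measurable_fun; exact: continuous_sin.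
by apply: (loc_boundedD _ (let_ el)).1; exact: loc_bounded_cst.
Qed.

Let lfl e : e \in line -> loc_bounded (fun t => flow_dev (et ^~ t) e).
Proof. by move=> el; exact/loc_boundedZ/lsin. Qed.

Let lF j : loc_bounded (F j).
Proof. by apply: loc_boundedB; apply: loc_bounded_sum => k; exact: lfl. Qed.

Let ldQ j : j \in gen -> loc_bounded (fun t => dQ j (mm j t)).
Proof.
move=> jg; apply: loc_bounded_continuous => t.
by apply: continuous_comp; [exact: mm_continuous|exact: dQ_continuous].
Qed.

Lemma loc_bounded_dissipation : loc_bounded dissipation.
Proof.
apply: loc_boundedD; apply: loc_bounded_sum => j jg.
  apply: loc_boundedD; first by apply: loc_boundedZ; exact: loc_boundedX.
  by apply: loc_boundedD; exact: loc_boundedX.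
by apply: loc_boundedM => //; exact: ldQ.
Qed.

Let zm_primitive j : primitive (fun t => zt j t - rz j t) (A j).
Proof.
have l1 : loc_bounded (fun t => - rz j t + A j t).
  by apply: loc_boundedD => //; exact: loc_boundedN.
have l2 : loc_bounded (fun t => - rz j t + 2 * A j t).
  by apply: loc_boundedD; [exact: loc_boundedN|exact: loc_boundedZ].
have := primitiveD l2 (loc_boundedZ (-1) l1) (zt_primitive j)
  (primitiveZ (-1) l1 (rz_primitive j)).
by apply: eq_primitive => t _; ring.
Qed.

Let q_primitive j : primitive (fun t => pt j t - rp j t) (fun t => - mm j t + B j t).
Proof.
have l1 : loc_bounded (fun t => - rp j t - mm j t + B j t).
  by apply: loc_boundedD => //; apply: loc_boundedB => //; exact: loc_boundedN.
have l2 : loc_bounded (fun t => - rp j t - 2 * mm j t + 2 * B j t).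
  apply: loc_boundedD; last exact: loc_boundedZ.
  by apply: loc_boundedB; [exact: loc_boundedN|exact: loc_boundedZ].
have := primitiveD l2 (loc_boundedZ (-1) l1) (pt_primitive j)
  (primitiveZ (-1) l1 (rp_primitive j)).
by apply: eq_primitive => t _; ring.
Qed.

Let om_primitive' j : j \in gen ->
  primitive (om j) (fun t => (Mi j)^-1 * (mm j t - La j * om j t - F j t)).
Proof.
move=> jg; have Mj : Mi j != 0 by rewrite gt_eqF// Mi_gt0.
have l : loc_bounded (fun t => mm j t - La j * om j t - F j t).
  by apply: loc_boundedB => //; apply: loc_boundedB => //; exact: loc_boundedZ.
apply: eq_primitive (primitiveZ (Mi j)^-1 l (om_primitive jg)) => // t _.
by rewrite mulKf.
Qed.

Let mm_primitive' j : j \in gen -> primitive (mm j)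
  (fun t => (tau j)^-1 * (kk j * (pt j t - om j t - dQ j (mm j t)))).
Proof.
move=> jg; have tj : tau j != 0 by rewrite gt_eqF// tau_gt0.
have l : loc_bounded (fun t => kk j * (pt j t - om j t - dQ j (mm j t))).
  apply: loc_boundedZ; apply: loc_boundedB; last exact: ldQ.
  exact: loc_boundedB.
apply: eq_primitive (primitiveZ (tau j)^-1 l (mm_primitive jg)) => // t _.
by rewrite mulKf.
Qed.

Let lom' j : j \in gen ->
  loc_bounded (fun t => (Mi j)^-1 * (mm j t - La j * om j t - F j t)).
Proof.
move=> jg; apply: loc_boundedZ; apply: loc_boundedB => //.
by apply: loc_boundedB => //; exact: loc_boundedZ.
Qed.

Let lmm' j : j \in gen ->
  loc_bounded (fun t => (tau j)^-1 * (kk j * (pt j t - om j t - dQ j (mm j t)))).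
Proof.
move=> jg; do 2 apply: loc_boundedZ; apply: loc_boundedB; last exact: ldQ.
exact: loc_boundedB.
Qed.

Let lrz' j : loc_bounded (fun t => - rz j t + A j t).
Proof. by apply: loc_boundedD => //; exact: loc_boundedN. Qed.

Let lq' j : loc_bounded (fun t => - mm j t + B j t).
Proof. by apply: loc_boundedD => //; exact: loc_boundedN. Qed.

Let lrp' j : loc_bounded (fun t => - rp j t - mm j t + B j t).
Proof.
by apply: loc_boundedD => //; apply: loc_boundedB => //; exact: loc_boundedN.
Qed.

(** Everything but damping cancels: zt A + pt B against the waves in transit, pt mm and om mm
    against the turbine input, and om F against the lines through summation by parts. *)
Let storage_rate t : 0 <= t ->
  \sum_j (((zt j t - rz j t) * A j t + rz j t * (- rz j t + A j t)) +
          ((pt j t - rp j t) * (- mm j t + B j t) +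
            rp j t * (- rp j t - mm j t + B j t))) +
  4^-1 * \sum_j \sum_(i | adj i j) w i j * (g i j t - g i j (t - T i j)) +
  \sum_(j in gen) (
    Mi j * (om j t * ((Mi j)^-1 * (mm j t - La j * om j t - F j t))) +
    tau j / kk j * (mm j t *
      ((tau j)^-1 * (kk j * (pt j t - om j t - dQ j (mm j t)))))) +
  \sum_(e in line) Y e * ((sin (es e + et e t) - sin (es e)) *
    (om e.1 t - om e.2 t)) = - dissipation t.
Proof.
move=> t0.
have -> : 4^-1 * \sum_j \sum_(i | adj i j) w i j * (g i j t - g i j (t - T i j)) =
    - \sum_j (zt j t * A j t + pt j t * B j t).
  rewrite (energy_balance adjC wC UV_scatters)// -mulrN -sumrN; congr (_ * _).
  by apply: eq_bigr => j _; rewrite -sumrN; apply: eq_bigr => i _; rewrite /g; ring.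
have -> : \sum_(e in line) Y e * ((sin (es e + et e t) - sin (es e)) *
    (om e.1 t - om e.2 t)) = \sum_j om j t * F j t.
  rewrite -(summation_by_parts line (flow_dev (et ^~ t)) (om ^~ t)).
  by apply: eq_bigr => e _; rewrite /flow_dev mulrA.
rewrite /dissipation ![\sum_(j in gen) _]big_mkcond/= -sumrN -!big_split -sumrN/=.
apply: eq_bigr => j _; case: ifPn => jg; last first.
  (* At a load bus, without rotor, [om j t * F j t] is itself minus the damping term. *)
  rewrite -[F j t]opprK -load_om// load_mm//; ring.
have Mj : Mi j != 0 by rewrite gt_eqF// Mi_gt0.
have tj : tau j != 0 by rewrite gt_eqF// tau_gt0.
have kj : kk j != 0 by rewrite gt_eqF// kk_gt0.
by field; rewrite Mj tj kj.
Qed.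

Lemma storage_primitive : primitive storage (fun t => - dissipation t).
Proof.
have lhs f f' : loc_bounded f -> loc_bounded f' -> loc_bounded (fun t => f t * f' t).
  exact: loc_boundedM.
have lcross i j : loc_bounded (fun t => w i j * (g i j t - g i j (t - T i j))).
  by apply/loc_boundedZ/loc_boundedB => //; exact: loc_bounded_shift (lg i j).
have P1 : primitive
   (fun t => \sum_j (((zt j t - rz j t) ^+ 2 / 2 + rz j t ^+ 2 / 2) +
          ((pt j t - rp j t) ^+ 2 / 2 + rp j t ^+ 2 / 2)))
   (fun t => \sum_j (((zt j t - rz j t) * A j t + rz j t * (- rz j t + A j t)) +
          ((pt j t - rp j t) * (- mm j t + B j t) +
            rp j t * (- rp j t - mm j t + B j t)))).
  apply: primitive_sum => j _.
    by apply: loc_boundedD; apply: loc_boundedD; apply: lhs => //; exact: loc_boundedB.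
  apply: primitiveD.
  - by apply: loc_boundedD; apply: lhs => //; exact: loc_boundedB.
  - by apply: loc_boundedD; apply: lhs => //; exact: loc_boundedB.
  - apply: primitiveD; [apply: lhs => //; exact: loc_boundedB|exact: lhs| |].
      by apply: (primitive_half_sqr (lA j)) => //; exact: loc_boundedB.
    exact: primitive_half_sqr.
  - apply: primitiveD; [apply: lhs => //; exact: loc_boundedB|exact: lhs| |].
      by apply: (primitive_half_sqr (lq' j)) => //; exact: loc_boundedB.
    exact: primitive_half_sqr.
have P2 : primitive
   (fun t => 4^-1 * \sum_j \sum_(i | adj i j) w i j * energy T U V i j t)
   (fun t => 4^-1 * \sum_j \sum_(i | adj i j) w i j * (g i j t - g i j (t - T i j))).
  apply: primitiveZ; first by do 2 apply: loc_bounded_sum => ? _.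
  apply: primitive_sum => [j _|j _]; first by apply: loc_bounded_sum.
  apply: primitive_sum => [i _|i ij] //.
  apply: primitiveZ.
    by apply: loc_boundedB => //; exact: loc_bounded_shift (lg i j).
  by apply: (primitive_window _ (lg i j)); exact: T_ge0.
have P3 : primitive
   (fun t => \sum_(j in gen)
      (Mi j * (om j t ^+ 2 / 2) + tau j / kk j * (mm j t ^+ 2 / 2)))
   (fun t => \sum_(j in gen) (
    Mi j * (om j t * ((Mi j)^-1 * (mm j t - La j * om j t - F j t))) +
    tau j / kk j * (mm j t *
      ((tau j)^-1 * (kk j * (pt j t - om j t - dQ j (mm j t))))))).
  apply: primitive_sum => j jg.
    by apply: loc_boundedD; apply: loc_boundedZ; apply: lhs => //;
      [exact: lom'|exact: lmm'].
  apply: primitiveD.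
  - by apply: loc_boundedZ; apply: lhs => //; exact: lom'.
  - by apply: loc_boundedZ; apply: lhs => //; exact: lmm'.
  - apply: primitiveZ; first by apply: lhs => //; exact: lom'.
    by apply: primitive_half_sqr => //; [exact: lom'|exact: om_primitive'].
  - apply: primitiveZ; first by apply: lhs => //; exact: lmm'.
    by apply: primitive_half_sqr => //; [exact: lmm'|exact: mm_primitive'].
have P4 : primitive (fun t => \sum_(e in line) Y e * line_energy (es e) (et e t))
    (fun t => \sum_(e in line) Y e * ((sin (es e + et e t) - sin (es e)) *
    (om e.1 t - om e.2 t))).
  apply: primitive_sum => e el.
    by apply/loc_boundedZ/lhs; [exact: lsin|exact: loc_boundedB].
  apply: primitiveZ; first by apply: lhs; [exact: lsin|exact: loc_boundedB].
  apply: (@primitive_comp _ _ (fun x => sin (es e + x) - sin (es e)) 1).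
  - exact: line_energy_quadratic.
  - move=> x y; rewrite mul1r (_ : _ - _ - _ = sin (es e + x) - sin (es e + y)).
      by rewrite (le_trans (sin_lipschitz _ _))// (_ : es e + x - _ = x - y)//; ring.
    by ring.
  - exact: loc_boundedB.
  - exact: lsin.
  - exact: et_primitive.
have l1 : loc_bounded (fun t =>
    \sum_j (((zt j t - rz j t) * A j t + rz j t * (- rz j t + A j t)) +
          ((pt j t - rp j t) * (- mm j t + B j t) +
            rp j t * (- rp j t - mm j t + B j t)))).
  apply: loc_bounded_sum => j _.
  by apply: loc_boundedD; apply: loc_boundedD; apply: lhs => //; exact: loc_boundedB.
have l2 : loc_bounded (fun t => 4^-1 * \sum_j \sum_(i | adj i j)
    w i j * (g i j t - g i j (t - T i j))).
  by apply: loc_boundedZ; do 2 apply: loc_bounded_sum => ? _.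
have l3 : loc_bounded (fun t => \sum_(j in gen) (
    Mi j * (om j t * ((Mi j)^-1 * (mm j t - La j * om j t - F j t))) +
    tau j / kk j * (mm j t *
      ((tau j)^-1 * (kk j * (pt j t - om j t - dQ j (mm j t))))))).
  apply: loc_bounded_sum => j jg.
  by apply: loc_boundedD; apply: loc_boundedZ; apply: lhs => //;
    [exact: lom'|exact: lmm'].
have l4 : loc_bounded (fun t => \sum_(e in line) Y e *
    ((sin (es e + et e t) - sin (es e)) * (om e.1 t - om e.2 t))).
  apply: loc_bounded_sum => e el.
  by apply/loc_boundedZ/lhs; [exact: lsin|exact: loc_boundedB].
have := primitiveD (loc_boundedD (loc_boundedD l1 l2) l3) l4
  (primitiveD (loc_boundedD l1 l2) l3 (primitiveD l1 l2 P1 P2) P3) P4.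
by apply: eq_primitive => // t t0; exact: storage_rate.
Qed.

Let storageE t : 0 <= t -> storage t + intco dissipation 0 t = storage 0.
Proof.
move=> t0; have := storage_primitive (lexx 0) t0.
have -> : intco (fun t => - dissipation t) 0 t = - intco dissipation 0 t.
  rewrite -mulN1r -(intcoZ loc_bounded_dissipation).
  by apply: intco_eq => s _; rewrite mulN1r.
lra.
Qed.

(** Strict convexity of the costs provides no quadratic lower bound; monotonicity of [dQ j] still
    keeps the turbine dissipation away from 0 when |x| >= e, which is all that Barbalat's lemma
    asks. *)
Let mm_dQ_gt j e x : j \in gen -> 0 < e -> e <= `|x| ->
  e * Num.min (dQ j e) (- dQ j (- e)) <= x * dQ j x.
Proof.
move=> jg e0 ex.
have mono a b : a <= b -> dQ j a <= dQ j b.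
  by rewrite le_eqVlt => /predU1P[->//|/(dQ_incr jg)/ltW].
have de : 0 < dQ j e by rewrite -(dQ0 jg) dQ_incr.
have dNe : dQ j (- e) < 0 by rewrite -(dQ0 jg) dQ_incr// oppr_lt0.
have [x0|x0] := leP 0 x.
  rewrite ger0_norm// in ex; have := mono _ _ ex => h.
  apply: ler_pM => //; first exact: ltW.
    by rewrite le_min (ltW de) oppr_ge0 ltW.
  by rewrite ge_min h.
rewrite ltr0_norm// lerNr in ex; have h := mono _ _ ex.
rewrite -[leRHS]mulrNN; apply: ler_pM => //; first exact: ltW.
- by rewrite le_min (ltW de) oppr_ge0 ltW.
- by rewrite lerNr.
- by rewrite ge_min lerN2 h orbT.
Qed.

Let mm_dQ_ge0 j x : j \in gen -> 0 <= x * dQ j x.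
Proof.
move=> jg; have [->|x0] := eqVneq x 0; first by rewrite mul0r.
have e0 : 0 < `|x| by rewrite normr_gt0.
apply: le_trans (mm_dQ_gt jg e0 (lexx _)).
rewrite mulr_ge0// le_min oppr_ge0.
have := dQ_incr jg e0; have := dQ_incr jg (x := - `|x|) (y := 0).
by rewrite oppr_lt0 (dQ0 jg) => /(_ e0)/ltW -> /ltW ->.
Qed.

Let node_diss j t := La j * om j t ^+ 2 + (rz j t ^+ 2 + rp j t ^+ 2).

Let node_diss_ge0 j t : 0 <= node_diss j t.
Proof. by rewrite addr_ge0 ?addr_ge0 ?sqr_ge0// mulr_ge0 ?sqr_ge0// ltW. Qed.

Let node_diss_le j t : node_diss j t <= dissipation t.
Proof.
rewrite /dissipation -/(node_diss _ _) (bigD1 j)//= -addrA lerDl addr_ge0//.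
  by apply: sumr_ge0 => i _; exact: node_diss_ge0.
by apply: sumr_ge0 => i ig; exact: mm_dQ_ge0.
Qed.

Let mm_dQ_le j t : j \in gen -> mm j t * dQ j (mm j t) <= dissipation t.
Proof.
move=> jg; rewrite /dissipation addrC [X in _ <= X + _](bigD1 j)//= -addrA lerDl.
rewrite addr_ge0//; apply: sumr_ge0 => i ig; last exact: node_diss_ge0.
by apply: mm_dQ_ge0; case/andP: ig.
Qed.

Let dissipation_ge0 t : 0 <= dissipation t.
Proof.
by apply: addr_ge0; apply: sumr_ge0 => i ig; [exact: node_diss_ge0|exact: mm_dQ_ge0].
Qed.

Let storage_le t : 0 <= t -> storage t <= storage 0.
Proof.
move=> t0; rewrite -(storageE t0) lerDl; apply: intco_ge0 => s _.
exact: dissipation_ge0.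
Qed.

Let state_sto t := \sum_j (((zt j t - rz j t) ^+ 2 / 2 + rz j t ^+ 2 / 2) +
          ((pt j t - rp j t) ^+ 2 / 2 + rp j t ^+ 2 / 2)).
Let wave_sto t := 4^-1 * \sum_j \sum_(i | adj i j) w i j * energy T U V i j t.
Let gen_sto t := \sum_(j in gen)
  (Mi j * (om j t ^+ 2 / 2) + tau j / kk j * (mm j t ^+ 2 / 2)).
Let line_sto t := \sum_(e in line) Y e * line_energy (es e) (et e t).

Let half_sqr_ge0 (x : R) : 0 <= x ^+ 2 / 2.
Proof. by rewrite divr_ge0 ?sqr_ge0. Qed.

Let node_sto_ge0 j t : 0 <= ((zt j t - rz j t) ^+ 2 / 2 + rz j t ^+ 2 / 2) +
          ((pt j t - rp j t) ^+ 2 / 2 + rp j t ^+ 2 / 2).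
Proof. by do !apply: addr_ge0. Qed.

Let state_sto_ge0 t : 0 <= state_sto t.
Proof. by apply: sumr_ge0 => j _; exact: node_sto_ge0. Qed.

Let energy_ge0 i j t : 0 <= energy T U V i j t.
Proof. by apply: intco_ge0 => s _; rewrite addr_ge0 ?sqr_ge0. Qed.

Let wave_sto_ge0 t : 0 <= wave_sto t.
Proof.
apply: mulr_ge0 => //; apply: sumr_ge0 => j _; apply: sumr_ge0 => i ij.
by rewrite mulr_ge0 ?energy_ge0// ltW// w_gt0.
Qed.

Let gen_node_ge0 j t : j \in gen ->
  0 <= Mi j * (om j t ^+ 2 / 2) /\ 0 <= tau j / kk j * (mm j t ^+ 2 / 2).
Proof.
move=> jg; have Mj := Mi_gt0 jg; have tj := tau_gt0 jg; have kj := kk_gt0 jg.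
split; first by rewrite mulr_ge0// ltW.
by rewrite mulr_ge0// divr_ge0// ltW.
Qed.

Let gen_sto_ge0 t : 0 <= gen_sto t.
Proof.
apply: sumr_ge0 => j jg; have [h1 h2] := gen_node_ge0 t jg; exact: addr_ge0.
Qed.

Let line_energy_nonneg e x : e \in line -> `|x| <= dl ->
  0 <= Y e * line_energy (es e) x.
Proof.
move=> el xd; rewrite mulr_ge0 ?(ltW (Y_gt0 el))// line_energy_ge0//.
by have := es_dl el; lra.
Qed.

(** There is no circularity, as the decrease of [storage] holds without any bound on the angles. At
    an instant when one deviation has size [dl] and the others at most [dl], no term of [storage] is
    negative, so [barrier] would put it above its initial value. *)
Lemma eta_trapped t e : 0 <= t -> e \in line -> `|et e t| < dl.
Proof.
move=> t0; move: e; apply: (trapped dl_gt0 et_continuous et_init _ t0).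
move=> s s0 hs e el; apply/eqP => Es.
have := storage_le s0; apply/negP; rewrite -ltNge.
apply: lt_le_trans (barrier el Es) _.
have : Y e * line_energy (es e) (et e s) <= line_sto s.
  rewrite /line_sto (bigD1 e)//= lerDl; apply: sumr_ge0 => i /andP[il _].
  exact/line_energy_nonneg/hs.
have := state_sto_ge0 s; have := wave_sto_ge0 s; have := gen_sto_ge0 s.
by rewrite /storage -/(state_sto s) -/(wave_sto s) -/(gen_sto s) -/(line_sto s); lra.
Qed.

Let parts_le t : 0 <= t -> [/\ state_sto t <= storage 0,
  wave_sto t <= storage 0 & gen_sto t <= storage 0].
Proof.
move=> t0; have : 0 <= line_sto t.
  apply: sumr_ge0 => e el; apply: line_energy_nonneg => //.
  exact/ltW/eta_trapped.
have := state_sto_ge0 t; have := wave_sto_ge0 t; have := gen_sto_ge0 t.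
have := storage_le t0.
rewrite {1}/storage -/(state_sto t) -/(wave_sto t) -/(gen_sto t) -/(line_sto t).
by move=> *; split; lra.
Qed.

Let node_sto_le j t : 0 <= t ->
  ((zt j t - rz j t) ^+ 2 / 2 + rz j t ^+ 2 / 2) +
  ((pt j t - rp j t) ^+ 2 / 2 + rp j t ^+ 2 / 2) <= storage 0.
Proof.
move=> t0; have [h _ _] := parts_le t0; apply: le_trans h.
by rewrite /state_sto (bigD1 j)//= lerDl; apply: sumr_ge0 => i _; exact: node_sto_ge0.
Qed.

Let rz_bounded j : ge0_bounded (rz j).
Proof.
apply: (@ge0_bounded_sqr _ _ 2^-1 (storage 0)) => // t t0.
have := node_sto_le j t0; have := half_sqr_ge0 (zt j t - rz j t).
by have := half_sqr_ge0 (pt j t - rp j t); have := half_sqr_ge0 (rp j t); lra.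
Qed.

Let rp_bounded j : ge0_bounded (rp j).
Proof.
apply: (@ge0_bounded_sqr _ _ 2^-1 (storage 0)) => // t t0.
have := node_sto_le j t0; have := half_sqr_ge0 (zt j t - rz j t).
by have := half_sqr_ge0 (pt j t - rp j t); have := half_sqr_ge0 (rz j t); lra.
Qed.

Let zm_bounded j : ge0_bounded (fun t => zt j t - rz j t).
Proof.
apply: (@ge0_bounded_sqr _ _ 2^-1 (storage 0)) => // t t0.
have := node_sto_le j t0; have := half_sqr_ge0 (rp j t).
by have := half_sqr_ge0 (pt j t - rp j t); have := half_sqr_ge0 (rz j t); lra.
Qed.

Let q_bounded j : ge0_bounded (fun t => pt j t - rp j t).
Proof.
apply: (@ge0_bounded_sqr _ _ 2^-1 (storage 0)) => // t t0.
have := node_sto_le j t0; have := half_sqr_ge0 (rp j t).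
by have := half_sqr_ge0 (zt j t - rz j t); have := half_sqr_ge0 (rz j t); lra.
Qed.

Let zt_bounded j : ge0_bounded (zt j).
Proof.
have -> : zt j = fun t => (zt j t - rz j t) + rz j t.
  by apply/funext => t; ring.
exact: ge0_boundedD.
Qed.

Let pt_bounded j : ge0_bounded (pt j).
Proof.
have -> : pt j = fun t => (pt j t - rp j t) + rp j t.
  by apply/funext => t; ring.
exact: ge0_boundedD.
Qed.

Let F_bounded j : ge0_bounded (F j).
Proof.
rewrite /F /netflow; under eq_fun do rewrite -mulN1r.
have fl e : ge0_bounded (fun t => flow_dev (et ^~ t) e).
  apply: ge0_boundedZ; exists 2 => t _.
  rewrite (le_trans (ler_normB _ _))//.
  by have := sin_max (es e + et e t); have := sin_max (es e); lra.
by apply: ge0_boundedD; [|apply: ge0_boundedZ]; apply: ge0_bounded_sum.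
Qed.

Let gen_node_le j t : j \in gen -> 0 <= t ->
  Mi j * (om j t ^+ 2 / 2) + tau j / kk j * (mm j t ^+ 2 / 2) <= storage 0.
Proof.
move=> jg t0; have [_ _ h] := parts_le t0; apply: le_trans h.
rewrite /gen_sto (bigD1 j)//= lerDl; apply: sumr_ge0 => i /andP[ig _].
by have [h1 h2] := gen_node_ge0 t ig; exact: addr_ge0.
Qed.

(** Load frequencies do not enter [storage]; they are bounded through the flows, since sine is
    bounded. *)
Let om_bounded j : ge0_bounded (om j).
Proof.
have [jg|jg] := boolP (j \in gen).
  apply: (@ge0_bounded_sqr _ _ (Mi j / 2) (storage 0)) => [|t t0].
    by rewrite divr_gt0// Mi_gt0.
  have := gen_node_le jg t0; have [_] := gen_node_ge0 t jg; lra.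
have [K FK] := F_bounded j; exists (K / La j) => t t0.
rewrite ler_pdivlMr// -[X in _ * X]gtr0_norm// -normrM mulrC load_om//.
by rewrite normrN FK.
Qed.

Let mm_bounded j : ge0_bounded (mm j).
Proof.
have [jg|jg] := boolP (j \in gen); last first.
  by exists 0 => t t0; rewrite load_mm// normr0.
apply: (@ge0_bounded_sqr _ _ (tau j / kk j / 2) (storage 0)) => [|t t0].
  by rewrite !divr_gt0// ?tau_gt0// kk_gt0.
have := gen_node_le jg t0; have [+ _] := gen_node_ge0 t jg; lra.
Qed.

Let dissipation_bound t : 0 <= t -> intco dissipation 0 t <= storage 0.
Proof.
move=> t0; rewrite -(storageE t0) lerDr.
have : 0 <= line_sto t.
  apply: sumr_ge0 => e el; apply: line_energy_nonneg => //.
  exact/ltW/eta_trapped.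
have := state_sto_ge0 t; have := wave_sto_ge0 t; have := gen_sto_ge0 t.
by rewrite /storage -/(state_sto t) -/(wave_sto t) -/(gen_sto t) -/(line_sto t); lra.
Qed.

Let dissipated (h : R -> R) : ge0_unif_continuous h ->
  (forall e, 0 < e -> exists2 c, 0 < c &
     forall t, 0 <= t -> e <= `|h t| -> c <= dissipation t) ->
  h t @[t --> +oo] --> 0.
Proof.
move=> uh hD; apply: (cvg0_dissipation uh loc_bounded_dissipation) hD => //.
exact: dissipation_bound.
Qed.

Let uc_of_bounded (f f' : R -> R) : loc_bounded f' -> ge0_bounded f' ->
  primitive f f' -> ge0_unif_continuous f.
Proof.
move=> lf' [K f'K] ff'; apply: primitive_unif_continuous ff' _.
exact: small_integrals_bounded f'K.
Qed.

Let ge0_boundedN (f : R -> R) : ge0_bounded f -> ge0_bounded (fun t => - f t).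
Proof. by under eq_fun do rewrite -mulN1r; exact: ge0_boundedZ. Qed.

Let et_uc e : e \in line -> ge0_unif_continuous (et e).
Proof.
move=> el; apply: uc_of_bounded (et_primitive el); first exact: loc_boundedB.
by apply: ge0_boundedD => //; exact: ge0_boundedN.
Qed.

Let flow_lipschitz e s t : e \in line ->
  `|flow_dev (et ^~ s) e - flow_dev (et ^~ t) e| <= Y e * `|et e s - et e t|.
Proof.
move=> el; rewrite /flow_dev -mulrBr normrM gtr0_norm ?Y_gt0//.
rewrite ler_pM2l ?Y_gt0//.
have -> : sin (es e + et e s) - sin (es e) - (sin (es e + et e t) - sin (es e)) =
  sin (es e + et e s) - sin (es e + et e t) by ring.
rewrite (le_trans (sin_lipschitz _ _))//.
by rewrite (_ : es e + _ - _ = et e s - et e t)//; ring.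
Qed.

Let F_uc j : ge0_unif_continuous (F j).
Proof.
rewrite /F /netflow; under eq_fun do rewrite -mulN1r.
have fl e : e \in line -> ge0_unif_continuous (fun t => flow_dev (et ^~ t) e).
  move=> el; apply: unif_continuous_le (et_uc el) => s t; exact: flow_lipschitz.
apply: unif_continuousD; first by apply: unif_continuous_sum => k; exact: fl.
by apply/unif_continuousZ/unif_continuous_sum => k; exact: fl.
Qed.

Let om_uc j : ge0_unif_continuous (om j).
Proof.
have [jg|jg] := boolP (j \in gen).
  apply: uc_of_bounded (om_primitive' jg); first exact: lom'.
  apply: ge0_boundedZ; apply: ge0_boundedD; last exact: ge0_boundedN.
  by apply: ge0_boundedD => //; apply/ge0_boundedN/ge0_boundedZ.
have omE t : 0 <= t -> om j t = - (La j)^-1 * F j t.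
  by move=> t0; rewrite mulNr -mulrN -load_om// mulKf// gt_eqF.
move=> e e0; have [d d0 H] := unif_continuousZ (- (La j)^-1) (F_uc j) e0.
by exists d => // s t s0 st td; rewrite !omE ?H// (le_trans s0 st).
Qed.

Lemma omega_cvg0 j : om j t @[t --> +oo] --> 0.
Proof.
apply: (dissipated (om_uc j)) => e e0.
exists (La j * e ^+ 2) => [|t t0 et']; first by rewrite mulr_gt0// exprn_gt0.
apply: le_trans (node_diss_le j t); apply: (@le_trans _ _ (La j * om j t ^+ 2)).
  rewrite ler_pM2l// -(real_normK (num_real (om j t))).
  by rewrite ler_sqr// nnegrE// ltW.
by rewrite lerDl addr_ge0 ?sqr_ge0.
Qed.

Let dQ_bounded j : j \in gen -> ge0_bounded (fun t => dQ j (mm j t)).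
Proof.
move=> jg; have [K mK] := mm_bounded j.
have mono a b : a <= b -> dQ j a <= dQ j b.
  by rewrite le_eqVlt => /predU1P[->//|/(dQ_incr jg)/ltW].
exists (`|dQ j K| + `|dQ j (- K)|) => t t0.
have := mK t t0; rewrite ler_norml => /andP[/mono h1 /mono h2].
have := ler_norm (dQ j K); have := lerNnormlW (lexx `|dQ j (- K)|).
have := normr_ge0 (dQ j K); have := normr_ge0 (dQ j (- K)).
by rewrite ler_norml => *; apply/andP; split; lra.
Qed.

Let mm_uc j : j \in gen -> ge0_unif_continuous (mm j).
Proof.
move=> jg; apply: uc_of_bounded (mm_primitive' jg); first exact: lmm'.
do 2 apply: ge0_boundedZ; apply: ge0_boundedD; last exact/ge0_boundedN/dQ_bounded.
by apply: ge0_boundedD => //; exact: ge0_boundedN.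
Qed.

Lemma pM_cvg0 j : mm j t @[t --> +oo] --> 0.
Proof.
have [jg|jg] := boolP (j \in gen); last first.
  by apply: (@eq_cvg_ge0 _ (fun=> 0)) => [t t0|]; [rewrite load_mm|exact: cvg_cst].
apply: (dissipated (mm_uc jg)) => e e0.
exists (e * Num.min (dQ j e) (- dQ j (- e))) => [|t t0 et'].
  rewrite mulr_gt0// lt_min oppr_gt0 -(dQ0 jg).
  by rewrite !dQ_incr// oppr_lt0.
exact: le_trans (mm_dQ_gt jg e0 et') (mm_dQ_le t jg).
Qed.

Let energy_bounded i j : adj i j -> ge0_bounded (energy T U V i j).
Proof.
move=> ij; exists (4 * storage 0 / w i j) => t t0.
have wij := w_gt0 ij; rewrite ger0_norm// ler_pdivlMr//.
have [_ h _] := parts_le t0; rewrite -ler_pdivrMl//; apply: le_trans h.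
rewrite /wave_sto ler_wpM2l// (bigD1 j)//= (bigD1 i)//= mulrC -addrA lerDl.
apply: addr_ge0; last apply: sumr_ge0 => b _; apply: sumr_ge0 => a.
  by move=> /andP[aj _]; rewrite mulr_ge0// ltW// w_gt0.
by move=> aj; rewrite mulr_ge0// ltW// w_gt0.
Qed.

Let bounds : exists K : R,
  [/\ forall j t, 0 <= t -> `|zt j t| <= K, forall j t, 0 <= t -> `|pt j t| <= K &
    forall i j, adj i j -> forall t, 0 <= t -> energy T U V i j t <= K].
Proof.
have [K1 K10 zK] := ge0_bounded_unif zt_bounded.
have [K2 K20 pK] := ge0_bounded_unif pt_bounded.
have [|K3 K30 eK] := @ge0_bounded_unif R (N * N)%type
    (fun ij t => if adj ij.1 ij.2 then energy T U V ij.1 ij.2 t else 0).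
  move=> [i j] /=; case E : (adj i j); first exact: energy_bounded E.
  by exists 0 => t _; rewrite normr0.
exists (K1 + (K2 + K3)); split=> [j t t0|j t t0|i j ij t t0].
- by have := zK j t t0; lra.
- by have := pK j t t0; lra.
- have := eK (i, j) t t0; rewrite /= ij => /(le_trans (ler_norm _)); lra.
Qed.

Let lnz j : loc_bounded (fun t => - zt j t).
Proof. exact: loc_boundedN. Qed.

Let lnV i j : loc_bounded (fun t => - V i j t).
Proof. exact: loc_boundedN. Qed.

Let scN := scatters_turn UV_scatters.

(** The inflows contain the waves, which are bounded in mean square only; this replaces the bounded
    derivatives used for [om] and [mm]. *)
Let small_AB j : small_integrals (A j) /\ small_integrals (B j).
Proof.
have [K [zK pK EK]] := bounds; split.
  exact: (small_integrals_inflow _ adjC T_ge0 UV_scatters _ _ _ _ zK pK EK).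
apply: (small_integrals_inflow _ adjC T_ge0 scN _ _ _ _ pK _ _) => //.
- by move=> i t t0; rewrite normrN zK.
- by rewrite energy_turn.
Qed.

Let small_bounded (f : R -> R) : loc_bounded f -> ge0_bounded f -> small_integrals f.
Proof. by move=> lf [K fK]; exact: small_integrals_bounded fK. Qed.

Lemma rhozeta_cvg0 j : rz j t @[t --> +oo] --> 0.
Proof.
apply: dissipated => [|e e0].
  apply: (primitive_unif_continuous (rz_primitive j)).
  apply: small_integralsD => //; first exact: loc_boundedN; last exact: (small_AB j).1.
  by apply: small_bounded; [exact: loc_boundedN|exact: ge0_boundedN].
exists (e ^+ 2) => [|t t0 et']; first by rewrite exprn_gt0.
apply: le_trans (node_diss_le j t); apply: (@le_trans _ _ (rz j t ^+ 2)).
  by rewrite -(real_normK (num_real (rz j t))) ler_sqr// nnegrE// ltW.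
rewrite /node_diss; have := sqr_ge0 (rp j t).
by have := mulr_ge0 (ltW (La_gt0 j)) (sqr_ge0 (om j t)); lra.
Qed.

Lemma rhop_cvg0 j : rp j t @[t --> +oo] --> 0.
Proof.
apply: dissipated => [|e e0].
  apply: (primitive_unif_continuous (rp_primitive j)).
  apply: small_integralsD => //; last exact: (small_AB j).2.
    by apply: loc_boundedB => //; exact: loc_boundedN.
  apply: small_bounded; first by apply: loc_boundedB => //; exact: loc_boundedN.
  by apply: ge0_boundedD; exact: ge0_boundedN.
exists (e ^+ 2) => [|t t0 et']; first by rewrite exprn_gt0.
apply: le_trans (node_diss_le j t); apply: (@le_trans _ _ (rp j t ^+ 2)).
  by rewrite -(real_normK (num_real (rp j t))) ler_sqr// nnegrE// ltW.
rewrite /node_diss; have := sqr_ge0 (rz j t).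
by have := mulr_ge0 (ltW (La_gt0 j)) (sqr_ge0 (om j t)); lra.
Qed.

Let zt_slow j : slowly_varying (zt j).
Proof.
have l1 : loc_bounded (fun t => - rz j t + 2 * A j t).
  by apply: loc_boundedD; [exact: loc_boundedN|exact: loc_boundedZ].
have H : primitive (fun t => zt j t + -2 * rz j t) (rz j).
  have := primitiveD l1 (loc_boundedZ (-2) (lrz' j)) (zt_primitive j)
    (primitiveZ (-2) (lrz' j) (rz_primitive j)).
  by apply: eq_primitive => t _; ring.
apply: (@eq_slow _ (fun t => (zt j t + -2 * rz j t) + 2 * rz j t)) => [t _|].
  by ring.
apply: slowD; first exact: slow_primitive H (rhozeta_cvg0 j).
exact: slow_cvg (cvg0Z 2 (rhozeta_cvg0 j)).
Qed.

Let pt_slow j : slowly_varying (pt j).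
Proof.
have l1 : loc_bounded (fun t => - rp j t - 2 * mm j t + 2 * B j t).
  apply: loc_boundedD; last exact: loc_boundedZ.
  by apply: loc_boundedB; [exact: loc_boundedN|exact: loc_boundedZ].
have H : primitive (fun t => pt j t + -2 * rp j t) (rp j).
  have := primitiveD l1 (loc_boundedZ (-2) (lrp' j)) (pt_primitive j)
    (primitiveZ (-2) (lrp' j) (rp_primitive j)).
  by apply: eq_primitive => t _; ring.
apply: (@eq_slow _ (fun t => (pt j t + -2 * rp j t) + 2 * rp j t)) => [t _|].
  by ring.
apply: slowD; first exact: slow_primitive H (rhop_cvg0 j).
exact: slow_cvg (cvg0Z 2 (rhop_cvg0 j)).
Qed.

Let pt_consensus i j : pt i t - pt j t @[t --> +oo] --> 0.
Proof.
have [K [zK pK EK]] := bounds.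
have [Z _ zZ] := ge0_bounded_unif zm_bounded.
apply: (consensus adjC adj_connected w_gt0 wC T_ge0 UV_scatters _ _ _ _ pK EK
  (m := fun _ _ => 0) (z := fun j t => zt j t - rz j t) (Z := Z)) => //.
- by move=> k; exact: loc_bounded_cst.
- by move=> k; apply: eq_primitive (zm_primitive k) => // t _; rewrite add0r.
- by move=> k; exact: cvg_cst.
Qed.

Let zt_consensus i j : zt i t - zt j t @[t --> +oo] --> 0.
Proof.
have [K [zK pK EK]] := bounds.
have [Z _ qZ] := ge0_bounded_unif q_bounded.
have nzK k t : 0 <= t -> `|- zt k t| <= K by move=> t0; rewrite normrN zK.
have nEK : forall i j, adj i j -> forall t, 0 <= t ->
  energy T (fun i j t => - V i j t) U i j t <= K by rewrite energy_turn.
suff : - zt j t - - zt i t @[t --> +oo] --> 0.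
  by apply: eq_cvg_ge0 => t _; ring.
(* In the turned system [pt - rp] is the integrated state and [- zt] the potential that agrees; the
   power deviation enters as a perturbation [m] tending to 0. *)
apply: (consensus adjC adj_connected w_gt0 wC T_ge0 scN _ _ _ _ nzK nEK
  (m := fun k t => - mm k t) (z := fun j t => pt j t - rp j t) (Z := Z)) => //.
- by move=> k; exact: loc_boundedN.
- move=> k; rewrite -[X in _ --> X]oppr0; exact: cvgN (pM_cvg0 k).
- move=> k; under eq_fun do rewrite -mulN1r; exact: slowZ.
Qed.

Lemma zeta_cvg : exists l : R, forall j, zt j t @[t --> +oo] --> l.
Proof.
have [K [zK pK EK]] := bounds.
apply: (potentials_cvg adjC w_gt0 wC T_ge0 UV_scatters _ _ _ _ EK
  (z := fun j t => zt j t - rz j t)) => //.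
- by move=> j; exact: loc_boundedB.
- move=> j; apply: eq_cvg_ge0 (rhozeta_cvg0 j) => t _; ring.
Qed.

Let dQ_cvg0 j : j \in gen -> dQ j (mm j t) @[t --> +oo] --> 0.
Proof.
move=> jg; rewrite -[X in _ --> X](dQ0 jg).
by apply: continuous_cvg (pM_cvg0 j); exact: dQ_continuous.
Qed.

(** The right-hand side of the turbine equation is slowly varying and is the derivative of a bounded
    function, so it tends to 0; the frequency and the marginal cost vanish in it, leaving the
    price. *)
Let pt_gen_cvg0 j : j \in gen -> pt j t @[t --> +oo] --> 0.
Proof.
move=> jg; pose f t := pt j t - om j t - dQ j (mm j t).
have lf : loc_bounded f.
  by apply: loc_boundedB; [exact: loc_boundedB|exact: ldQ].
have kj := kk_gt0 jg; have tj := tau_gt0 jg.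
have [Z mZ] := mm_bounded j.
have f0 : f t @[t --> +oo] --> 0.
  apply: (@slow_cvg0 _ _ (tau j * (2 * Z) / kk j)) => //.
    apply: (@eq_slow _ (fun t => pt j t + (-1 * om j t + -1 * dQ j (mm j t)))).
      by move=> t _; rewrite /f; ring.
    apply: slowD => //; apply: slowD; apply: slowZ.
      exact: slow_cvg (omega_cvg0 j).
    exact: slow_cvg (dQ_cvg0 jg).
  move=> t h t0 h0; have th : t <= t + h by rewrite lerDl.
  have := mm_primitive jg t0 th; rewrite -/f intcoZ// => E.
  rewrite ler_pdivlMr// -[X in _ * X](gtr0_norm kj) -normrM mulrC -E.
  rewrite -mulrBr normrM gtr0_norm// ler_pM2l//.
  rewrite (le_trans (ler_normB _ _))// mulr2n mulrDl !mul1r lerD// mZ//.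
  exact: le_trans th.
have : f t + (om j t + dQ j (mm j t)) @[t --> +oo] --> 0.
  by apply: cvg0D => //; apply: cvg0D; [exact: omega_cvg0|exact: dQ_cvg0].
by apply: eq_cvg_ge0 => t _; rewrite /f; ring.
Qed.

(** A generator pins the price. In its presence the conservation law for [pt - rp] is perturbed by
    [mm], whose integral is not controlled; without generators [mm] is identically 0, the law is
    exact and the turned form of [potentials_cvg] applies. *)
Lemma pc_cvg : exists l : R, (forall j, pt j t @[t --> +oo] --> l) /\
  (forall j, j \in gen -> l = 0).
Proof.
have [gen0|[j jg]] := set_0Vmem gen; last first.
  exists 0; split=> // i.
  have := cvg0D (pt_consensus i j) (pt_gen_cvg0 jg).
  by apply: eq_cvg_ge0 => t _; ring.
have [K [zK pK EK]] := bounds.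
have nzK k t : 0 <= t -> `|- zt k t| <= K by move=> t0; rewrite normrN zK.
have nEK : forall i j, adj i j -> forall t, 0 <= t ->
  energy T (fun i j t => - V i j t) U i j t <= K by rewrite energy_turn.
suff [l ptl] : exists l : R, forall j, pt j t @[t --> +oo] --> l.
  by exists l; split=> // j; rewrite gen0 inE.
apply: (potentials_cvg adjC w_gt0 wC T_ge0 scN _ _ _ _ nEK
  (z := fun j t => pt j t - rp j t)) => //.
- by move=> j; exact: loc_boundedB.
- move=> j; apply: eq_primitive (q_primitive j) => // t t0.
  by rewrite load_mm ?gen0 ?inE// oppr0 add0r.
- move=> j; apply: eq_cvg_ge0 (rhop_cvg0 j) => t _; ring.
- by move=> i j; apply: eq_cvg_ge0 (zt_consensus j i) => t _; ring.
Qed.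

(** At a generator the rotor equation is treated like that of the turbine: a slowly varying
    derivative of a bounded function. At a load the balance equation reduces the claim to the
    frequency. *)
Lemma netflow_cvg0 j : F j t @[t --> +oo] --> 0.
Proof.
have [jg|jg] := boolP (j \in gen); last first.
  have := cvg0Z (- La j) (omega_cvg0 j).
  by apply: eq_cvg_ge0 => t t0; rewrite mulNr load_om// opprK.
have sF : slowly_varying (F j).
  rewrite /F /netflow; under eq_fun do rewrite -mulN1r.
  have fl e : e \in line -> slowly_varying (fun t => flow_dev (et ^~ t) e).
    move=> el; apply: (@slow_le _ _ (et e) (Y e)) => [s t|]; first exact: flow_lipschitz.
    apply: slow_primitive (et_primitive el) _; first exact: loc_boundedB.
    have := cvg0D (omega_cvg0 e.1) (cvg0Z (-1) (omega_cvg0 e.2)).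
    by apply: eq_cvg_ge0 => t _; ring.
  apply: slowD; first by apply: slow_sum => k; exact: fl.
  by apply/slowZ/slow_sum => k; exact: fl.
pose f t := mm j t - La j * om j t - F j t.
have lf : loc_bounded f.
  by apply: loc_boundedB => //; apply: loc_boundedB => //; exact: loc_boundedZ.
have [Z oZ] := om_bounded j; have Mj := Mi_gt0 jg.
have f0 : f t @[t --> +oo] --> 0.
  apply: (@slow_cvg0 _ _ (Mi j * (2 * Z))) => //.
    apply: (@eq_slow _ (fun t => mm j t + (- La j * om j t + -1 * F j t))).
      by move=> t _; rewrite /f; ring.
    apply: slowD; first exact: slow_cvg (pM_cvg0 j).
    by apply: slowD; apply: slowZ => //; exact: slow_cvg (omega_cvg0 j).
  move=> t h t0 h0; have th : t <= t + h by rewrite lerDl.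
  rewrite -(om_primitive jg t0 th) -mulrBr normrM gtr0_norm// ler_pM2l//.
  rewrite (le_trans (ler_normB _ _))// mulr2n mulrDl !mul1r lerD// oZ//.
  exact: le_trans th.
have : mm j t + (- La j * om j t + -1 * f t) @[t --> +oo] --> 0.
  apply: cvg0D; first exact: pM_cvg0.
  by apply: cvg0D; apply: cvg0Z => //; exact: omega_cvg0.
by apply: eq_cvg_ge0 => t _; rewrite /f; ring.
Qed.

(** Cauchy criterion. Between [s] and [t] the angles change by differences of the potentials x_j,
    the integrals of the frequencies. Pairing these with the change of flow gives, after summation
    by parts, a pairing of [x] with changes of net flow, which is small; strong monotonicity of sine
    bounds it below by squared angle increments. *)
Lemma eta_cvg e : e \in line -> exists l : R, et e t @[t --> +oo] --> l.
Proof.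
move=> el; apply: cauchy_cvg_pinfty => eps eps0.
have [j0 _|noN] := pickP (fun _ : N => true); last by have := noN e.1.
have [c c0 cP] := sin_strongly_monotone (ltW dl_gt0) (es_dl el).
have /choice[C CP] : forall j, exists C : R, 0 <= C /\ forall (x : N -> R) d,
    (forall a b, Defs.adjacent line a b -> `|x a - x b| <= d) ->
    `|x j - x j0| <= C * d.
  by move=> j; have [C C0 CP] := @connect_diff_bound R N _ line_connected j j0; exists C.
have d2 : 0 <= 2 * dl by rewrite mulr_ge0// ltW.
pose G t := \sum_j C j * (2 * dl) * `|F j t|.
have G0 : G t @[t --> +oo] --> 0.
  apply: cvg_sum0 => j _; apply: cvg0Z.
  by rewrite -[X in _ --> X](normr0 R); apply: cvg_norm; exact: netflow_cvg0.
(* Half of the final bound, as [G] is used both at [s] and at [t]. *)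
have Yc : 0 < Y e * c * eps ^+ 2 / 2.
  by rewrite divr_gt0// !mulr_gt0 ?exprn_gt0// Y_gt0.
have [t0 t00 Gt] := (cvg_at_pinftyP _ _).1 G0 _ Yc.
exists t0 => //.
suff H s t : t0 <= s -> s <= t -> `|et e t - et e s| <= eps.
  move=> s t ts tt; have [st|/ltW st] := leP s t; last exact: H.
  by rewrite distrC; exact: H.
move=> t0s st; have s0 := le_trans t00 t0s; have t0t := le_trans t0s st.
have t0' := le_trans t00 t0t.
pose x j := intco (om j) s t.
have etE a : a \in line -> et a t - et a s = x a.1 - x a.2.
  by move=> al; rewrite (et_primitive al)// intcoB.
have xd a b : Defs.adjacent line a b -> `|x a - x b| <= 2 * dl.
  have xab u : u \in line -> `|x u.1 - x u.2| <= 2 * dl.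
    move=> ul; rewrite -etE// (le_trans (ler_normB _ _))//.
    by have := eta_trapped s0 ul; have := eta_trapped t0' ul; lra.
  by move=> /orP[/xab//|/xab /=]; rewrite distrC.
pose dfl a := flow_dev (et ^~ t) a - flow_dev (et ^~ s) a.
have dF j : netflow line dfl j = F j t - F j s.
  by rewrite /F /netflow /dfl !sumrB; ring.
have term a : a \in line -> 0 <= dfl a * (x a.1 - x a.2).
  move=> al; have [k k0 kP] := sin_strongly_monotone (ltW dl_gt0) (es_dl al).
  have := kP _ _ (ltW (eta_trapped t0' al)) (ltW (eta_trapped s0 al)).
  rewrite -etE// /dfl /flow_dev -mulrBr -mulrA => h.
  apply: mulr_ge0; first exact/ltW/Y_gt0.
  apply: le_trans (mulr_ge0 (ltW k0) (sqr_ge0 _)) (le_trans h _).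
  by rewrite le_eqVlt; apply/orP; left; apply/eqP; ring.
have total : \sum_(a in line) dfl a * (x a.1 - x a.2) <= Y e * c * eps ^+ 2.
  rewrite summation_by_parts.
  (* The net flows sum to 0, so [x] may be recentred at [j0]; its differences are then bounded along
     paths, each line contributing at most [2 * dl] by trapping. *)
  have -> : \sum_j x j * netflow line dfl j =
      \sum_j (x j - x j0) * (F j t - F j s).
    transitivity (\sum_j x j * netflow line dfl j - x j0 * \sum_j netflow line dfl j).
      by rewrite sum_netflow mulr0 subr0.
    by rewrite mulr_sumr -sumrB; apply: eq_bigr => j _; rewrite dF; ring.
  apply: (@le_trans _ _ (G t + G s)).
    rewrite /G -big_split; apply: ler_sum => j _ /=.
    rewrite -mulrDr (le_trans (ler_norm _))// normrM.
    by apply: ler_pM => //; [exact: (CP j).2|exact: ler_normB].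
  have := Gt t t0t; have := Gt s t0s; rewrite !subr0.
  by move=> /(le_trans (ler_norm _)) h1 /(le_trans (ler_norm _)) h2; lra.
have own : Y e * (c * (et e t - et e s) ^+ 2) <= Y e * c * eps ^+ 2.
  apply: le_trans total; rewrite (bigD1 e)//=.
  apply: (@le_trans _ _ (dfl e * (x e.1 - x e.2))); last first.
    by rewrite lerDl; apply: sumr_ge0 => a /andP[al _]; exact: term.
  rewrite -etE// /dfl /flow_dev -mulrBr -mulrA ler_pM2l ?Y_gt0//.
  apply: le_trans (cP _ _ (ltW (eta_trapped t0' el)) (ltW (eta_trapped s0 el))) _.
  by rewrite le_eqVlt; apply/orP; left; apply/eqP; ring.
move: own; rewrite mulrA ler_pM2l ?mulr_gt0 ?Y_gt0//.
rewrite -(real_normK (num_real (et e t - et e s))).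
by rewrite ler_sqr// nnegrE ltW.
Qed.

Theorem closed_loop_cvg :
  [/\ forall j, [/\ om j t @[t --> +oo] --> 0, mm j t @[t --> +oo] --> 0,
       rz j t @[t --> +oo] --> 0 & rp j t @[t --> +oo] --> 0],
      exists l : R, forall j, zt j t @[t --> +oo] --> l,
      exists l : R, (forall j, pt j t @[t --> +oo] --> l) /\
        (forall j, j \in gen -> l = 0),
      forall e, e \in line -> exists l : R, et e t @[t --> +oo] --> l
    & forall j, netflow line (flow_dev (et ^~ t)) j @[t --> +oo] --> 0].
Proof.
split; [|exact: zeta_cvg|exact: pc_cvg|exact: eta_cvg|exact: netflow_cvg0].
move=> j; split; [exact: omega_cvg0|exact: pM_cvg0|exact: rhozeta_cvg0|].
exact: rhop_cvg0.
Qed.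

End ClosedLoop.

(** * Trajectories of the network *)

Section Convexity.
Context {R : realType}.
Implicit Types (f : R -> R) (a b : R).

(** By convexity, a fraction [s] of the way from [a] to [b] has a slope no larger than the whole
    way, and for small [s] this slope is close to the derivative at [a]. *)
Lemma convex_tangent f a b : derivable f a 1 -> strictly_convex f ->
  f a + derive1 f a * (b - a) <= f b.
Proof.
move=> df cf; have [->|ba] := eqVneq b a; first by rewrite subrr mulr0 addr0.
pose d := b - a; have d0 : d != 0 by rewrite subr_eq0.
have nd : 0 < `|d| by rewrite normr_gt0.
apply/ler_addgt0Pl => e e0; rewrite -/d.
have /cvgrPdist_lt/(_ (e / `|d|) (divr_gt0 e0 nd)) [r /= r0 rP] :
    h^-1 *: ((f \o shift a) (h *: 1) - f a) @[h --> 0^'] --> 'D_1 f a by exact: df.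
(* The first term keeps [s] below 1, the second keeps [s * d] within the radius [r] of the
   difference quotient. *)
pose s := Num.min (2^-1) (r / 2 / `|d|).
have s0 : 0 < s by rewrite lt_min invr_gt0 ltr0n/= !divr_gt0.
have s1 : s < 1.
  have : s <= 2^-1 by rewrite ge_min lexx.
  by lra.
have sd0 : s * d != 0 by rewrite mulf_neq0// gt_eqF.
have sdr : `|0 - s * d| < r.
  rewrite sub0r normrN normrM gtr0_norm//.
  have : s <= r / 2 / `|d| by rewrite ge_min lexx orbT.
  by rewrite ler_pdivlMr//; lra.
have := rP _ sdr sd0; rewrite -derive1E.
have := cf b a s; rewrite ba s0 s1 => /(_ isT isT).
have -> : s * b + (1 - s) * a = (s * d) *: 1 + a.
  by rewrite /d /GRing.scale/=; ring.
move=> conv H.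
have {}H : `|derive1 f a * d - (f ((s * d) *: 1 + a) - f a) / s| < e.
  have -> : derive1 f a * d - (f ((s * d) *: 1 + a) - f a) / s =
     (derive1 f a - (s * d)^-1 *: (f ((s * d) *: 1 + a) - f a)) * d.
    rewrite /GRing.scale/=; field; rewrite d0/= gt_eqF//.
  by rewrite normrM -ltr_pdivlMr.
have : (f ((s * d) *: 1 + a) - f a) / s <= f b - f a.
  by rewrite ler_pdivrMr//; lra.
move: H; rewrite ltr_norml => /andP[_]; lra.
Qed.

(** The tangents at [a] and [b] lie below [f] at the midpoint, where [f] is strictly below the
    chord. *)
Lemma strictly_convex_derive1 f : (forall a, derivable f a 1) ->
  strictly_convex f -> {homo derive1 f : a b / a < b}.
Proof.
move=> df cf a b ab; pose m := 2^-1 * a + (1 - 2^-1) * b.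
have am : m - a = (b - a) / 2 by rewrite /m; field.
have bm : m - b = - ((b - a) / 2) by rewrite /m; field.
have h1 := convex_tangent m (df a) cf.
have h2 := convex_tangent m (df b) cf.
have := cf a b 2^-1; rewrite lt_eqF// => /(_ isT); rewrite -/m => h3.
have {}h3 : f m < 2^-1 * f a + (1 - 2^-1) * f b by apply: h3; lra.
have ba : 0 < (b - a) / 2 by rewrite divr_gt0// subr_gt0.
rewrite -(ltr_pM2r ba); move: h1 h2; rewrite am bm; lra.
Qed.

End Convexity.

(** * Solutions in integral form *)

Section Integrates.
Context {R : realType} {N : finType}.
Variables (X : R -> signals R N) (f g : signals R N -> R).
Hypothesis ifg : integrates X f g.

Lemma continuous_max0 : continuous (fun t : R => Num.max 0 t).
Proof.
move=> t; apply: (@continuous_max _ _ (fun=> 0) id); first exact: cvg_cst.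
exact: cvg_id.
Qed.

(** [Num.max 0 t] freezes the states before time 0: the equations govern them from then on only,
    while the calculus above works on the whole line. *)
Lemma integrates_continuous : continuous (fun t : R => f (X (Num.max 0 t))).
Proof.
move=> t; set x : R := Num.max 0 t; pose b := x + 1.
have x0 : 0 <= x by rewrite le_max lexx.
have b0 : 0 <= b by rewrite /b; lra.
have [gi _] := ifg b0.
have /subspace_continuousP cG := parameterized_integral_continuous b0 gi.
have xin : `[0, b]%classic x by rewrite /= in_itv /= x0 /b; lra.
have /cvgrPdist_le H := cG x xin.
apply/cvgrPdist_le => e e0; have := H e e0; rewrite near_withinE => He.
have cmax : Num.max 0 s @[s --> t] --> x by exact: continuous_max0.
pose G (y : R) := \int[lebesgue_measure]_(u in `[0, y]) g (X u).
have He' : \forall s \near t, `[0, b]%classic (Num.max 0 s) ->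
    `|G x - G (Num.max 0 s)| <= e by exact: (cmax _ He).
have xb : \forall s \near t, Num.max 0 s < b.
  have : \forall y \near x, y < b by apply: lt_nbhsl; rewrite /b; lra.
  exact: cmax.
move: He' xb; apply: filterS2 => s He' sb.
have s0 : 0 <= Num.max 0 s by rewrite le_max lexx.
rewrite -/x (ifg x0).2 (ifg s0).2.
have -> (I0 I1 I2 : R) : I0 + I1 - (I0 + I2) = I1 - I2 by ring.
by apply: He'; rewrite /= in_itv /= s0 ltW.
Qed.

Lemma integrates_primitive (h : R -> R) (c : R) : loc_bounded h ->
  (forall t, 0 <= t -> g (X t) = h t) ->
  primitive (fun t : R => f (X (Num.max 0 t)) - c) h.
Proof.
move=> lh gh; have E t : 0 <= t -> f (X t) = f (X 0) + intco h 0 t.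
  move=> t0; rewrite (ifg t0).2; congr (_ + _).
  rewrite -Rintegral_itv_bndo_bndc.
    by apply: eq_Rintegral => s; rewrite inE /= in_itv /= => /andP[s0 _]; exact: gh.
  apply: integrableS (ifg t0).1 => // u /=.
  by rewrite !in_itv /= => /andP[-> /ltW].
move=> s t s0 st; have t0 := le_trans s0 st; rewrite !max_r// (E t)// (E s)//.
by rewrite (intco_split lh s0 st); ring.
Qed.

End Integrates.

(** * Symmetric wave variables of the network *)

Section Waves.
Context {R : realType} {N : finType}.
Variable S : network R N.
Hypothesis wfS : well_formed S.
Implicit Types (x : signals R N) (i j : N).

Definition wsign i j : R := if (i, j) \in comm S then Num.sqrt 2 else - Num.sqrt 2.
Definition wave0 x i j : R := wsign i j * sout x i j 0 0.
Definition wave1 x i j : R := wsign i j * sout x i j 1 0.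

Let s2 : Num.sqrt 2 != 0 :> R.
Proof. by rewrite gt_eqF// sqrtr_gt0. Qed.

Lemma wsignC i j : Defs.adjacent (comm S) i j -> wsign j i = - wsign i j.
Proof.
rewrite /wsign => /orP[] ij; rewrite ij (negbTE (comm_oriented wfS ij))//.
by rewrite opprK.
Qed.

Lemma scattering_waves x i j : scattering S x -> Defs.adjacent (comm S) i j ->
  [/\ rp x j i = zeta x i - wave0 x i j,
      rzeta x j i = - pc x i - wave1 x i j,
      wsign i j * sinc x i j 0 0 = wave0 x i j - 2 * zeta x i
    & wsign i j * sinc x i j 1 0 = wave1 x i j + 2 * pc x i].
Proof.
move=> sc; rewrite /wave0 /wave1 /wsign /rp /rzeta => /orP[] ij.
  have [-> -> _ _] := sc i j ij; rewrite ij /y !mxE /=.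
  by split; field.
have [_ _ -> ->] := sc j i ij; rewrite (negbTE (comm_oriented wfS ij)) /y !mxE /=.
by split; field.
Qed.

Lemma Es_mul (v : 'cV[R]_2) : (Es *m v) 0 0 = - v 1 0 /\ (Es *m v) 1 0 = v 0 0.
Proof.
split; rewrite mxE !big_ord_recl big_ord0 !mxE /= addr0.
  rewrite mul0r add0r mulN1r; congr (- v _ _); exact/val_inj.
rewrite mul1r mul0r addr0; congr (v _ _); exact/val_inj.
Qed.

Lemma transmission_waves (X : R -> signals R N) i j t :
  transmission S X -> Defs.adjacent (comm S) i j -> 0 <= t ->
  scattering S (X t) ->
  wave0 (X t) i j = wave1 (X (t - delay S j i)) j i + 2 * zeta (X t) i /\
  wave1 (X t) i j = - wave0 (X (t - delay S j i)) j i - 2 * pc (X t) i.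
Proof.
move=> tr ij t0 sc; have [_ _ h1 h2] := scattering_waves sc ij.
have E : sinc (X t) i j = Es *m sout (X (t - delay S j i)) j i.
  by move: ij => /orP[] ij; have [] := tr t t0 _ _ ij.
have [e1 e2] := Es_mul (sout (X (t - delay S j i)) j i).
move: h1 h2; rewrite E e1 e2 /wave0 /wave1 (wsignC ij) => h1 h2.
by split; lra.
Qed.

End Waves.

Section WaveBounds.
Context {R : realType} {N : finType}.
Variables (adj : rel N) (T : N -> N -> R).
Hypothesis adjC : symmetric adj.
Hypothesis T_ge0 : forall i j, adj i j -> 0 <= T i j.

(* Step by step over the round trip time of an edge; an instantaneous round trip
   determines the waves algebraically. *)
Lemma scatters_bounded (zt pt : N -> R -> R) (U V : N -> N -> R -> R) (K : R) :
  scatters adj T zt pt U V ->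
  (forall j, loc_bounded (zt j)) -> (forall j, loc_bounded (pt j)) ->
  (forall i j, adj i j -> forall t, - T i j <= t < 0 ->
     `|U i j t| <= K /\ `|V i j t| <= K) ->
  forall i j, adj i j -> forall b : R, exists L : R, forall t,
    - T i j <= t -> t <= b -> `|U i j t| <= L /\ `|V i j t| <= L.
Proof.
move=> sc lz lp UK i j ij b; have ji : adj j i by rewrite adjC.
have [Zi Zi0 ziP] := loc_bounded_ge0 b (lz i).
have [Zj Zj0 zjP] := loc_bounded_ge0 b (lz j).
have [Pi Pi0 piP] := loc_bounded_ge0 b (lp i).
have [Pj Pj0 pjP] := loc_bounded_ge0 b (lp j).
pose Z := Zi + Zj + Pi + Pj.
have inb t : 0 <= t -> t <= b -> `|t| <= b by move=> t0; rewrite ger0_norm.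
have bd t : 0 <= t -> t <= b ->
    [/\ `|zt i t| <= Z, `|zt j t| <= Z, `|pt i t| <= Z & `|pt j t| <= Z].
  move=> t0 tb; have h := inb t t0 tb.
  have := ziP t h; have := zjP t h; have := piP t h; have := pjP t h.
  by rewrite /Z; split; lra.
have Tij := T_ge0 ij; have Tji := T_ge0 ji.
have [T0|T0] := leP (T i j + T j i) 0.
  have Tij0 : T i j = 0 by lra.
  have Tji0 : T j i = 0 by lra.
  exists (2 * Z) => t; rewrite Tij0 oppr0 => t0 tb.
  have [h1 h2] := sc i j ij t t0; have [h3 h4] := sc j i ji t t0.
  rewrite Tji0 subr0 in h1 h2; rewrite Tij0 subr0 in h3 h4.
  have [b1 b2 b3 b4] := bd t t0 tb.
  have -> : U i j t = zt i t - pt j t by lra.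
  have -> : V i j t = - (zt j t + pt i t) by lra.
  rewrite normrN; split; [have := ler_normB (zt i t) (pt j t)|
    have := ler_normD (zt j t) (pt i t)]; lra.
have Z0 : 0 <= Z by rewrite /Z; lra.
have triD (a c : R) : `|a + 2 * c| <= `|a| + 2 * `|c|.
  by have := ler_normD a (2 * c); rewrite normrM [`|2|]ger0_norm.
have triB (a c : R) : `|- a - 2 * c| <= `|a| + 2 * `|c|.
  by have := ler_normB (- a) (2 * c); rewrite normrN normrM [`|2|]ger0_norm.
(* A round trip consists of two reflections, each adding at most [2 * Z]; hence [4 * Z] per step. *)
suff step (n : nat) t : - T i j <= t -> t < n%:R * (T i j + T j i) -> t <= b ->
    `|U i j t| <= K + n%:R * (4 * Z) /\ `|V i j t| <= K + n%:R * (4 * Z).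
  exists (K + (Num.truncn (b / (T i j + T j i))).+1%:R * (4 * Z)) => t tT tb.
  apply: step => //; apply: le_lt_trans tb _.
  by rewrite -ltr_pdivrMr// truncnS_gt.
elim: n t => [|n IH] t tT tn tb.
  rewrite mul0r in tn; rewrite mul0r addr0; apply: UK => //.
  by rewrite tT tn.
have [t0|t0] := ltP t 0.
  have [//|h1 h2] := UK i j ij t; first by rewrite tT t0.
  have : 0 <= n.+1%:R * (4 * Z) by rewrite !mulr_ge0.
  by split; lra.
have [h1 h2] := sc i j ij t t0; have [b1 b2 b3 b4] := bd t t0 tb.
suff [d1 d2] : `|V j i (t - T j i)| <= K + n%:R * (4 * Z) + 2 * Z /\
    `|U j i (t - T j i)| <= K + n%:R * (4 * Z) + 2 * Z.
  rewrite h1 h2 -[n.+1%:R]natr1 [(n%:R + 1) * _]mulrDl mul1r; split.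
    by apply: le_trans (triD _ _) _; lra.
  by apply: le_trans (triB _ _) _; lra.
have [s0|s0] := ltP (t - T j i) 0.
  have [|h3 h4] := UK j i ji (t - T j i); first by rewrite s0 andbT; lra.
  have : 0 <= n%:R * (4 * Z) by rewrite !mulr_ge0.
  by split; lra.
have sb : t - T j i <= b by lra.
have [h3 h4] := sc j i ji _ s0; have [c1 c2 c3 c4] := bd _ s0 sb.
have [] := IH (t - T j i - T i j); first by lra.
- by rewrite -natr1 mulrDl mul1r in tn; lra.
- by lra.
move=> h5 h6; rewrite h3 h4; split.
  by apply: le_trans (triB _ _) _; lra.
by apply: le_trans (triD _ _) _; lra.
Qed.

End WaveBounds.

(** * Equilibria: synchrony, power balance, optimality *)

Section Equilibrium.
Context {R : realType} {N : finType}.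
Variable S : network R N.
Hypothesis wfS : well_formed S.
Implicit Types (x : signals R N) (i j : N).

Let adj := Defs.adjacent (comm S).

Lemma adjacentC (E : {set N * N}) : symmetric (Defs.adjacent E).
Proof. by move=> i j; rewrite /Defs.adjacent orbC. Qed.

Lemma comm_pE x j : scattering S x ->
  comm_p S x j = \sum_(i | adj i j) alpha S i j * (zeta x j - wave0 S x j i - pc x j).
Proof.
move=> sc; apply: eq_bigr => i ij; have ji : adj j i by rewrite /adj adjacentC.
by have [-> _ _ _] := scattering_waves wfS sc ji.
Qed.

Lemma comm_zetaE x j : scattering S x -> comm_zeta S x j =
  - \sum_(i | adj i j) alpha S i j * (pc x j + wave1 S x j i + zeta x j).
Proof.
move=> sc; rewrite -sumrN; apply: eq_bigr => i ij.
have ji : adj j i by rewrite /adj adjacentC.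
by have [_ -> _ _] := scattering_waves wfS sc ji; ring.
Qed.

Lemma imbalanceE x j : imbalance S x j =
  - demand S j - damping S j * omega x j -
  netflow (line S) (fun e => flow S x e.1 e.2) j.
Proof. by rewrite /imbalance /netflow; ring. Qed.

Section Facts.
Variable x : signals R N.
Hypothesis eq_x : equilibrium S x.

Let power : power_dynamics (vanishes x) S. Proof. by case: eq_x => -[]. Qed.
Let gendyn : gen_dynamics (vanishes x) S (gen_input S).
Proof. by case: eq_x => -[]. Qed.
Let ctrl : controller_dynamics (vanishes x) S. Proof. by case: eq_x => -[]. Qed.
Let balance : load_balance S x. Proof. by case: eq_x. Qed.
Let scat : scattering S x. Proof. by case: eq_x. Qed.

Lemma equilibrium_waves i j : adj i j ->
  wave0 S x i j = zeta x i - pc x j /\ wave1 S x i j = - zeta x j - pc x i.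
Proof.
move=> ij; have ji : adj j i by rewrite /adj adjacentC.
have tr : transmission S (fun=> x) by case: eq_x.
have [h1 h2] := transmission_waves wfS tr ij (lexx 0) scat.
have [h3 h4] := transmission_waves wfS tr ji (lexx 0) scat.
by split; lra.
Qed.

Lemma equilibrium_rho j :
  [/\ rhozeta x j = 0, comm_p S x j = 0, rhop x j = 0 &
      comm_zeta S x j = demand S j - pM x j].
Proof.
have [h1 h2 h3 h4] := ctrl j; move: h1 h2 h3 h4; rewrite /vanishes => *.
by split; lra.
Qed.

Let alpha_gt0' i j : adj i j -> 0 < alpha S i j. Proof. exact: alpha_gt0. Qed.
Let alphaC' i j : adj i j -> alpha S i j = alpha S j i. Proof. exact: alphaC. Qed.

(** At rest the signal received from [i] is [pc x i], so [comm_p] becomes a graph Laplacian of [pc],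
    and it vanishes. *)
Lemma equilibrium_pc i j : pc x i = pc x j.
Proof.
apply: (laplacian_eq0 (adj := adj) (adjacentC _) (comm_connected wfS)
  alpha_gt0' alphaC') => k.
have [_ + _ _] := equilibrium_rho k; rewrite comm_pE// => {2}<-.
apply: eq_bigr => l lk; have kl : adj k l by rewrite /adj adjacentC.
by rewrite (equilibrium_waves kl).1; ring.
Qed.

Lemma equilibrium_comm_zeta j :
  comm_zeta S x j = \sum_(i | adj i j) alpha S i j * (zeta x i - zeta x j).
Proof.
rewrite comm_zetaE// -sumrN; apply: eq_bigr => l lk.
have kl : adj j l by rewrite /adj adjacentC.
by rewrite (equilibrium_waves kl).2; ring.
Qed.

Lemma equilibrium_supply : \sum_j pM x j = \sum_j demand S j.
Proof.
have : \sum_j comm_zeta S x j = 0.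
  rewrite (eq_bigr (fun j => \sum_(i | adj i j) alpha S i j * zeta x i -
      \sum_(i | adj i j) alpha S i j * zeta x j)); last first.
    move=> j _; rewrite equilibrium_comm_zeta -sumrB.
    by apply: eq_bigr => i _; ring.
  rewrite sumrB (exchange_adj (adjacentC _)); apply/eqP; rewrite subr_eq0; apply/eqP.
  by apply: eq_bigr => j _; apply: eq_bigr => i ij; rewrite (alphaC' ij).
rewrite (eq_bigr (fun j => demand S j - pM x j)); last first.
  by move=> j _; have [] := equilibrium_rho j.
by rewrite sumrB => /eqP; rewrite subr_eq0 => /eqP.
Qed.

Lemma equilibrium_node j : pM x j + imbalance S x j = 0.
Proof.
have [jg|jg] := boolP (j \in gen S); first exact: power.2.
by rewrite -balance.1// balance.2// addr0.
Qed.

(** Stationary angles synchronize the frequencies over the connected lines. In the sum of the node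
    balances the flows cancel and supply meets demand, which leaves the total damping, a positive
    number, times the common frequency. *)
Lemma equilibrium_omega j : omega x j = 0.
Proof.
have oE a b : omega x a = omega x b.
  apply: (connect_eq (line_connected wfS)) => {}a {}b.
  by move=> /orP[/power.1|/power.1]; rewrite /vanishes => /eqP;
    rewrite subr_eq0 => /eqP.
have : \sum_i (pM x i + imbalance S x i) = 0.
  by rewrite big1// => i _; exact: equilibrium_node.
rewrite (eq_bigr (fun i => pM x i - demand S i - damping S i * omega x j -
    netflow (line S) (fun e => flow S x e.1 e.2) i)); last first.
  by move=> i _; rewrite imbalanceE (oE j i); ring.
rewrite sumrB sum_netflow subr0 2!sumrB equilibrium_supply subrr sub0r -mulr_suml.
move/eqP; rewrite oppr_eq0 mulf_eq0 => /orP[/eqP D0|/eqP //].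
have : damping S j <= 0.
  rewrite -D0 (bigD1 j)//= lerDl; apply: sumr_ge0 => i _.
  exact/ltW/damping_gt0.
by rewrite leNgt damping_gt0.
Qed.

Lemma equilibrium_price j : j \in gen S ->
  pc x j = derive1 (cost S j) (pM x j).
Proof.
move=> jg; have := gendyn jg; rewrite /vanishes /gen_input equilibrium_omega subr0.
have kgj := kg_gt0 wfS jg; have kcj := kc_gt0 wfS jg.
have -> : - pM x j + kg S j * (kc S j * pc x j + pM x j / kg S j -
    kc S j * derive1 (cost S j) (pM x j)) =
    kg S j * kc S j * (pc x j - derive1 (cost S j) (pM x j)).
  by field; rewrite gt_eqF.
by move/eqP; rewrite !mulf_eq0 (gt_eqF kgj) (gt_eqF kcj)/= subr_eq0 => /eqP.
Qed.

(** The common value of [pc] is the multiplier of the balance constraint: it equals every marginal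
    cost, and multiplied by the change of supply it adds nothing on feasible points, so the tangent
    inequalities sum to optimality. *)
Lemma equilibrium_optimal :
  (forall j, j \in gen S ->
     continuously_differentiable (cost S j) /\ strictly_convex (cost S j)) ->
  solves_OGR S (pM x).
Proof.
move=> A1.
have feas : OGR_feasible S (pM x).
  rewrite /OGR_feasible -equilibrium_supply big_mkcond; apply: eq_bigr => j _.
  by case: ifPn => // jg; rewrite balance.2.
split=> // q fq; have [g0|[k kg]] := set_0Vmem (gen S).
  by rewrite g0 !big_set0.
have -> : \sum_(j in gen S) cost S j (pM x j) =
    \sum_(j in gen S) (cost S j (pM x j) + pc x k * (q j - pM x j)).
  rewrite big_split/= -mulr_sumr sumrB fq feas subrr mulr0 addr0//.
apply: ler_sum => j jg; have [[dj _] cj] := A1 j jg.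
by rewrite (equilibrium_pc k j) equilibrium_price//; exact: convex_tangent.
Qed.

End Facts.
End Equilibrium.

(** * From a solution of the network to its deviations *)

Section Trajectory.
Context {R : realType} {N : finType}.
Variable S : network R N.
Hypothesis wfS : well_formed S.
Hypothesis costS : forall j, j \in gen S ->
  continuously_differentiable (cost S j) /\ strictly_convex (cost S j).
Variable xe : signals R N.
Hypothesis eq_xe : equilibrium S xe.
Variable X : R -> signals R N.
Hypothesis solX : solution S X.

Let adj := Defs.adjacent (comm S).

Definition dev (f : signals R N -> R) t := f (X (Num.max 0 t)) - f xe.
Definition eta_dev e := dev (fun x => Defs.eta x e).
Definition omega_dev j := dev (fun x => omega x j).
Definition pM_dev j := dev (fun x => pM x j).
Definition rhozeta_dev j := dev (fun x => rhozeta x j).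
Definition zeta_dev j := dev (fun x => zeta x j).
Definition rhop_dev j := dev (fun x => rhop x j).
Definition pc_dev j := dev (fun x => pc x j).

(* Waves older than the initial content of the channels are irrelevant and are
   replaced by 0. *)
Definition wave_dev (f : signals R N -> N -> N -> R) i j t :=
  if adj i j && (- delay S i j <= t) then f (X t) i j - f xe i j else 0.

Definition price_dev j (p : R) :=
  derive1 (cost S j) (pM xe j + p) - derive1 (cost S j) (pM xe j).
Definition line_gain (e : N * N) := suscept S e.1 e.2.
Definition gen_gain j := kg S j * kc S j.
Definition flow_deviation (x : N * N -> R) := flow_dev line_gain (Defs.eta xe) x.

Variable k : R.
Hypothesis window_k : forall i j, adj i j -> forall t, - delay S i j <= t < 0 ->
  forall l, `|sout (X t) i j l 0 - sout xe i j l 0| <= k.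

Let dyn : closed_loop_dynamics (integrates X) S. Proof. by case: solX. Qed.
Let power : power_dynamics (integrates X) S. Proof. by case: dyn. Qed.
Let gendyn : gen_dynamics (integrates X) S (gen_input S). Proof. by case: dyn. Qed.
Let ctrl : controller_dynamics (integrates X) S. Proof. by case: dyn. Qed.
Let alg t : 0 <= t -> load_balance S (X t) /\ scattering S (X t).
Proof. by case: solX => _ + _ _; exact. Qed.
Let tr : transmission S X. Proof. by case: solX. Qed.
Let balance_xe : load_balance S xe. Proof. by case: eq_xe. Qed.
Let scat_xe : scattering S xe. Proof. by case: eq_xe. Qed.
Let max0_ge0 (t : R) : 0 <= Num.max 0 t. Proof. by rewrite le_max lexx. Qed.
Let max0_id (t : R) : 0 <= t -> Num.max 0 t = t. Proof. by move=> ?; rewrite max_r. Qed.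

Let dev_continuous f g : integrates X f g -> continuous (dev f).
Proof.
by move=> ifg t; apply: cvgB; [exact: (integrates_continuous ifg)|exact: cvg_cst].
Qed.

Let dev_continuousZ (c : R) f g : c != 0 -> integrates X (fun x => c * f x) g ->
  continuous (dev f).
Proof.
move=> c0 ifg t; have -> : dev f = fun t => c^-1 * dev (fun x => c * f x) t.
  by apply/funext => s; rewrite /dev -mulrBr mulKf.
by apply: cvgM; [exact: cvg_cst|exact: (dev_continuous ifg)].
Qed.

Lemma eta_dev_continuous e : e \in line S -> continuous (eta_dev e).
Proof. by case: e => i j /power.1; exact: dev_continuous. Qed.

Lemma rhozeta_dev_continuous j : continuous (rhozeta_dev j).
Proof. by have [h _ _ _] := ctrl j; exact: dev_continuous h. Qed.

Lemma zeta_dev_continuous j : continuous (zeta_dev j).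
Proof. by have [_ h _ _] := ctrl j; exact: dev_continuous h. Qed.

Lemma rhop_dev_continuous j : continuous (rhop_dev j).
Proof. by have [_ _ h _] := ctrl j; exact: dev_continuous h. Qed.

Lemma pc_dev_continuous j : continuous (pc_dev j).
Proof. by have [_ _ _ h] := ctrl j; exact: dev_continuous h. Qed.

Let netflow_dev j t := netflow (line S) (flow_deviation (eta_dev ^~ t)) j.

Let netflow_devE j t : netflow_dev j t =
  netflow (line S) (fun e => flow S (X (Num.max 0 t)) e.1 e.2) j -
  netflow (line S) (fun e => flow S xe e.1 e.2) j.
Proof.
have E e : flow_deviation (eta_dev ^~ t) e =
    flow S (X (Num.max 0 t)) e.1 e.2 - flow S xe e.1 e.2.
  case: e => a b; rewrite /flow_deviation /flow_dev /flow /line_gain /=.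
  have -> : Defs.eta xe (a, b) + eta_dev (a, b) t =
      Defs.eta (X (Num.max 0 t)) (a, b) by rewrite /eta_dev /dev; ring.
  by ring.
rewrite /netflow_dev /netflow; under eq_bigr do rewrite E.
by under [X in _ - X]eq_bigr do rewrite E; rewrite !sumrB; ring.
Qed.

Let imbalance_dev j t : imbalance S (X (Num.max 0 t)) j - imbalance S xe j =
  - damping S j * omega_dev j t - netflow_dev j t.
Proof. by rewrite netflow_devE !imbalanceE /omega_dev /dev; ring. Qed.

Lemma load_omega_dev j t : j \notin gen S ->
  damping S j * omega_dev j t = - netflow_dev j t.
Proof.
move=> jg; have := imbalance_dev j t.
have [[h _] _] := alg (max0_ge0 t).
by rewrite -(h j jg) -(balance_xe.1 j jg); lra.
Qed.

Lemma load_pM_dev j t : j \notin gen S -> pM_dev j t = 0.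
Proof.
move=> jg; have [[_ h] _] := alg (max0_ge0 t).
by rewrite /pM_dev /dev h// balance_xe.2// subrr.
Qed.

Lemma pM_dev_continuous j : continuous (pM_dev j).
Proof.
have [jg|jg] := boolP (j \in gen S); last first.
  rewrite (_ : pM_dev j = fun=> 0); first by move=> t; exact: cvg_cst.
  by apply/funext => t; exact: load_pM_dev.
by apply: dev_continuousZ (gendyn jg); rewrite gt_eqF// turbine_gt0.
Qed.

Let netflow_dev_continuous j : continuous (netflow_dev j).
Proof.
have fc e : e \in line S -> continuous (fun t => flow_deviation (eta_dev ^~ t) e).
  move=> el t; apply: cvgM; first exact: cvg_cst.
  apply: cvgB; last exact: cvg_cst.
  apply: continuous_cvg; first exact: continuous_sin.
  by apply: cvgD; [exact: cvg_cst|exact: eta_dev_continuous].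
move=> t; apply: cvgB; apply: cvg_big => //.
- exact: add_continuous.
- by move=> i ij; exact: fc.
- exact: add_continuous.
- by move=> i ij; exact: fc.
Qed.

Lemma omega_dev_continuous j : continuous (omega_dev j).
Proof.
have [jg|jg] := boolP (j \in gen S).
  by apply: dev_continuousZ (power.2 j jg); rewrite gt_eqF// inertia_gt0.
have dj : damping S j != 0 by rewrite gt_eqF// damping_gt0.
rewrite (_ : omega_dev j = fun t => - (damping S j)^-1 * netflow_dev j t).
  by move=> t; apply: cvgM; [exact: cvg_cst|exact: netflow_dev_continuous].
by apply/funext => t; rewrite mulNr -mulrN -load_omega_dev// mulKf.
Qed.

Let adjC : symmetric adj. Proof. exact: adjacentC. Qed.

Lemma waves_scatter :
  scatters adj (delay S) zeta_dev pc_dev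
    (wave_dev (wave0 S)) (wave_dev (wave1 S)).
Proof.
move=> i j ij t t0; have ji : adj j i by rewrite adjC.
have Tij := delay_ge0 wfS ij.
have [_ sct] := alg t0.
have [h1 h2] := transmission_waves wfS tr ij t0 sct.
have [w1 w2] := equilibrium_waves wfS eq_xe ij.
have [w3 w4] := equilibrium_waves wfS eq_xe ji.
rewrite /wave_dev ij ji /= (_ : - delay S i j <= t); last by lra.
rewrite (_ : - delay S j i <= t - delay S j i); last by lra.
rewrite /zeta_dev /pc_dev /dev max0_id//.
by split; lra.
Qed.

Let wave_window (l : 'I_2) i j t : adj i j -> - delay S i j <= t < 0 ->
  `|wsign S i j * sout (X t) i j l 0 - wsign S i j * sout xe i j l 0| <=
    Num.sqrt 2 * k.
Proof.
move=> ij tT; rewrite -mulrBr normrM.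
have -> : `|wsign S i j| = Num.sqrt 2.
  by rewrite /wsign; case: ifP => _; rewrite ?normrN ger0_norm// sqrtr_ge0.
by rewrite ler_wpM2l ?sqrtr_ge0// window_k.
Qed.

Let waves_window i j : adj i j -> forall t, - delay S i j <= t < 0 ->
  `|wave_dev (wave0 S) i j t| <= Num.sqrt 2 * k /\
  `|wave_dev (wave1 S) i j t| <= Num.sqrt 2 * k.
Proof.
move=> ij t tT; have /andP[t1 _] := tT.
by rewrite /wave_dev ij t1; split; exact: wave_window.
Qed.

Let loc_bounded_wave (f : signals R N -> N -> N -> R) i j :
  measurable_fun [set: R] (fun t => f (X t) i j) \/ ~~ adj i j ->
  (forall b : R, adj i j -> exists L : R, forall t,
    - delay S i j <= t -> t <= b -> `|wave_dev f i j t| <= L) ->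
  loc_bounded (wave_dev f i j).
Proof.
move=> mf bf; have [ij|nij] := boolP (adj i j); last first.
  apply: eq_loc_bounded (loc_bounded_cst 0) => t.
  by rewrite /wave_dev (negbTE nij).
case: mf => [mf|]; last by rewrite ij.
split.
  rewrite /wave_dev ij /=; apply: measurable_fun_ifT => //.
    by apply: measurable_fun_ler => //; exact: measurable_cst.
  by apply: measurable_funB.
move=> b; have [L LP] := bf b ij; exists `|L| => t tb.
have [t1|t1] := boolP (- delay S i j <= t); last first.
  by rewrite /wave_dev (negbTE t1) andbF normr0.
rewrite (le_trans (LP t t1 _)) ?ler_norm//.
exact: le_trans (ler_norm _) tb.
Qed.

Let wave_measurable (l : 'I_2) i j :
  measurable_fun [set: R] (fun t => wsign S i j * sout (X t) i j l 0) \/ ~~ adj i j.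
Proof.
have [ij|nij] := boolP (adj i j); [left|by right].
by apply: measurable_funM => //; case: solX => _ _ _; exact.
Qed.

(** [solution] grants measurability of the waves only; local bounds are propagated from the initial
    window through the scattering relations. *)
Let waves_bounded i j b : adj i j -> exists L : R, forall t,
    - delay S i j <= t -> t <= b ->
  `|wave_dev (wave0 S) i j t| <= L /\ `|wave_dev (wave1 S) i j t| <= L.
Proof.
move=> ij; apply: (scatters_bounded adjC (delay_ge0 wfS) waves_scatter _ _ waves_window).
- by move=> a; apply: loc_bounded_continuous; exact: zeta_dev_continuous.
- by move=> a; apply: loc_bounded_continuous; exact: pc_dev_continuous.
- exact: ij.
Qed.

Lemma loc_bounded_wave0 i j : loc_bounded (wave_dev (wave0 S) i j).
Proof.
apply: loc_bounded_wave; first exact: wave_measurable.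
move=> b ij; have [L LP] := waves_bounded b ij; exists L => t t1 t2.
exact: (LP t t1 t2).1.
Qed.

Lemma loc_bounded_wave1 i j : loc_bounded (wave_dev (wave1 S) i j).
Proof.
apply: loc_bounded_wave; first exact: wave_measurable.
move=> b ij; have [L LP] := waves_bounded b ij; exists L => t t1 t2.
exact: (LP t t1 t2).2.
Qed.

Let U := wave_dev (wave0 S).
Let V := wave_dev (wave1 S).
Let A := inflow adj (alpha S) zeta_dev pc_dev U.
Let B := inflow adj (alpha S) pc_dev (fun j t => - zeta_dev j t) (fun i j t => - V i j t).

Let leta e : e \in line S -> loc_bounded (eta_dev e).
Proof. by move=> el; exact/loc_bounded_continuous/eta_dev_continuous. Qed.
Let lomega j : loc_bounded (omega_dev j).
Proof. exact/loc_bounded_continuous/omega_dev_continuous. Qed.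
Let lpM j : loc_bounded (pM_dev j).
Proof. exact/loc_bounded_continuous/pM_dev_continuous. Qed.
Let lrhozeta j : loc_bounded (rhozeta_dev j).
Proof. exact/loc_bounded_continuous/rhozeta_dev_continuous. Qed.
Let lzeta j : loc_bounded (zeta_dev j).
Proof. exact/loc_bounded_continuous/zeta_dev_continuous. Qed.
Let lrhop j : loc_bounded (rhop_dev j).
Proof. exact/loc_bounded_continuous/rhop_dev_continuous. Qed.
Let lpc j : loc_bounded (pc_dev j).
Proof. exact/loc_bounded_continuous/pc_dev_continuous. Qed.
Let lnetflow j : loc_bounded (netflow_dev j).
Proof. exact/loc_bounded_continuous/netflow_dev_continuous. Qed.

Let lA j : loc_bounded (A j).
Proof.
apply: loc_bounded_sum => i _; apply: loc_boundedZ.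
by do 2 apply: loc_boundedB => //; exact: loc_bounded_wave0.
Qed.

Let lB j : loc_bounded (B j).
Proof.
apply: loc_bounded_sum => i _; apply: loc_boundedZ.
apply: loc_boundedB; last exact: loc_boundedN.
by apply: loc_boundedB => //; apply: loc_boundedN; exact: loc_bounded_wave1.
Qed.

Let price_dev_continuous j : j \in gen S -> continuous (price_dev j).
Proof.
move=> jg p; apply: cvgB; last exact: cvg_cst.
have [[_ cQ] _] := costS jg; apply: continuous_cvg; first exact: cQ.
by apply: cvgD; [exact: cvg_cst|exact: cvg_id].
Qed.

Let price_dev_incr j : j \in gen S -> {homo price_dev j : x y / x < y}.
Proof.
move=> jg p q pq; rewrite /price_dev ltrD2r.
have [[dj _] cj] := costS jg.
by apply: (strictly_convex_derive1 dj cj); rewrite ltrD2l.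
Qed.

Let price_dev0 j : price_dev j 0 = 0.
Proof. by rewrite /price_dev addr0 subrr. Qed.

Let lprice j : j \in gen S -> loc_bounded (fun t => price_dev j (pM_dev j t)).
Proof.
move=> jg; apply: loc_bounded_continuous => t; apply: continuous_cvg.
  exact: price_dev_continuous.
exact: pM_dev_continuous.
Qed.

Let devE f t : 0 <= t -> f (X t) = dev f t + f xe.
Proof. by move=> t0; rewrite /dev max0_id// subrK. Qed.

Let comm_p_dev j t : 0 <= t -> comm_p S (X t) j = A j t.
Proof.
move=> t0; have [_ sct] := alg t0.
have [_ h _ _] := equilibrium_rho eq_xe j.
rewrite -[LHS]subr0 -h !comm_pE// -sumrB; apply: eq_bigr => i ij.
have ji : adj j i by rewrite adjC.
have Tji := delay_ge0 wfS ji.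
rewrite /U /wave_dev ji /= (_ : - delay S j i <= t); last by lra.
by rewrite /zeta_dev /pc_dev /dev max0_id//; ring.
Qed.

Let comm_zeta_dev j t : 0 <= t ->
  comm_zeta S (X t) j = comm_zeta S xe j - B j t.
Proof.
move=> t0; have [_ sct] := alg t0.
apply/eqP; rewrite -subr_eq0 opprB; apply/eqP.
rewrite !comm_zetaE// -!sumrN -!big_split big1// => i ij.
have ji : adj j i by rewrite adjC.
have Tji := delay_ge0 wfS ji.
rewrite /= /V /wave_dev ji /= (_ : - delay S j i <= t); last by lra.
by rewrite /zeta_dev /pc_dev /dev max0_id//; ring.
Qed.

Let eta_primitive e : e \in line S ->
  primitive (eta_dev e) (fun t => omega_dev e.1 t - omega_dev e.2 t).
Proof.
case: e => i j ij; apply: (integrates_primitive (power.1 i j ij)).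
  exact: loc_boundedB.
move=> t t0; rewrite (devE (fun x => omega x i))// (devE (fun x => omega x j))//.
by rewrite !(equilibrium_omega wfS eq_xe) !addr0.
Qed.

Let omega_primitive j : j \in gen S ->
  primitive (fun t => inertia S j * omega_dev j t)
    (fun t => pM_dev j t - damping S j * omega_dev j t - netflow_dev j t).
Proof.
move=> jg; apply: (@eq_primitive _ (fun t => inertia S j * omega (X (Num.max 0 t)) j -
  inertia S j * omega xe j) _
  (fun t => pM_dev j t - damping S j * omega_dev j t - netflow_dev j t)) => [t _| |];
  last first.
- apply: (integrates_primitive (power.2 j jg)).
    by apply: loc_boundedB => //; apply: loc_boundedB => //; exact: loc_boundedZ.
  move=> t t0; have := imbalance_dev j t; rewrite max0_id// => h.
  rewrite (devE (fun x => pM x j))//.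
  by have := equilibrium_node eq_xe j; rewrite /pM_dev; lra.
- by [].
- by rewrite /omega_dev /dev; ring.
Qed.

Let pM_primitive j : j \in gen S ->
  primitive (fun t => turbine S j * pM_dev j t)
    (fun t => gen_gain j * (pc_dev j t - omega_dev j t - price_dev j (pM_dev j t))).
Proof.
move=> jg; apply: (@eq_primitive _ (fun t => turbine S j * pM (X (Num.max 0 t)) j -
  turbine S j * pM xe j) _ (fun t => gen_gain j *
  (pc_dev j t - omega_dev j t - price_dev j (pM_dev j t)))) => [t _| |]; last first.
- apply: (integrates_primitive (gendyn jg)).
    apply: loc_boundedZ; apply: loc_boundedB; last exact: lprice.
    exact: loc_boundedB.
  move=> t t0; rewrite /gen_input /price_dev /gen_gain.
  have -> : pM xe j + pM_dev j t = pM (X t) j.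
    by rewrite /pM_dev /dev max0_id//; ring.
  rewrite -(equilibrium_price wfS eq_xe jg).
  rewrite /pc_dev /omega_dev /dev max0_id// (equilibrium_omega wfS eq_xe).
  by field; rewrite gt_eqF// kg_gt0.
- by [].
- by rewrite /pM_dev /dev; ring.
Qed.

Let rhozeta_primitive j :
  primitive (rhozeta_dev j) (fun t => - rhozeta_dev j t + A j t).
Proof.
have [h _ _ _] := ctrl j; apply: (integrates_primitive h).
  by apply: loc_boundedD => //; exact: loc_boundedN.
move=> t t0; rewrite comm_p_dev// (devE (fun x => rhozeta x j))//.
by have [-> _ _ _] := equilibrium_rho eq_xe j; rewrite addr0.
Qed.

Let zeta_primitive j :
  primitive (zeta_dev j) (fun t => - rhozeta_dev j t + 2 * A j t).
Proof.
have [_ h _ _] := ctrl j; apply: (integrates_primitive h).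
  by apply: loc_boundedD; [exact: loc_boundedN|exact: loc_boundedZ].
move=> t t0; rewrite comm_p_dev// (devE (fun x => rhozeta x j))//.
by have [-> _ _ _] := equilibrium_rho eq_xe j; rewrite addr0.
Qed.

Let rhop_primitive j :
  primitive (rhop_dev j) (fun t => - rhop_dev j t - pM_dev j t + B j t).
Proof.
have [_ _ h _] := ctrl j; apply: (integrates_primitive h).
  by apply: loc_boundedD => //; apply: loc_boundedB => //; exact: loc_boundedN.
move=> t t0; rewrite comm_zeta_dev// (devE (fun x => rhop x j))//.
rewrite (devE (fun x => pM x j))//.
by have [_ _ -> ->] := equilibrium_rho eq_xe j; rewrite /rhop_dev /pM_dev; ring.
Qed.

Let pc_primitive j :
  primitive (pc_dev j) (fun t => - rhop_dev j t - 2 * pM_dev j t + 2 * B j t).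
Proof.
have [_ _ _ h] := ctrl j; apply: (integrates_primitive h).
  apply: loc_boundedD; last exact: loc_boundedZ.
  by apply: loc_boundedB; [exact: loc_boundedN|exact: loc_boundedZ].
move=> t t0; rewrite comm_zeta_dev// (devE (fun x => rhop x j))//.
rewrite (devE (fun x => pM x j))//.
by have [_ _ -> ->] := equilibrium_rho eq_xe j; rewrite /rhop_dev /pM_dev; ring.
Qed.

Hypothesis eta_k : forall e, e \in line S -> `|eta_dev e 0| <= k.
Hypothesis omega_k : forall j, `|omega_dev j 0| <= k.
Hypothesis pM_k : forall j, `|pM_dev j 0| <= k.
Hypothesis rhozeta_k : forall j, `|rhozeta_dev j 0| <= k.
Hypothesis zeta_k : forall j, `|zeta_dev j 0| <= k.
Hypothesis rhop_k : forall j, `|rhop_dev j 0| <= k.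
Hypothesis pc_k : forall j, `|pc_dev j 0| <= k.

(** Bounds the initial storage over k^2. At a node, squares of differences are at most 4 k^2 and
    squares of states at most k^2, giving 5 in all after halving; the two wave components, each at
    most sqrt 2 k, contribute 4 k^2 per unit of delay, offset by [4^-1]; and [line_energy] is at
    most the square of the deviation. *)
Definition storage_gain : R :=
  \sum_(j : N) 5 + \sum_j \sum_(i | adj i j) alpha S i j * delay S i j +
  \sum_(j in gen S) (inertia S j / 2 + turbine S j / gen_gain j / 2) +
  \sum_(e in line S) line_gain e.

Let line_gain_gt0 e : e \in line S -> 0 < line_gain e.
Proof. by case: e => i j ij; apply: suscept_gt0 => //; rewrite /Defs.adjacent ij. Qed.

Let gen_gain_gt0 j : j \in gen S -> 0 < gen_gain j.
Proof. by move=> jg; rewrite mulr_gt0// ?kg_gt0// kc_gt0. Qed.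

Let adj_alpha_gt0 i j : adj i j -> 0 < alpha S i j. Proof. exact: alpha_gt0. Qed.
Let adj_delay_ge0 i j : adj i j -> 0 <= delay S i j. Proof. exact: delay_ge0. Qed.

Definition trajectory_storage := storage adj (alpha S) (delay S) (gen S) (line S)
  (inertia S) (turbine S) gen_gain line_gain (Defs.eta xe)
  eta_dev omega_dev pM_dev rhozeta_dev zeta_dev rhop_dev pc_dev U V.

Lemma storage_init : trajectory_storage 0 <= storage_gain * k ^+ 2.
Proof.
have sq (x : R) : `|x| <= k -> x ^+ 2 <= k ^+ 2.
  move=> xk; rewrite -(real_normK (num_real x)) ler_sqr// nnegrE.
  exact: le_trans xk.
have sq2 (x y : R) : `|x| <= k -> `|y| <= k -> (x - y) ^+ 2 <= 4 * k ^+ 2.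
  move=> /sq xk /sq yk; have := sqr_ge0 (x + y); rewrite sqrrD sqrrB; lra.
rewrite /trajectory_storage /storage /storage_gain !mulrDl; apply: lerD; first apply: lerD.
- apply: lerD.
    rewrite mulr_suml; apply: ler_sum => j _.
    have := sq2 _ _ (zeta_k j) (rhozeta_k j); have := sq _ (rhozeta_k j).
    have := sq2 _ _ (pc_k j) (rhop_k j); have := sq _ (rhop_k j); lra.
  rewrite mulr_sumr mulr_suml; apply: ler_sum => j _.
  rewrite mulr_sumr mulr_suml; apply: ler_sum => i ij.
  have wij := adj_alpha_gt0 ij; have Tij := adj_delay_ge0 ij.
  have lU := loc_bounded_wave0 i j; have lV := loc_bounded_wave1 i j.
  have -> : alpha S i j * delay S i j * k ^+ 2 =
      4^-1 * (alpha S i j * (4 * k ^+ 2 * delay S i j)) by field.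
  rewrite ler_pM2l ?invr_gt0// ler_pM2l//.
  have -> : 4 * k ^+ 2 * delay S i j =
      intco (fun=> 4 * k ^+ 2) (0 - delay S i j) 0.
    by rewrite intco_cst; [ring|rewrite sub0r oppr_le0].
  apply: intco_le => //.
  - by apply: loc_boundedD; exact: loc_boundedX.
  - exact: loc_bounded_cst.
  move=> s; rewrite sub0r => sT; have [h1 h2] := waves_window ij sT.
  have s2k (x : R) : `|x| <= Num.sqrt 2 * k -> x ^+ 2 <= 2 * k ^+ 2.
    move=> xk; rewrite -(real_normK (num_real x)).
    rewrite -[2 in leRHS](sqr_sqrtr (ler0n _ 2)) -exprMn ler_sqr// nnegrE.
    exact: le_trans xk.
  have := s2k _ h1; have := s2k _ h2; rewrite /U /V; lra.
- rewrite mulr_suml; apply: ler_sum => j jg.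
  have Mj := inertia_gt0 wfS jg; have tj := turbine_gt0 wfS jg.
  have gj := gen_gain_gt0 jg; have tg : 0 < turbine S j / gen_gain j by rewrite divr_gt0.
  have h1 : inertia S j * omega_dev j 0 ^+ 2 <= inertia S j * k ^+ 2.
    by rewrite ler_pM2l// sq.
  have h2 : turbine S j / gen_gain j * pM_dev j 0 ^+ 2 <=
      turbine S j / gen_gain j * k ^+ 2 by rewrite ler_pM2l// sq.
  move: h1 h2; set a := turbine S j / gen_gain j; lra.
- rewrite mulr_suml; apply: ler_sum => e el.
  rewrite ler_pM2l ?line_gain_gt0//.
  exact: le_trans (line_energy_le _ _) (sq _ (eta_k el)).
Qed.

Lemma storage_gain_ge0 : 0 <= storage_gain.
Proof.
apply: addr_ge0; [apply: addr_ge0; [apply: addr_ge0|]|]; apply: sumr_ge0.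
- by [].
- move=> j _; apply: sumr_ge0 => i ij.
  by rewrite mulr_ge0 ?adj_delay_ge0// ltW// adj_alpha_gt0.
- move=> j jg; have Mj := inertia_gt0 wfS jg; have tj := turbine_gt0 wfS jg.
  by rewrite addr_ge0// !divr_ge0// ltW// gen_gain_gt0.
- by move=> e el; exact/ltW/line_gain_gt0.
Qed.

Variable dl : R.
Hypothesis dl_gt0 : 0 < dl.
Hypothesis eta_dl : forall e, e \in line S -> `|Defs.eta xe e| + dl < pi / 2.
Hypothesis k_dl : k < dl.
Hypothesis barrier : forall e x, e \in line S -> `|x| = dl ->
  storage_gain * k ^+ 2 < line_gain e * line_energy (Defs.eta xe e) x.

Lemma trajectory_cvg :
  [/\ forall j, [/\ omega_dev j t @[t --> +oo] --> 0, pM_dev j t @[t --> +oo] --> 0,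
       rhozeta_dev j t @[t --> +oo] --> 0 & rhop_dev j t @[t --> +oo] --> 0],
      exists l : R, forall j, zeta_dev j t @[t --> +oo] --> l,
      exists l : R, (forall j, pc_dev j t @[t --> +oo] --> l) /\
        (forall j, j \in gen S -> l = 0),
      forall e, e \in line S -> exists l : R, eta_dev e t @[t --> +oo] --> l
    & forall j, netflow (line S) (flow_deviation (eta_dev ^~ t)) j
        @[t --> +oo] --> 0].
Proof.
apply: (@closed_loop_cvg R N adj (alpha S) (delay S) adjC (comm_connected wfS)
  adj_alpha_gt0 (alphaC wfS) adj_delay_ge0 (gen S) (line S)
  (inertia S) (damping S) (turbine S) gen_gain line_gain
  (line_connected wfS) (inertia_gt0 wfS) (damping_gt0 wfS) (turbine_gt0 wfS)
  gen_gain_gt0 line_gain_gt0 (Defs.eta xe) dl price_dev dl_gt0 eta_dl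
  price_dev_continuous price_dev_incr (fun j _ => price_dev0 j)
  eta_dev omega_dev pM_dev rhozeta_dev zeta_dev rhop_dev pc_dev U V
  eta_dev_continuous omega_dev_continuous pM_dev_continuous
  rhozeta_dev_continuous zeta_dev_continuous rhop_dev_continuous
  pc_dev_continuous loc_bounded_wave0 loc_bounded_wave1
  eta_primitive omega_primitive (fun j jg t _ => load_omega_dev t jg)
  (fun j jg t _ => load_pM_dev t jg) pM_primitive rhozeta_primitive
  zeta_primitive rhop_primitive pc_primitive waves_scatter).
- by move=> e x el xd; exact: le_lt_trans storage_init (barrier el xd).
- by move=> e el; exact: le_lt_trans (eta_k el) k_dl.
Qed.

End Trajectory.

(** The default value 1 of the minimum covers the case where no index satisfies [P]. *)
Lemma fin_lower_bound (R : realType) (I : finType) (P : pred I) (f : I -> R) :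
  (forall i, P i -> 0 < f i) -> exists2 c : R, 0 < c & forall i, P i -> c <= f i.
Proof.
move=> f0; exists (\big[Num.min/1]_(i | P i) f i).
  by elim/big_ind: _ => // x y x0 y0; rewrite lt_min x0 y0.
by move=> i Pi; exact: bigmin_le_cond.
Qed.

(** * Reconstruction of an equilibrium from the limits *)

Section Limit.
Context {R : realType} {N : finType}.
Variable S : network R N.
Hypothesis wfS : well_formed S.
Variable xe : signals R N.
Hypothesis eq_xe : equilibrium S xe.

(* The waves at rest are read off [r_ij = Es y_i]. *)
Definition rest_signals (et : N * N -> R) (zt pt : N -> R) : signals R N :=
  let yy j := vec2 (zt j) (- pt j) in
  let rr i := vec2 (pt i) (zt i) in
  Signals et (fun=> 0) (pM xe) (fun=> 0) zt (fun=> 0) pt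
    (fun i j => rr i)
    (fun i j => - (wsign S i j)^-1 *: (rr j - yy i))
    (fun i j => - (wsign S i j)^-1 *: (rr j + yy i)).

(** Power balance sees the angles only through the net flows, and the controllers see [zeta] only
    through differences; the price may move only when no generator ties it to a marginal cost. *)
Lemma rest_equilibrium (et : N * N -> R) (l1 l2 : R) :
  (forall j, netflow (line S) (fun e => suscept S e.1 e.2 * sin (et e)) j =
     netflow (line S) (fun e => flow S xe e.1 e.2) j) ->
  (forall j, j \in gen S -> l2 = 0) ->
  equilibrium S (rest_signals et (fun j => zeta xe j + l1) (fun j => pc xe j + l2)).
Proof.
move=> flowE l20; set x := rest_signals _ _ _.
have imbE j : imbalance S x j = imbalance S xe j.
  rewrite !imbalanceE (equilibrium_omega wfS eq_xe) /=; congr (_ - _).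
  rewrite -flowE /netflow; congr (_ - _); apply: eq_bigr => i _;
  by rewrite /flow.
have cp j : comm_p S x j = 0.
  rewrite /comm_p big1// => i ij; rewrite /rp /= !mxE /=.
  by rewrite (equilibrium_pc wfS eq_xe i j) subrr mulr0.
have cz j : comm_zeta S x j = demand S j - pM x j.
  have [_ _ _ <-] := equilibrium_rho eq_xe j.
  rewrite (equilibrium_comm_zeta wfS eq_xe); apply: eq_bigr => i _.
  by rewrite /rzeta /= !mxE /=; ring.
have sc : scattering S x.
  move=> i j ij; rewrite /= /wsign ij (negbTE (comm_oriented wfS ij)).
  by rewrite invrN opprK.
split.
- split.
  + split=> [i j _|j jg]; rewrite /vanishes; first by rewrite subrr.
    by rewrite imbE -(equilibrium_node eq_xe j).
  + move=> j jg; rewrite /vanishes /gen_input /= (l20 j jg) !addr0 subr0.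
    rewrite (equilibrium_price wfS eq_xe jg).
    have kgj := kg_gt0 wfS jg; by field; rewrite gt_eqF.
  + by move=> j; split; rewrite /vanishes ?cp ?cz /=; ring.
- have [_ [b1 b2] _ _] := eq_xe; split=> j jg; last exact: b2.
  by rewrite imbE; exact: b1.
- exact: sc.
- have mat (i j : N) : Defs.adjacent (comm S) i j ->
      sinc x i j = Es *m sout x j i.
    move=> ij; have [e1 e2] := Es_mul (sout x j i).
    have sij := wsignC wfS ij.
    apply/matrixP => a b; rewrite (ord1 b).
    have [->|a1] := eqVneq a 0.
      rewrite e1 /= sij !mxE /= invrN; ring.
    have -> : a = 1.
      by apply/val_inj; case: a a1 => -[|[|]].
    by rewrite e2 /= sij !mxE /= invrN; ring.
  by move=> t _ i j ij; split; apply: mat; rewrite /Defs.adjacent ij ?orbT.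
Qed.

End Limit.

(** * Neighbourhoods in the space of initial conditions *)

Section InitialCondition.
Context {R : realType} {N : finType}.
Variable S : network R N.

Lemma nbhs_pair (T1 T2 : topologicalType) (a : T1) (b : T2) (P : set T1) (Q : set T2) :
  nbhs a P -> nbhs b Q -> nbhs (a, b) [set p | P p.1 /\ Q p.2].
Proof. by move=> aP bQ; exists (P, Q). Qed.

Lemma nbhs_uniform_box (T : choiceType) (D : set T) (f : {uniform` D -> R^o}) (k : R) :
  0 < k -> nbhs f [set h : {uniform` D -> R^o} | forall x, D x -> `|h x - f x| <= k].
Proof.
move=> k0; apply/uniform_nbhs; exists [set xy | ball xy.1 k xy.2].
split; first exact: (entourage_ball _ (PosNum k0)).
by move=> h /= fh x Dx; have := fh x Dx; rewrite /ball /= distrC => /ltW.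
Qed.

Lemma nbhs_uniform_box_cV (T : choiceType) (D : set T) (n : nat)
    (f : {uniform` D -> 'cV[R]_n}) (k : R) : 0 < k ->
  nbhs f [set h : {uniform` D -> 'cV[R]_n} | forall x, D x ->
    forall l, `|h x l 0 - f x l 0| <= k].
Proof.
move=> k0; apply/uniform_nbhs; exists [set xy | ball xy.1 k xy.2].
split; first exact: (entourage_ball _ (PosNum k0)).
move=> h /= fh x Dx l; have := (fh x Dx).2 l 0.
by rewrite /ball /= distrC => /ltW.
Qed.

Definition initial_box (xe : signals R N) (k : R) : set (phase S) :=
  [set p : phase S |
    (forall e, e \in line S -> `|p.1.1.1.1 e - Defs.eta xe e| <= k) /\
    (forall j, `|p.1.1.1.2.1 j - omega xe j| <= k) /\
    (forall j, `|p.1.1.1.2.2 j - pM xe j| <= k) /\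
    (forall j, `|p.1.1.2.1 j - rhozeta xe j| <= k) /\
    (forall j, `|p.1.1.2.2 j - zeta xe j| <= k) /\
    (forall j, `|p.1.2.1 j - rhop xe j| <= k) /\
    (forall j, `|p.1.2.2 j - pc xe j| <= k) /\
    (forall q, channel_window S q ->
      forall l, `|p.2 q l 0 - sout xe q.1.1 q.1.2 l 0| <= k)].

Lemma initial_box_nbhs xe k : 0 < k ->
  nbhs (initial_condition S (fun=> xe)) (initial_box xe k).
Proof.
move=> k0.
have ubox (f : {uniform N -> R^o}) : nbhs f
    [set h : {uniform N -> R^o} | forall x, `|h x - f x| <= k].
  have := nbhs_uniform_box f k0; apply: filterS => h /= fh x; exact: fh.
have H := nbhs_pair (nbhs_pair (nbhs_pair (nbhs_pair
  (nbhs_uniform_box (D := [set e | e \in line S]) (Defs.eta xe) k0)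
  (nbhs_pair (ubox (omega xe)) (ubox (pM xe))))
  (nbhs_pair (ubox (rhozeta xe)) (ubox (zeta xe))))
  (nbhs_pair (ubox (rhop xe)) (ubox (pc xe))))
  (nbhs_uniform_box_cV (D := channel_window S)
    (fun q : N * N * R => sout xe q.1.1 q.1.2) k0).
by apply: filterS H => p /= [[[[h1 [h2 h3]] [h4 h5]] [h6 h7]] h8].
Qed.

End InitialCondition.

Theorem theorem1 (R : realType) (N : finType) (S : network R N)
    (wfS : well_formed S) (A1 : assumption1 S)
    (xe : signals R N) (eq_xe : equilibrium S xe) (A2 : assumption2 S xe) :
  exists Omega : set (phase S),
    [/\ open Omega,
        Omega (initial_condition S (fun=> xe))
      & forall X : R -> signals R N,
          solution S X -> Omega (initial_condition S X) ->
          exists x : signals R N,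
            [/\ equilibrium S x, solves_OGR S (pM x),
                forall j, omega x j = 0 & converges_to S X x]].
Proof.
have costS := A1.1.
have [d d0 dP] : exists2 d : R, 0 < d &
    forall e, e \in line S -> d <= pi / 2 - `|Defs.eta xe e|.
  by apply: fin_lower_bound => -[i j] /A2; rewrite subr_gt0.
(* Half of the smallest margin, so that angles moved by [dl] stay strictly below pi / 2. *)
pose dl := d / 2.
have dl0 : 0 < dl by rewrite divr_gt0.
have eta_dl e : e \in line S -> `|Defs.eta xe e| + dl < pi / 2.
  by move=> /dP; rewrite /dl; lra.
have Y0 e : e \in line S -> 0 < line_gain S e.
  by case: e => i j ij; apply: (suscept_gt0 wfS); rewrite /Defs.adjacent ij.
(* Both signs are needed because [line_energy] is not even in the deviation unless the angle at rest
   has sine 0. *)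
pose barrier e := Num.min (line_gain S e * line_energy (Defs.eta xe e) dl)
  (line_gain S e * line_energy (Defs.eta xe e) (- dl)).
have [c c0 cP] : exists2 c : R, 0 < c & forall e, e \in line S -> c <= barrier e.
  apply: fin_lower_bound => e el; rewrite lt_min.
  have dlN : `|dl| = dl by rewrite gtr0_norm.
  by rewrite !mulr_gt0 ?Y0// line_energy_gt0 ?normrN ?oppr_eq0 ?gt_eqF// dlN eta_dl.
have G0 := storage_gain_ge0 wfS.
(* The first term starts the angles inside the trap, the second gives k^2 <= k, and the third then
   makes the initial storage at most c / 2, below every barrier. *)
pose k := Num.min (dl / 2) (Num.min 1 (c / (2 * (storage_gain S + 1)))).
have G1 : 0 < 2 * (storage_gain S + 1) by lra.
have k0 : 0 < k by rewrite !lt_min ltr01 (divr_gt0 dl0)//= divr_gt0.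
have k1 : k <= 1 by rewrite !ge_min lexx orbT.
have k_dl : k < dl.
  have : k <= dl / 2 by rewrite ge_min lexx.
  by lra.
have kc : storage_gain S * k ^+ 2 < c.
  have : k <= c / (2 * (storage_gain S + 1)) by rewrite !ge_min lexx !orbT.
  rewrite ler_pdivlMr// => h1.
  have h2 : storage_gain S * k ^+ 2 <= storage_gain S * k.
    by rewrite ler_wpM2l// expr2 ler_piMr// ltW.
  by nra.
exists (interior (initial_box xe k)); split.
- exact: open_interior.
- exact: initial_box_nbhs.
move=> X solX /interior_subset [h1 [h2 [h3 [h4 [h5 [h6 [h7 h8]]]]]]].
have max00 : Num.max 0 0 = 0 :> R by rewrite maxxx.
have window i j : Defs.adjacent (comm S) i j -> forall t, - delay S i j <= t < 0 ->
    forall l, `|sout (X t) i j l 0 - sout xe i j l 0| <= k.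
  by move=> ij t tT l; apply: (h8 (i, j, t)).
have e1 e : e \in line S -> `|eta_dev xe X e 0| <= k.
  by move=> el; rewrite /eta_dev /dev max00; exact: h1.
have e2 j : `|omega_dev xe X j 0| <= k by rewrite /omega_dev /dev max00; exact: h2.
have e3 j : `|pM_dev xe X j 0| <= k by rewrite /pM_dev /dev max00; exact: h3.
have e4 j : `|rhozeta_dev xe X j 0| <= k.
  by rewrite /rhozeta_dev /dev max00; exact: h4.
have e5 j : `|zeta_dev xe X j 0| <= k by rewrite /zeta_dev /dev max00; exact: h5.
have e6 j : `|rhop_dev xe X j 0| <= k by rewrite /rhop_dev /dev max00; exact: h6.
have e7 j : `|pc_dev xe X j 0| <= k by rewrite /pc_dev /dev max00; exact: h7.
have wall e x : e \in line S -> `|x| = dl ->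
    storage_gain S * k ^+ 2 < line_gain S e * line_energy (Defs.eta xe e) x.
  move=> el xd; apply: (lt_le_trans kc); apply: le_trans (cP e el) _.
  rewrite /barrier ge_min; have [x0|x0] := leP 0 x.
    by move: xd; rewrite ger0_norm// => ->; rewrite lexx.
  by move: xd; rewrite ltr0_norm// => <-; rewrite opprK lexx orbT.
have [] := trajectory_cvg wfS costS eq_xe solX window e1 e2 e3 e4 e5 e6 e7
  dl0 eta_dl k_dl wall.
move=> states [l1 zl] [l2 [pl l20]] etas net0.
have /choice[le leP] : forall e, exists l : R, e \in line S ->
    eta_dev xe X e t @[t --> +oo] --> l.
  move=> e; have [el|nel] := boolP (e \in line S); last by exists 0.
  by have [l lP] := etas e el; exists l.
pose et e := Defs.eta xe e + le e.
have undev (f : signals R N -> R) l : dev xe X f t @[t --> +oo] --> l ->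
    f (X t) @[t --> +oo] --> f xe + l.
  move=> fl; have : f xe + dev xe X f t @[t --> +oo] --> f xe + l.
    by apply: cvgD => //; exact: cvg_cst.
  by apply: eq_cvg_ge0 => t t0; rewrite /dev max_r//; ring.
(* Flow deviations converge by continuity of sine while their net flows tend to 0; uniqueness of
   limits gives the limit angles the net flows of [xe]. *)
have flowE j : netflow (line S) (fun e => suscept S e.1 e.2 * sin (et e)) j =
    netflow (line S) (fun e => flow S xe e.1 e.2) j.
  have fc e : e \in line S -> flow_deviation S xe (eta_dev xe X ^~ t) e @[t --> +oo] -->
      suscept S e.1 e.2 * (sin (et e) - sin (Defs.eta xe e)).
    move=> el; apply: cvgM; first exact: cvg_cst.
    apply: cvgB; last exact: cvg_cst.
    apply: continuous_cvg; first exact: continuous_sin.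
    by apply: cvgD; [exact: cvg_cst|exact: leP].
  have : netflow (line S) (flow_deviation S xe (eta_dev xe X ^~ t)) j @[t --> +oo] -->
      netflow (line S) (fun e => suscept S e.1 e.2 *
        (sin (et e) - sin (Defs.eta xe e))) j.
    by apply: cvgB; apply: cvg_big => [|i ij]; [exact: add_continuous|exact: fc|
      exact: add_continuous|exact: fc].
  move/(cvg_unique _ (net0 j)) => /(_ (@norm_hausdorff _ _)) E.
  apply/eqP; rewrite -subr_eq0 [X in _ == X]E; apply/eqP.
  rewrite /netflow /flow.
  under [X in _ = X - _]eq_bigr do rewrite mulrBr.
  under [X in _ = _ - X]eq_bigr do rewrite mulrBr.
  rewrite !sumrB /=; ring.
(* Only the states have limits; the waves of [x] are rebuilt from the states at rest. *)
pose x := rest_signals S xe et (fun j => zeta xe j + l1) (fun j => pc xe j + l2).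
exists x; split.
- exact: rest_equilibrium.
- exact: (equilibrium_optimal wfS eq_xe costS).
- by [].
split=> [i j ij|j]; first exact: undev (leP _ ij).
have [s1 s2 s3 s4] := states j.
have om0 := equilibrium_omega wfS eq_xe j; have [rz0 _ rp0 _] := equilibrium_rho eq_xe j.
do !split.
- by have := undev _ _ s1; rewrite om0 addr0.
- by have := undev _ _ s2; rewrite addr0.
- by have := undev _ _ s3; rewrite rz0 addr0.
- exact: undev (zl j).
- by have := undev _ _ s4; rewrite rp0 addr0.
- exact: undev (pl j).
Qed.
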